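(* Let $\sigma\ge0$ and let $\{\psi_\rho\}$ be a family of scaled zonal kernels for which there exist $0<\rho_0<1$, $m\ge\sigma$ and $c_1,c_2>0$ such that, for all $0<\rho<\rho_0$, with $\ell_\rho:=\lfloor\rho^{-1}-1\rfloor$, $$|1-\widehat\psi_\rho(\ell)|\le c_1(\ell\rho)^m\ \ (0\le\ell\le\ell_\rho),\qquad |\widehat\psi_\rho(\ell)|\le c_2\ \ (\ell>\ell_\rho).$$ Let $\Psi_\rho=\Psi_\rho^{\mathrm{div}}+\Psi_\rho^{\mathrm{curl}}$ be the associated matrix-valued kernel and $\mathcal C_{\Psi_\rho}$ the associated convolution operator. Then for any $0\le\tau\le\sigma$ there exists a constant $C>0$, independent of $\rho\in(0,\rho_0)$ and $\mathbf f$, such that for every tangent vector field $\mathbf f\in\mathbf H^\sigma(\mathbb S^2)$ $$\|\mathbf f-\mathcal C_{\Psi_\rho}\mathbf f\|_{\mathbf H^\tau(\mathbb S^2)}\le C\rho^{\sigma-\tau}\|\mathbf f\|_{\mathbf H^\sigma(\mathbb S^2)}.$$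
   Context: $\mathbb S^2$ is the unit sphere in $\mathbb R^3$ with (unnormalized) surface measure $\mu$. $\mathbf L_2(\mathbb S^2)$ is the space of square-integrable tangential vector fields $\mathbf f:\mathbb S^2\to\mathbb R^3$ ($x^\top\mathbf f(x)=0$), with $\langle\mathbf f,\mathbf g\rangle=\int\mathbf f^\top\mathbf g\,d\mu$. $\{Y_{\ell,k}\}_{k=1}^{2\ell+1}$ is a real orthonormal basis of the spherical harmonics of degree $\ell$, $\lambda_\ell=\ell(\ell+1)$; $\nabla_*f(x)=(\mathbf I-xx^\top)\nabla f(x)$, $\mathbf L_*f(x)=x\times\nabla f(x)$; for $\ell\ge1$, $\mathbf y_{\ell,k}=\mathbf L_*Y_{\ell,k}/\sqrt{\lambda_\ell}$ and $\mathbf z_{\ell,k}=\nabla_*Y_{\ell,k}/\sqrt{\lambda_\ell}$ (together an orthonormal basis of $\mathbf L_2(\mathbb S^2)$). Put $\widehat{\mathbf f}^{\mathrm{div}}_{\ell,k}=\langle\mathbf f,\mathbf y_{\ell,k}\rangle$, $\widehat{\mathbf f}^{\mathrm{curl}}_{\ell,k}=\langle\mathbf f,\mathbf z_{\ell,k}\rangle$. For $\sigma\ge0$, $\mathbf H^\sigma(\mathbb S^2)$ is the set of $\mathbf f\in\mathbf L_2(\mathbb S^2)$ with $\|\mathbf f\|^2_{\mathbf H^\sigma(\mathbb S^2)}=\sum_{\ell\ge1}\sum_{k=1}^{2\ell+1}(1+\lambda_\ell)^\sigma(|\widehat{\mathbf f}^{\mathrm{div}}_{\ell,k}|^2+|\widehat{\mathbf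 f}^{\mathrm{curl}}_{\ell,k}|^2)<\infty$. Scaled zonal kernel: for a fixed $\phi\in C[0,\infty)$ and $\rho\in(0,1)$, $\psi_\rho(x\cdot y)=C_{\psi,\rho}\,\phi(\rho^{-1}\|x-y\|)$, $x,y\in\mathbb S^2$, where $C_{\psi,\rho}$ is such that $\int_{\mathbb S^2}\psi_\rho(x\cdot y)\,d\mu(x)=1$; $\psi_\rho$ is regarded as a function on $[-1,1]$, with Fourier–Legendre coefficients $\widehat\psi_\rho(\ell)=2\pi\int_{-1}^1\psi_\rho(t)P_\ell(t)\,dt$ ($P_\ell$ Legendre polynomial, $P_\ell(1)=1$). Matrix kernels: $\kappa(t)=\frac1{4\pi(1-t^2)}\int_{-1}^t(1-4\pi\psi_\rho(s))\,ds$ on $(-1,1)$, extended continuously to $[-1,1]$. With $t=x\cdot y$, $\Psi^{\mathrm{div}}_\rho(x,y)=-\kappa'(t)(x\times y)(x\times y)^\top+\kappa(t)(t\mathbf I-yx^\top)$ and $\Psi^{\mathrm{curl}}_\rho(x,y)=\kappa'(t)(y-tx)(x-ty)^\top+\kappa(t)(\mathbf I-xx^\top)(\mathbf I-yy^\top)$, with values at $x=\pm y$ given by continuous extension. The convolution operator is $(\mathcal C_{\Psi_\rho}\mathbf f)(x)=\int_{\mathbb S^2}\Psi_\rho(x,y)\mathbf f(y)\,d\mu(y)$. *)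

(* Defs.v *)
From HB Require Import structures.
From mathcomp Require Import all_boot all_order all_algebra.
From mathcomp Require mpoly.
From mathcomp Require Import all_classical all_reals all_analysis.
From mathcomp Require Import measurable_realfun.

(* The notations of mpoly clash with those of the analysis library. *)
Import (canonicals, coercions) mpoly.

Set Implicit Arguments.
Unset Strict Implicit.
Unset Printing Implicit Defensive.

Import Order.TTheory GRing.Theory Num.Theory.
Import numFieldNormedType.Exports.

Local Open Scope classical_set_scope.
Local Open Scope ring_scope.

Definition dot (R : realType) (x y : 'cV[R]_3) : R := (x^T *m y) 0 0.

(* The library norm on 'cV[R]_3 is the sup norm, hence this one. *)
Definition enorm (R : realType) (x : 'cV[R]_3) : R := Num.sqrt (dot x x).

(* Indices are added in 'I_3, i.e. modulo 3. *)
Definition cross (R : realType) (x y : 'cV[R]_3) : 'cV[R]_3 :=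
  \col_i (x (i + 1) 0 * y (i + 2) 0 - x (i + 2) 0 * y (i + 1) 0).

Definition sphere (R : realType) : set 'cV[R]_3 := [set x | enorm x = 1].
Arguments sphere R : clear implicits.

Definition grad (R : realType) (f : 'cV[R]_3 -> R) (x : 'cV[R]_3) : 'cV[R]_3 :=
  \col_i 'D_(delta_mx i 0) f x.

(* On the sphere, nabla_star f and L_star f depend only on the restriction of
   the differentiable function f to the sphere. *)
Definition nabla_star (R : realType) (f : 'cV[R]_3 -> R) (x : 'cV[R]_3) :
    'cV[R]_3 :=
  (1%:M - x *m x^T) *m grad f x.

Definition L_star (R : realType) (f : 'cV[R]_3 -> R) (x : 'cV[R]_3) :
    'cV[R]_3 :=
  cross x (grad f x).

(* 'cV[R]_3 with the sigma-algebra generated by the coordinates, which is the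
   Borel one; this is how the library equips n.-tuple R. *)
Definition borel3 (R : realType) :=
  g_sigma_algebraType (g_sigma_preimage
    (fun (i : 'I_3) (x : 'cV[R]_3) => x i 0 : measurableTypeR R)).

Definition spherical_coord (R : realType)
    (p : measurableTypeR R * measurableTypeR R) : 'cV[R]_3 :=
  \col_i [:: sin p.1 * cos p.2; sin p.1 * sin p.2; cos p.1]`_i.

Definition spherical_domain (R : realType) :
    set (measurableTypeR R * measurableTypeR R) :=
  `[0, pi]%classic `*` `[0, 2 * pi]%classic.
Arguments spherical_domain R : clear implicits.

(* d mu = sin theta dtheta dphi *)
Definition surface_measure (R : realType) (A : set (borel3 R)) : \bar R :=
  (\int[lebesgue_measure \x lebesgue_measure]_(p in
     spherical_domain R `&` @spherical_coord R @^-1` A) (sin p.1)%:E)%E.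

Lemma measurable_spherical_domain (R : realType) :
  measurable (spherical_domain R).
Proof. by apply: measurableX; exact: measurable_itv. Qed.

Lemma measurable_spherical_coord (R : realType) :
  measurable_fun setT
    (@spherical_coord R : measurableTypeR R * measurableTypeR R -> borel3 R).
Proof.
have msin : measurable_fun setT (sin : R -> R).
  by apply: continuous_measurable_fun => x; exact: continuous_sin.
have mcos : measurable_fun setT (cos : R -> R).
  by apply: continuous_measurable_fun => x; exact: continuous_cos.
have mcoord (i : 'I_3) : measurable_fun setT
    (fun p : measurableTypeR R * measurableTypeR R =>
       spherical_coord p i 0 : measurableTypeR R).
  have ms1 : measurable_fun setT
      (fun p : measurableTypeR R * measurableTypeR R => sin p.1 : R).
    exact: (measurableT_comp msin measurable_fst).
  have mc1 : measurable_fun setT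
      (fun p : measurableTypeR R * measurableTypeR R => cos p.1 : R).
    exact: (measurableT_comp mcos measurable_fst).
  have ms2 : measurable_fun setT
      (fun p : measurableTypeR R * measurableTypeR R => sin p.2 : R).
    exact: (measurableT_comp msin measurable_snd).
  have mc2 : measurable_fun setT
      (fun p : measurableTypeR R * measurableTypeR R => cos p.2 : R).
    exact: (measurableT_comp mcos measurable_snd).
  under eq_fun do rewrite mxE.
  case: i => -[|[|[|//]]] ? /=.
  - exact: (measurable_funM ms1 mc2).
  - exact: (measurable_funM ms1 ms2).
  - exact: mc1.
pose S := [set A : set 'cV[R]_3 | measurable (@spherical_coord R @^-1` A)].
have sS : sigma_algebra setT S.
  split=> [|A mA|A mA]; rewrite /S/=.
  - by rewrite preimage_set0.
  - by rewrite setTD preimage_setC; exact: measurableC.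
  - by rewrite preimage_bigcup; apply: bigcup_measurable => k _; exact: mA.
move=> _ A mA; rewrite setTI; move: A mA.
apply: (smallest_sub sS); apply: (smallest_sub sS) => A.
rewrite -bigcup_mkord_ord => -[i _ [B mB <-]].
rewrite /S/= setTI -comp_preimage -[X in measurable X]setTI.
exact: mcoord.
Qed.

Lemma surface_measure0 (R : realType) : @surface_measure R set0 = 0%E.
Proof. by rewrite /surface_measure preimage_set0 setI0 integral_set0. Qed.

Lemma sin_ge0_spherical_domain (R : realType) p :
  spherical_domain R p -> (0 <= (sin p.1)%:E :> \bar R)%E.
Proof. by move=> [/= + _]; rewrite in_itv/= lee_fin => /sin_ge0_pi. Qed.

Lemma surface_measure_ge0 (R : realType) A : (0 <= @surface_measure R A)%E.
Proof. by apply: integral_ge0 => p [/sin_ge0_spherical_domain]. Qed.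

Lemma surface_measure_semi_sigma_additive (R : realType) :
  semi_sigma_additive (@surface_measure R).
Proof.
move=> F mF tF mUF; rewrite /surface_measure preimage_bigcup setI_bigcupr.
have mG k : measurable
    (spherical_domain R `&` @spherical_coord R @^-1` F k).
  apply: measurableI; first exact: measurable_spherical_domain.
  by rewrite -[X in measurable X]setTI; exact: measurable_spherical_coord.
rewrite ge0_integral_bigcup//=; last 3 first.
- apply/measurable_EFinP; apply: measurable_funTS.
  by apply: measurableT_comp => //; apply: continuous_measurable_fun => x; exact: continuous_sin.
- by move=> p [k _ [/sin_ge0_spherical_domain]].
- apply/trivIsetP => i j _ _ ij; rewrite setIACA setIid -preimage_setI.
  by move/trivIsetP : tF => /(_ i j Logic.I Logic.I ij) ->; rewrite preimage_set0 setI0.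
apply: is_cvg_ereal_nneg_natsum_cond => // n _ _.
by apply: integral_ge0 => p [/sin_ge0_spherical_domain].
Qed.

HB.instance Definition _ (R : realType) := isMeasure.Build _ _ _
  (@surface_measure R) (@surface_measure0 R) (@surface_measure_ge0 R)
  (@surface_measure_semi_sigma_additive R).

Definition sint (R : realType) (g : 'cV[R]_3 -> R) : R :=
  \int[@surface_measure R]_(x in (sphere R : set (borel3 R))) g x.

Definition inner (R : realType) (f g : 'cV[R]_3 -> 'cV[R]_3) : R :=
  sint (fun x => dot (f x) (g x)).

Definition tangential_L2 (R : realType) (f : 'cV[R]_3 -> 'cV[R]_3) : Prop :=
  [/\ forall i, measurable_fun (sphere R : set (borel3 R))
        (fun x : borel3 R => f x i 0),
      forall x, sphere R x -> dot x (f x) = 0 &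
      (\int[@surface_measure R]_(x in (sphere R : set (borel3 R)))
         (dot (f x) (f x))%:E < +oo)%E].

(* Spherical harmonics of degree l are restrictions to the sphere of
   homogeneous harmonic polynomials of degree l; we carry the polynomial
   function itself, so that grad applies to it. *)
Definition harmonic_homog (R : realType) (l : nat) (f : 'cV[R]_3 -> R) : Prop :=
  exists p : mpoly.mpoly 3 R,
    [/\ p \is mpoly.ishomog1 l mpoly.mdeg,
        \sum_(i < 3) mpoly.mderiv i (mpoly.mderiv i p) = 0 &
        forall x, f x = mpoly.meval (fun i => x i 0) p].

Definition spherical_harmonic_basis (R : realType)
    (Y : forall l : nat, 'I_l.*2.+1 -> 'cV[R]_3 -> R) : Prop :=
  forall l,
  [/\ forall k, harmonic_homog l (Y l k),
      forall j k, sint (fun x => Y l j x * Y l k x) = (j == k)%:R &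
      forall f, harmonic_homog l f -> exists a : 'I_l.*2.+1 -> R,
        forall x, sphere R x -> f x = \sum_k a k * Y l k x].

Definition lambda (R : realType) (l : nat) : R := l%:R * (l%:R + 1).
Arguments lambda R l : clear implicits.

Definition y_field (R : realType) (Y : forall l : nat, 'I_l.*2.+1 -> 'cV[R]_3 -> R)
    (l : nat) (k : 'I_l.*2.+1) (x : 'cV[R]_3) : 'cV[R]_3 :=
  (Num.sqrt (lambda R l))^-1 *: L_star (Y l k) x.

Definition z_field (R : realType) (Y : forall l : nat, 'I_l.*2.+1 -> 'cV[R]_3 -> R)
    (l : nat) (k : 'I_l.*2.+1) (x : 'cV[R]_3) : 'cV[R]_3 :=
  (Num.sqrt (lambda R l))^-1 *: nabla_star (Y l k) x.

Definition div_coef (R : realType) (Y : forall l : nat, 'I_l.*2.+1 -> 'cV[R]_3 -> R)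
    (f : 'cV[R]_3 -> 'cV[R]_3) (l : nat) (k : 'I_l.*2.+1) : R :=
  inner f (y_field Y k).

Definition curl_coef (R : realType) (Y : forall l : nat, 'I_l.*2.+1 -> 'cV[R]_3 -> R)
    (f : 'cV[R]_3 -> 'cV[R]_3) (l : nat) (k : 'I_l.*2.+1) : R :=
  inner f (z_field Y k).

Definition sobolev_sqnorm (R : realType)
    (Y : forall l : nat, 'I_l.*2.+1 -> 'cV[R]_3 -> R) (s : R)
    (f : 'cV[R]_3 -> 'cV[R]_3) : \bar R :=
  (\sum_(1 <= l <oo) (\sum_(k < l.*2.+1) (1 + lambda R l) `^ s *
     (`|div_coef Y f k| ^+ 2 + `|curl_coef Y f k| ^+ 2))%R%:E)%E.

Definition sobolev (R : realType)
    (Y : forall l : nat, 'I_l.*2.+1 -> 'cV[R]_3 -> R) (s : R)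
    (f : 'cV[R]_3 -> 'cV[R]_3) : Prop :=
  tangential_L2 f /\ (sobolev_sqnorm Y s f < +oo)%E.

(* Meaningful on sobolev Y s, where sobolev_sqnorm is finite. *)
Definition sobolev_norm (R : realType)
    (Y : forall l : nat, 'I_l.*2.+1 -> 'cV[R]_3 -> R) (s : R)
    (f : 'cV[R]_3 -> 'cV[R]_3) : R :=
  Num.sqrt (fine (sobolev_sqnorm Y s f)).

(* Rodrigues' formula *)
Definition legendre (R : realType) (l : nat) : {poly R} :=
  ((2 ^ l * l`!)%:R)^-1 *: (('X^2 - 1) ^+ l)^`(l).
Arguments legendre R l : clear implicits.

Definition legendre_coef (R : realType) (psi : R -> R) (l : nat) : R :=
  2 * pi * \int[lebesgue_measure]_(t in `[-1, 1]) (psi t * (legendre R l).[t]).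

(* psi rho is the function of one variable; only its values on [-1, 1]
   matter. *)
Definition scaled_zonal_family (R : realType) (phi : R -> R)
    (psi : R -> R -> R) : Prop :=
  forall rho, 0 < rho < 1 -> exists C,
    (forall x y, sphere R x -> sphere R y ->
       psi rho (dot x y) = C * phi (rho^-1 * enorm (x - y))) /\
    (forall y, sphere R y -> sint (fun x => psi rho (dot x y)) = 1).

Definition kappa_open (R : realType) (psi : R -> R) (t : R) : R :=
  (4 * pi * (1 - t ^+ 2))^-1 *
  \int[lebesgue_measure]_(s in `[-1, t]) (1 - 4 * pi * psi s).

Definition kappa (R : realType) (psi : R -> R) (t : R) : R :=
  if t == 1 then lim (kappa_open psi u @[u --> 1^'-])
  else if t == -1 then lim (kappa_open psi u @[u --> (-1)^'+])
  else kappa_open psi t.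

Definition Psi_div_open (R : realType) (psi : R -> R) (x y : 'cV[R]_3) :
    'M[R]_3 :=
  let t := dot x y in
  - derive1 (kappa psi) t *: (cross x y *m (cross x y)^T) +
  kappa psi t *: (t%:M - y *m x^T).

Definition Psi_curl_open (R : realType) (psi : R -> R) (x y : 'cV[R]_3) :
    'M[R]_3 :=
  let t := dot x y in
  derive1 (kappa psi) t *: ((y - t *: x) *m (x - t *: y)^T) +
  kappa psi t *: ((1%:M - x *m x^T) *m (1%:M - y *m y^T)).

(* Extension of F by continuity from the pairs of points of the sphere with
   y <> x and y <> - x. *)
Definition continuous_ext (R : realType) (F : 'cV[R]_3 -> 'cV[R]_3 -> 'M[R]_3)
    (x y : 'cV[R]_3) : 'M[R]_3 :=
  if (y == x) || (y == - x) then
    lim (F q.1 q.2 @[q --> within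
      [set q | [/\ sphere R q.1, sphere R q.2, q.2 <> q.1 & q.2 <> - q.1]]
      (nbhs (x, y))])
  else F x y.

Definition Psi_div (R : realType) (psi : R -> R) :=
  continuous_ext (Psi_div_open psi).

Definition Psi_curl (R : realType) (psi : R -> R) :=
  continuous_ext (Psi_curl_open psi).

Definition Psi (R : realType) (psi : R -> R) (x y : 'cV[R]_3) : 'M[R]_3 :=
  Psi_div psi x y + Psi_curl psi x y.

Definition convolution (R : realType) (K : 'cV[R]_3 -> 'cV[R]_3 -> 'M[R]_3)
    (f : 'cV[R]_3 -> 'cV[R]_3) (x : 'cV[R]_3) : 'cV[R]_3 :=
  \col_i sint (fun y => (K x y *m f y) i 0).

(* Main.v *)
Require Import Defs.
From HB Require Import structures.
From mathcomp Require Import all_boot all_order all_algebra.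
From mathcomp Require Import ring lra.
From mathcomp Require mpoly.
From mathcomp Require Import all_classical all_reals all_analysis.
From mathcomp Require Import measurable_realfun.
Import (canonicals, coercions) mpoly.

(** Write [L = x * grad] for the rotation fields of the sphere.  If [psi] is a
    zonal polynomial of integral one, then [kappa = g'] for a polynomial [g] with
    [psi = 1/(4 pi) - ((1 - t^2) g')'], and [Psi_div(x, y) = - L L^T g(x . y)],
    while [Psi_curl] is [Psi_div] conjugated by the quarter turns [v |-> x * v]
    and [v |-> y * v] of the tangent planes.  Surface integrals of [L_i p]
    vanish for polynomials [p] (check monomials in spherical coordinates), so
    integrating by parts twice moves [L . L] onto a spherical harmonic [Z] of
    degree [l] and reduces the action of [Psi] on [L Z] and on the surface
    gradient of [Z] to the Funk-Hecke formula
    [int psi(x . y) Z(x) dx = psihat(l) Z(y)]; the latter follows by induction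
    on the degree of [psi] from [x_i Z = A_i + |x|^2 d_i Z / (2 l + 1)], with
    [A_i] harmonic of degree [l + 1], and Bonnet's recursion.

    For a continuous profile the entries of [Psi] are bounded by a multiple of
    the uniform norm of [psi], thanks to
    [(1 - t^2) kappa' = 1/(4 pi) - psi + 2 t kappa] and the vanishing of
    [(1 - t^2) kappa] at both ends.  Hence Bernstein polynomials give kernels
    that are finite sums [a(x) b(y)], for which Fubini is trivial and which
    converge uniformly to [Psi] off the null set [y = x, - x].  The
    coefficients of [f - Psi f] are therefore [1 - psihat(l)] times those of
    [f], and the hypotheses bound [|1 - psihat(l)|] by a multiple of
    [(rho sqrt (1 + lambda_l))^(sigma - tau)]. *)

Set Implicit Arguments.
Unset Strict Implicit.
Unset Printing Implicit Defensive.

Import Order.TTheory GRing.Theory Num.Theory.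
Import numFieldNormedType.Exports.

Local Open Scope classical_set_scope.
Local Open Scope ring_scope.

(** * Solid harmonics and infinitesimal rotations *)

(** The rotation fields preserve degrees, annihilate [|x|^2] and commute with the Laplacian.
    Calculus on the sphere thus becomes a set of identities between polynomials on the whole space,
    decided by [ring]; the integration variable is confined to the sphere only by the rule that
    [|x|^2] may be replaced by 1 under the integral. Polynomials are forced by the ends of
    [[-1, 1]]. For a profile that is merely continuous, [kappa'] may be unbounded near 1 and -1, so
    the Green function need not be twice differentiable across the poles and cannot be integrated by
    parts there. What survives is an estimate, since [kappa'] always multiplies a matrix of size
    [1 - t^2]. Only this estimate, and Legendre coefficients of a fixed degree, are passed to the
    limit. The condition that [psi] has surface integral one says that [(4 pi)^-1 - psi] has mean
    zero on [[-1, 1]]. This is the solvability condition for [((1 - t^2) g')' = (4 pi)^-1 - psi],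
    hence the approximating polynomials must have exactly the same integral. *)

Lemma big_ord3 (V : nmodType) (F : 'I_3 -> V) : \sum_i F i = F 0 + F 1 + F 2.
Proof.
rewrite !big_ord_recl big_ord0 addr0 addrA.
by congr (_ + F _ + F _); apply: val_inj.
Qed.

Lemma ord3_ind (P : 'I_3 -> Prop) : P 0 -> P 1 -> P 2 -> forall i, P i.
Proof.
move=> P0 P1 P2 [[|[|[|//]]] i3].
- by rewrite (_ : Ordinal i3 = 0) //; apply: val_inj.
- by rewrite (_ : Ordinal i3 = 1) //; apply: val_inj.
- by rewrite (_ : Ordinal i3 = 2) //; apply: val_inj.
Qed.

Lemma ord3_add : ((0 + 1 = 1 :> 'I_3)%R * (0 + 2 = 2 :> 'I_3)%R *
  (1 + 1 = 2 :> 'I_3)%R * (1 + 2 = 0 :> 'I_3)%R *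
  (2 + 1 = 0 :> 'I_3)%R * (2 + 2 = 1 :> 'I_3)%R)%type.
Proof. by do !split; apply: val_inj. Qed.

Notation poly3 R := (mpoly.mpoly 3 R).

Section Poly3.
Variable R : realFieldType.
Implicit Types (p q Z : poly3 R) (i j : 'I_3) (l n : nat).

Definition var i : poly3 R := mpoly.mpolyX R (mpoly.mnm1 i).
Local Notation d := (@mpoly.mderiv 3 R).

Definition rotd i p : poly3 R := var (i + 1) * d (i + 2) p - var (i + 2) * d (i + 1) p.
Definition laplacian p : poly3 R := \sum_i d i (d i p).
Definition euler p : poly3 R := \sum_i var i * d i p.
Definition sqnorm3 : poly3 R := \sum_i var i ^+ 2.

Lemma mderiv_var i j : d i (var j) = (i == j)%:R.
Proof.
rewrite /var mpoly.mderivX mpoly.mnmE eq_sym.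
have [->|_] := eqVneq i j; last by rewrite scale0r.
rewrite scale1r [mpoly.mnm_sub _ _](_ : _ = mpoly.mnm0) ?mpoly.mpolyX0 //.
by apply/mpoly.mnmP => k; rewrite !mpoly.mnmE subnn.
Qed.

Lemma mderiv_scalar i (c : R) : d i c%:A = 0.
Proof. by rewrite mpoly.mderivZ -[1]/(mpoly.mpolyC 3 1) mpoly.mderivC scaler0. Qed.

Lemma mderiv1 i : d i 1 = 0.
Proof. exact: mpoly.mderivC. Qed.

Lemma mderivXn i p n : d i (p ^+ n) = (p ^+ n.-1 * d i p) *+ n.
Proof.
elim: n => [|[|n] IH]; first by rewrite expr0 mderiv1 mulr0n.
  by rewrite expr1 expr0 mul1r.
rewrite exprS mpoly.mderivM IH /= mulrnAr mulrA -exprS [d i p * _]mulrC.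
by rewrite -mulrS.
Qed.

(** Sorts mixed second derivatives into one order, so that [ring] meets equal atoms on both
    sides. *)
Definition mderivC3 := (fun p => mpoly.mderiv_comm 1 0 p,
  fun p => mpoly.mderiv_comm 2 0 p, fun p => mpoly.mderiv_comm 2 1 p).

Definition var_mderivE := (mderiv_var, mpoly.mderivD, mpoly.mderivB, mpoly.mderivM,
  mpoly.mderivN, mpoly.mderivZ, mpoly.mderiv0).

Lemma rotdD i p q : rotd i (p + q) = rotd i p + rotd i q.
Proof. by rewrite /rotd !mpoly.mderivD; ring. Qed.

Lemma rotdZ i (c : R) p : rotd i (c *: p) = c *: rotd i p.
Proof. by rewrite /rotd !mpoly.mderivZ -!scalerAr scalerBr. Qed.

Lemma rotdM i p q : rotd i (p * q) = rotd i p * q + p * rotd i q.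
Proof. by rewrite /rotd !mpoly.mderivM; ring. Qed.

Lemma euler_scale p l : euler p = l%:R *: p -> euler (euler p) = l%:R *: (l%:R *: p).
Proof.
move=> E; rewrite {1}E /euler.
under eq_bigr do rewrite mpoly.mderivZ -scalerAr.
by rewrite -scaler_sumr -/(euler p) E.
Qed.

(** With [E] the Euler operator this reads [L . L = |x|^2 Laplacian - E (E + 1)], the splitting of
    the Laplacian into radial and angular parts. *)
Lemma rotd_sqr p :
  \sum_i rotd i (rotd i p) = sqnorm3 * laplacian p - euler (euler p) - euler p.
Proof.
rewrite /rotd /laplacian /euler /sqnorm3 !big_ord3 !ord3_add.
rewrite !var_mderivE /=.
rewrite !mderivC3.
by ring.
Qed.

(* On the sphere, [d i p - var i * euler p] is the surface gradient of [p]. *)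
Lemma rotd_surface_gradient p :
  \sum_i rotd i (d i p - var i * euler p) = 0.
Proof.
rewrite /rotd /euler !big_ord3 !ord3_add.
rewrite !var_mderivE /=.
rewrite !mderivC3.
by ring.
Qed.

(** Homogeneity is encoded by Euler's identity. It is linear in [p], so closure under a differential
    operator reduces to commutators with the Laplacian and the Euler operator. *)
Definition solid_harmonic l p := laplacian p = 0 /\ euler p = l%:R *: p.

(** Monomials diagonalise the Euler operator, with their degree as eigenvalue. *)
Lemma mcoeff_euler p m : mpoly.mcoeff m (euler p) = (mpoly.mdeg m)%:R * mpoly.mcoeff m p.
Proof.
pose P q := mpoly.mcoeff m (euler q) = (mpoly.mdeg m)%:R * mpoly.mcoeff m q.
have PX (n : mpoly.multinom 3) : P (mpoly.mpolyX R n).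
  rewrite /P /euler; have -> : \sum_i var i * d i (mpoly.mpolyX R n) =
      (mpoly.mdeg n)%:R *: mpoly.mpolyX R n.
    rewrite mpoly.mdegE natr_sum scaler_suml; apply: eq_bigr => i _.
    rewrite mpoly.mderivX -scalerAr /var -mpoly.mpolyXD.
    have [->|ni0] := posnP (n i); first by rewrite !scale0r.
    congr (_ *: mpoly.mpolyX _ _); rewrite mpoly.addmC mpoly.submK //.
    by apply/mpoly.mnm_lepP => k; rewrite mpoly.mnmE; case: eqVneq => // <-.
  rewrite mpoly.mcoeffZ mpoly.mcoeffX.
  by case: eqVneq => [->//|_]; rewrite !mulr0.
rewrite -/(P p) {1}/P; elim/mpoly.mpolyind: p => [|c n q _ _ IH].
  by rewrite /euler big1 => [|i _]; rewrite ?mpoly.mderiv0 ?mulr0 // !mpoly.mcoeff0 mulr0.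
have -> : euler (c *: mpoly.mpolyX R n + q) = c *: euler (mpoly.mpolyX R n) + euler q.
  rewrite /euler scaler_sumr -big_split; apply: eq_bigr => i _ /=.
  by rewrite mpoly.mderivD mpoly.mderivZ mulrDr -scalerAr.
rewrite !mpoly.mcoeffD !mpoly.mcoeffZ IH [mpoly.mcoeff m (euler _)]PX.
by ring.
Qed.

Lemma homog_euler l p : p \is mpoly.ishomog1 l mpoly.mdeg -> euler p = l%:R *: p.
Proof.
move=> hp; apply/mpoly.mpolyP => m; rewrite mcoeff_euler mpoly.mcoeffZ.
have [<-//|ml] := eqVneq (mpoly.mdeg m) l.
by rewrite (mpoly.dhomog_nemf_coeff hp ml) !mulr0.
Qed.

Lemma laplacian_mderiv i p : laplacian (d i p) = d i (laplacian p).
Proof.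
rewrite /laplacian raddf_sum; apply: eq_bigr => j _.
by rewrite /= (mpoly.mderiv_comm i j) (mpoly.mderiv_comm i j (d j p)).
Qed.

Lemma euler_mderiv i p : euler (d i p) = d i (euler p) - d i p.
Proof.
rewrite /euler !big_ord3; elim/ord3_ind: i; rewrite !var_mderivE /=;
 rewrite ?mderivC3 ?mderiv1;
 by ring.
Qed.

Lemma solid_harmonic_mderiv l i Z :
  solid_harmonic l.+1 Z -> solid_harmonic l (d i Z).
Proof.
move=> [h1 h2]; split; first by rewrite laplacian_mderiv h1 mpoly.mderiv0.
by rewrite euler_mderiv h2 mpoly.mderivZ -natr1 scalerDl scale1r addrK.
Qed.

(** The derivative would be homogeneous of degree -1, and no monomial has negative degree. *)
Lemma solid_harmonic0_mderiv i Z : solid_harmonic 0 Z -> d i Z = 0.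
Proof.
move=> [_ h2]; apply/mpoly.mpolyP => m; rewrite mpoly.mcoeff0.
have := mcoeff_euler (d i Z) m.
rewrite euler_mderiv h2 scale0r mpoly.mderiv0 sub0r mpoly.mcoeffN => /eqP.
rewrite eq_sym -subr_eq0 opprK -[X in _ + X]mul1r -mulrDl natr1.
by rewrite mulf_eq0 pnatr_eq0 => /eqP.
Qed.

(** Rotations commute with the Laplacian and with dilations. *)
Lemma solid_harmonic_rotd l i Z : solid_harmonic l Z -> solid_harmonic l (rotd i Z).
Proof.
move=> [h1 h2]; split.
  transitivity (rotd i (laplacian Z)); last first.
    by rewrite h1 /rotd !mpoly.mderiv0 !mulr0 subrr.
  rewrite /rotd /laplacian !big_ord3; elim/ord3_ind: i; rewrite !ord3_add !var_mderivE /=;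
  rewrite ?mderivC3 ?mderiv1; by ring.
transitivity (rotd i (euler Z)); last by rewrite h2 rotdZ.
rewrite /rotd /euler !big_ord3; elim/ord3_ind: i; rewrite !ord3_add !var_mderivE /=;
rewrite ?mderivC3 ?mderiv1;
by ring.
Qed.
End Poly3.

(** * The Funk-Hecke formula for rotation invariant functionals *)

Section Zonal.
Variable R : realFieldType.
Implicit Types (p Z : poly3 R) (q : {poly R}) (i j : 'I_3) (l : nat).
Local Notation d := (@mpoly.mderiv 3 R).

Lemma solid_harmonic0 Z (y : 'I_3 -> R) :
  solid_harmonic 0 Z -> Z = (mpoly.meval y Z)%:A.
Proof.
move=> [_ h]; suff -> : Z = (mpoly.mcoeff mpoly.mnm0 Z)%:A.
  by rewrite mpoly.mevalZ mpoly.meval1 mulr1.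
apply/mpoly.mpolyP => m; rewrite mpoly.mcoeffZ mpoly.mcoeff1.
have := mcoeff_euler Z m; rewrite h scale0r mpoly.mcoeff0.
have [->|m0] := eqVneq m mpoly.mnm0; first by rewrite mulr1.
move/esym/eqP; rewrite mulf_eq0 pnatr_eq0 mpoly.mdeg_eq0 (negbTE m0) /=.
by move/eqP ->; rewrite mulr0.
Qed.

(** The coefficient is dictated by the Laplacian: it sends [x_i Z] to [2 d_i Z], and [|x|^2 d_i Z]
    to [(6 + 4 (l - 1)) d_i Z = 2 (2 l + 1) d_i Z]. *)
Lemma solid_harmonic_mul_var l i Z : solid_harmonic l Z ->
  solid_harmonic l.+1 (var R i * Z - (l.*2.+1%:R)^-1 *: (sqnorm3 R * d i Z)).
Proof.
move=> [h1 h2]; set c := (_^-1 : R).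
have hc : c * (2 * l%:R + 1) = 1.
  by rewrite /c -natrM mul2n natr1 mulVf // pnatr_eq0.
have hB1 : laplacian (d i Z) = 0 by rewrite laplacian_mderiv h1 mpoly.mderiv0.
have hB2 : euler (d i Z) = (l%:R - 1) *: d i Z.
  by rewrite euler_mderiv h2 mpoly.mderivZ scalerBl scale1r.
split.
  have -> : laplacian (var R i * Z - c *: (sqnorm3 R * d i Z)) =
      2 * d i Z + var R i * laplacian Z - c *: (6 * d i Z + 4 * euler (d i Z) +
        sqnorm3 R * laplacian (d i Z)).
    rewrite /laplacian /euler /sqnorm3 !big_ord3.
    elim/ord3_ind: i {hB1 hB2}; rewrite !expr2 !var_mderivE /= ?mderiv1 ?mderivC3 -!mpoly.mul_mpolyC;
    by ring.
  rewrite h1 hB1 hB2 !mulr0 !addr0 -!mpoly.mul_mpolyC.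
  (* The scalar relation [c (2 l + 1) = 1] is moved to constant polynomials, where it can be
     combined with [ring]. *)
  have := congr1 (@mpoly.mpolyC 3 R) hc.
  rewrite !mpoly.mpolyCB !mpoly.mpolyCM !mpoly.mpolyCD !mpoly.mpolyCM.
  rewrite mpoly.mpolyC1 mpoly.mpolyCMn mpoly.mpolyC1 => hc'.
  set L := mpoly.mpolyC 3 l%:R in hc' *.
  transitivity ((1 - mpoly.mpolyC 3 c * (2 * L + 1)) * (2 * d i Z)); first by ring.
  by rewrite hc' subrr mul0r.
have -> : euler (var R i * Z - c *: (sqnorm3 R * d i Z)) =
   var R i * Z + var R i * euler Z - c *: (2 * sqnorm3 R * d i Z + sqnorm3 R * euler (d i Z)).
  rewrite /euler /sqnorm3 !big_ord3.
  elim/ord3_ind: i {hB1 hB2}; rewrite !expr2 !var_mderivE /= ?mderiv1 ?mderivC3 -!mpoly.mul_mpolyC;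
  by ring.
rewrite h2 hB2 -(natr1 l) scalerBl scalerDl !scale1r -!mpoly.mul_mpolyC.
by ring.
Qed.

Definition linform (y : 'I_3 -> R) : poly3 R := \sum_i y i *: var R i.
Definition zonal (y : 'I_3 -> R) q : poly3 R := horner_alg (linform y) q.

Lemma meval_var (x : 'I_3 -> R) i : mpoly.meval x (var R i) = x i.
Proof. exact: mpoly.mevalXU. Qed.

Lemma meval_zonal (x y : 'I_3 -> R) q :
  mpoly.meval x (zonal y q) = q.[\sum_i y i * x i].
Proof.
rewrite /zonal; elim/poly_ind: q => [|q c IH].
  by rewrite linear0 mpoly.meval0 horner0.
rewrite linearD rmorphM /= horner_algX horner_algC mpoly.mevalD mpoly.mevalM IH.
rewrite hornerMXaddC mpoly.mevalZ mpoly.meval1 mulr1; congr (_ * _ + _).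
by rewrite raddf_sum; apply: eq_bigr => i _; rewrite /= mpoly.mevalZ meval_var.
Qed.

Lemma mderiv_linform (y : 'I_3 -> R) i : d i (linform y) = (y i)%:A.
Proof.
rewrite /linform big_ord3.
by elim/ord3_ind: i; rewrite !var_mderivE /= -!mpoly.mul_mpolyC; ring.
Qed.

Lemma mderiv_zonal (y : 'I_3 -> R) i q : d i (zonal y q) = y i *: zonal y q^`().
Proof.
rewrite /zonal; elim/poly_ind: q => [|q c IH].
  by rewrite deriv0 linear0 mpoly.mderiv0 scaler0.
rewrite linearD rmorphM /= horner_algX horner_algC mpoly.mderivD mpoly.mderivM IH.
rewrite mderiv_scalar addr0 mderiv_linform derivD derivM derivX derivC addr0 mulr1.
by rewrite linearD rmorphM /= horner_algX -!mpoly.mul_mpolyC; ring.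
Qed.

(* The cross product of [x] and [y], as a polynomial in [x]. *)
Definition crossp (y : 'I_3 -> R) i : poly3 R :=
  y (i + 2) *: var R (i + 1) - y (i + 1) *: var R (i + 2).

Lemma rotd_zonal (y : 'I_3 -> R) i q :
  rotd i (zonal y q) = crossp y i * zonal y q^`().
Proof.
by rewrite /rotd /crossp !mderiv_zonal -!mpoly.mul_mpolyC; ring.
Qed.

Lemma rotd_crossp (y : 'I_3 -> R) i j :
  rotd i (crossp y j) = y i *: var R j - (i == j)%:R *: linform y.
Proof.
rewrite /rotd /crossp /linform big_ord3.
by elim/ord3_ind: i; elim/ord3_ind: j;
  rewrite !ord3_add !var_mderivE /= -!mpoly.mul_mpolyC ?mpoly.mpolyC0 ?mpoly.mpolyC1;
  ring.
Qed.

(** For [|x| = 1] the right-hand side is the Legendre operator [((1 - t^2) q')'] at [t = x . y]; as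
    an identity of polynomials it keeps the factor [|x|^2]. *)
Lemma rotd_sqr_zonal (y : 'I_3 -> R) q : \sum_i y i ^+ 2 = 1 ->
  \sum_i rotd i (rotd i (zonal y q)) =
  sqnorm3 R * zonal y q^`()^`() - zonal y ('X ^+ 2 * q^`()^`() + 'X *+ 2 * q^`()).
Proof.
move=> y1; have E r : euler (zonal y r) = linform y * zonal y r^`().
  rewrite /euler; under eq_bigr do rewrite mderiv_zonal -scalerAr scalerAl.
  by rewrite -mulr_suml.
rewrite rotd_sqr.
have -> : laplacian (zonal y q) = zonal y q^`()^`().
  rewrite /laplacian; under eq_bigr do rewrite mderiv_zonal mpoly.mderivZ mderiv_zonal scalerA.
  by rewrite -scaler_suml; under eq_bigr do rewrite -expr2; rewrite y1 scale1r.
have -> : euler (zonal y q) = zonal y ('X * q^`()).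
  by rewrite E /zonal rmorphM /= horner_algX.
rewrite E derivM derivX mul1r /zonal !(linearD, rmorphM, rmorphXn, rmorphMn) /=.
by rewrite !horner_algX; ring.
Qed.

Section InvariantFunctional.
(** [I] stands for the surface integral; the two hypotheses are its invariance under infinitesimal
    rotations and its concentration on the unit sphere. *)
Variable I : {scalar poly3 R}.
Hypothesis I_rotd : forall i p, I (rotd i p) = 0.
Hypothesis I_sqnorm : forall p, I (sqnorm3 R * p) = I p.

Lemma rotd_by_parts i p p' : I (rotd i p * p') = - I (p * rotd i p').
Proof. by apply/eqP; rewrite -addr_eq0 -raddfD /= -rotdM I_rotd. Qed.

Lemma rotd_sqr_solid_harmonic l Z : solid_harmonic l Z ->
  \sum_i rotd i (rotd i Z) = - (l%:R * (l%:R + 1)) *: Z.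
Proof.
move=> [h1 h2]; rewrite rotd_sqr (euler_scale h2) h1 h2 mulr0 sub0r.
by rewrite scalerA -opprD -scalerDl scaleNr mulrDr mulr1.
Qed.

(** [Z] is a multiple of [L . L Z], whose integral vanishes, and in degree at least 1 the eigenvalue
    is nonzero. *)
Lemma int_solid_harmonic l Z : solid_harmonic l.+1 Z -> I Z = 0.
Proof.
move=> hZ; have := congr1 I (rotd_sqr_solid_harmonic hZ).
rewrite raddf_sum big1 => [|i _]; last by rewrite /= I_rotd.
rewrite /= linearZ /= => /esym/eqP; rewrite mulf_eq0 oppr_eq0 mulf_eq0.
by rewrite natr1 !pnatr_eq0 /= => /eqP.
Qed.

(** [D l q] stands for the Legendre coefficient of degree [l] of [q]. It is characterised by its
    values at 1, which encode orthogonality to constants, and by the dual form of Bonnet's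
    recursion. *)
Variable D : nat -> {scalar {poly R}}.
Hypothesis D01 : D 0 1 = I 1.
Hypothesis DS1 : forall l, D l.+1 1 = 0.
Hypothesis D_mulX : forall l q,
  (l.*2.+1)%:R * D l (q * 'X) = l.+1%:R * D l.+1 q + l%:R * D l.-1 q.

Variable y : 'I_3 -> R.
Hypothesis y1 : \sum_i y i ^+ 2 = 1.

Theorem funk_hecke l q Z : solid_harmonic l Z ->
  I (zonal y q * Z) = D l q * mpoly.meval y Z.
Proof.
elim/poly_ind: q l Z => [|q c IH] l Z hZ.
  by rewrite /zonal !linear0 mul0r linear0 mul0r.
rewrite /zonal !linearD rmorphM /= horner_algX horner_algC -/(zonal y q).
rewrite !mulrDl linearD /=; congr (_ + _); last first.
  rewrite -scalerAl mul1r linearZ /= -alg_polyC linearZ /= -mulrA; congr (_ * _).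
  case: l hZ => [|l] hZ; last by rewrite DS1 mul0r (int_solid_harmonic hZ).
  by rewrite D01 {1}(solid_harmonic0 y hZ) linearZ /= mulrC.
(* For [l = 0] the default [0.-1 = 0] is harmless: both sides vanish because [Z] is constant. *)
have hB i : I (zonal y q * d i Z) = D l.-1 q * mpoly.meval y (d i Z).
  case: l hZ => [|l] hZ.
    by rewrite solid_harmonic0_mderiv // mulr0 linear0 mpoly.meval0 mulr0.
  exact/IH/solid_harmonic_mderiv.
set c2 := ((l.*2.+1)%:R : R).
have c20 : c2 != 0 by rewrite pnatr_eq0.
pose A i := var R i * Z - c2^-1 *: (sqnorm3 R * d i Z).
have hA i : solid_harmonic l.+1 (A i) by apply: solid_harmonic_mul_var.
have -> : zonal y q * linform y * Z =
    \sum_i y i *: (zonal y q * A i + c2^-1 *: (sqnorm3 R * (zonal y q * d i Z))).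
  rewrite /linform mulr_sumr mulr_suml; apply: eq_bigr => i _.
  by rewrite /A -!mpoly.mul_mpolyC; ring.
rewrite raddf_sum.
under eq_bigr => i _.
  rewrite /= linearZ /= linearD /= linearZ /= I_sqnorm hB (IH _ _ (hA i)).
  rewrite /A mpoly.mevalB mpoly.mevalM meval_var mpoly.mevalZ mpoly.mevalM.
  rewrite (_ : mpoly.meval y (sqnorm3 R) = 1); last first.
    rewrite /sqnorm3 raddf_sum -[RHS]y1; apply: eq_bigr => k _.
    by rewrite /= rmorphXn /= meval_var.
  rewrite mul1r.
  have -> : y i * (D l.+1 q * (y i * mpoly.meval y Z - c2^-1 * mpoly.meval y (d i Z)) +
     c2^-1 * (D l.-1 q * mpoly.meval y (d i Z))) =
     D l.+1 q * mpoly.meval y Z * y i ^+ 2 + (D l.-1 q - D l.+1 q) * c2^-1 *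
       (y i * mpoly.meval y (d i Z)) by ring.
  over.
rewrite big_split /= -!mulr_sumr y1.
(* Euler's identity at [y]. The weights of [D l.+1 q] and [D l.-1 q] thereby become
   [(l + 1) / (2 l + 1)] and [l / (2 l + 1)], those of Bonnet's recursion. *)
have -> : \sum_i y i * mpoly.meval y (d i Z) = l%:R * mpoly.meval y Z.
  case: hZ => _ /(congr1 (mpoly.meval y)); rewrite mpoly.mevalZ => <-.
  by rewrite raddf_sum; apply: eq_bigr => i _; rewrite /= mpoly.mevalM meval_var.
apply: (mulfI c20); rewrite [RHS]mulrA D_mulX /c2 -(natr1 l) -(natr1 l.*2) -mul2n natrM.
have : (2 * l%:R + 1 : R) != 0 by rewrite -natrM mul2n natr1.
move: (mpoly.meval y Z) (D _ _) (D _ _) (l%:R) => a b b' L L0.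
by field.
Qed.

Variable g : {poly R}.
Variable c : R.
Let psi : {poly R} := c%:P - ((1 - 'X ^+ 2) * g^`())^`().

(** By parts, [L . L] lands on [Z] and becomes minus the eigenvalue, while [rotd j] is moved onto
    [Z] too. As [rotd j Z] is harmonic of the same degree, the eigenvalue can be turned back into
    [L . L], which returns to the zonal factor as the Legendre operator of [g]. The constant [c]
    drops out because [rotd j Z] has integral zero. *)
Lemma kernel_rotd l Z j : solid_harmonic l.+1 Z ->
  I (\sum_i - rotd i (rotd j (zonal y g)) * rotd i Z) =
  D l.+1 psi * mpoly.meval y (rotd j Z).
Proof.
move=> hZ; rewrite -(funk_hecke psi (solid_harmonic_rotd j hZ)).
transitivity (I (rotd j (zonal y g) * \sum_i rotd i (rotd i Z))).
  rewrite mulr_sumr !raddf_sum; apply: eq_bigr => i _ /=.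
  by rewrite mulNr raddfN /= (rotd_by_parts i) opprK.
have hj := solid_harmonic_rotd j hZ.
rewrite (rotd_sqr_solid_harmonic hZ) -scalerAr linearZ /= rotd_by_parts mulrNN.
transitivity (I (zonal y g * (l.+1%:R * (l.+1%:R + 1) *: rotd j Z))).
  by rewrite -scalerAr linearZ.
have {1}-> : l.+1%:R * (l.+1%:R + 1) *: rotd j Z = - \sum_i rotd i (rotd i (rotd j Z)).
  by rewrite (rotd_sqr_solid_harmonic hj) scaleNr opprK.
rewrite mulrN mulr_sumr !raddfN raddf_sum /=.
have -> : zonal y psi * rotd j Z = c *: rotd j Z
  - zonal y (((1 - 'X ^+ 2) * g^`())^`()) * rotd j Z.
  by rewrite /psi /zonal linearB /= horner_algC mulrBl -scalerAl mul1r.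
rewrite linearB /= linearZ /= (int_solid_harmonic hj) mulr0 sub0r; congr (- _).
transitivity (I ((\sum_i rotd i (rotd i (zonal y g))) * rotd j Z)).
  rewrite mulr_suml raddf_sum; apply: eq_bigr => i _ /=.
  by rewrite (rotd_by_parts i (rotd i _)) (rotd_by_parts i (zonal y g)) opprK.
rewrite rotd_sqr_zonal // mulrBl linearB /= -mulrA I_sqnorm -linearB /= -mulrBl.
congr (I (_ * _)); rewrite /zonal -linearB /=; congr horner_alg.
rewrite derivM derivB derivXn expr1 -[1]/(1%:P) derivC polyC1.
by ring.
Qed.

(** One integration by parts puts [L .] on a surface gradient, where it gives zero. *)
Lemma kernel_surface_gradient Z j :
  I (\sum_i - rotd i (rotd j (zonal y g)) * (d i Z - var R i * euler Z)) = 0.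
Proof.
transitivity (I (rotd j (zonal y g) * \sum_i rotd i (d i Z - var R i * euler Z))).
  rewrite mulr_sumr !raddf_sum; apply: eq_bigr => i _ /=.
  by rewrite mulNr raddfN /= (rotd_by_parts i) opprK.
by rewrite rotd_surface_gradient mulr0 linear0.
Qed.

End InvariantFunctional.
End Zonal.

(** * Legendre polynomials *)

Section Rodrigues.
Variable R : realFieldType.
Implicit Types (p : {poly R}) (l n : nat).

(** Legendre polynomial without the factor [1 / (2^l l!)], so that the recursions have integer
    coefficients. *)
Definition rodrigues l : {poly R} := (('X^2 - 1) ^+ l)^`(l).

Lemma derivn_mulX p n : (p * 'X)^`(n) = p^`(n) * 'X + p^`(n.-1) *+ n.
Proof.
elim: n => [|n IH]; first by rewrite !derivn0 mulr0n addr0.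
rewrite derivnS IH derivD derivM derivX mulr1 derivMn -!derivnS.
case: n {IH} => [|n]; first by rewrite mulr0n addr0 mulr1n.
by rewrite -addrA -mulrS.
Qed.

Lemma deriv_sqrX_sub1 l :
  ((('X^2 - 1) ^+ l.+1 : {poly R}))^`() = (('X^2 - 1) ^+ l * 'X *+ l.+1) *+ 2.
Proof.
by rewrite deriv_exp /= derivB derivXn expr1 -[1]/(1%:P) derivC polyC1; ring.
Qed.

Lemma rodrigues_rec1 l :
  rodrigues l.+1 = ((rodrigues l * 'X + (('X^2 - 1) ^+ l)^`(l.-1) *+ l) *+ l.+1) *+ 2.
Proof. by rewrite /rodrigues derivSn deriv_sqrX_sub1 !derivnMn derivn_mulX. Qed.

Lemma rodrigues_rec2 l :
  rodrigues l.+2 =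
    (((('X^2 - 1) ^+ l.+1)^`(l) *+ (l.+1).*2.+1 + rodrigues l *+ (l.+1).*2) *+ l.+2) *+ 2.
Proof.
rewrite /rodrigues 2!derivSn deriv_sqrX_sub1 !derivMn -!derivnMn -derivnD -!derivnMn.
congr (_^`(l)); rewrite derivM derivX deriv_sqrX_sub1 mulr1 !(exprS _ l) -muln2.
by set w := _ ^+ l; ring.
Qed.

(** The two previous recursions express [rodrigues l.+2] through the same auxiliary derivative [s];
    it cancels between them. *)
Lemma rodrigues_bonnet l :
  rodrigues l.+2 = rodrigues l.+1 * 'X *+ (l.+1.*2.+1).*2 - rodrigues l *+ (l.+1.*2 ^ 2).
Proof.
have h1 := rodrigues_rec1 l.+1; have h2 := rodrigues_rec2 l.
have n0 : (l.+2)%:R * 2%:R != 0 :> {poly R}.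
  by rewrite -natrM -polyC_natr polyC_eq0 pnatr_eq0.
move: h1 h2; rewrite /=; set a := rodrigues l.+2; set b := rodrigues l.+1.
set c := rodrigues l; set s := (_ ^+ _)^`(_).
rewrite -!muln2 => h1 h2.
have h3 : b * 'X = s * (l%:R + 2%:R) + c * (l%:R + 1) * 2%:R.
  apply: (mulIf n0).
  transitivity (a - s * (l%:R + 1) * (l.+2%:R * 2%:R)).
    by rewrite h1; ring.
  by rewrite h2; ring.
transitivity (b * 'X * (2 * (2 * l%:R + 3)) - c * (2 * l%:R + 2) ^+ 2); last by ring.
by rewrite h3 h2; ring.
Qed.

End Rodrigues.

Lemma legendre_bonnet (R : realType) l :
  (l.*2.+1)%:R *: (legendre R l * 'X) =
  l.+1%:R *: legendre R l.+1 + l%:R *: legendre R l.-1.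
Proof.
have lE k : legendre R k = ((2 ^ k * k`!)%:R)^-1 *: rodrigues R k by [].
rewrite !lE; case: l => [|l].
  (* In degree 0 the default [0.-1 = 0] is multiplied by 0. *)
  rewrite scale0r addr0 !scale1r (_ : (2 ^ 0 * 0`!)%N = 1%N)// (_ : (2 ^ 1 * 1`!)%N = 2%N)//.
  rewrite /rodrigues derivn1 derivn0 expr0 expr1 derivB derivXn expr1 -polyC1 derivC subr0.
  rewrite invr1 scale1r mul1r; have -> : 'X *+ 2 = 2 *: 'X :> {poly R} by rewrite scaler_nat.
  by rewrite scalerA mulVf ?scale1r ?pnatr_eq0.
rewrite rodrigues_bonnet /= -scalerAl; set b := _ * 'X; set c := rodrigues R l.
rewrite -[b *+ _]scaler_nat -[c *+ _]scaler_nat !scalerBr !scalerA -addrA -scaleNr -scalerDl.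
have n0 k : (k.+1)%:R != 0 :> R by rewrite pnatr_eq0.
have f0 : (l`!)%:R != 0 :> R by rewrite pnatr_eq0 -lt0n fact_gt0.
have e0 : (2 ^+ l) != 0 :> R by rewrite expf_neq0.
rewrite !factS -!muln2 !(natrM, natrX) !exprS.
rewrite [X in _ = _ + X *: _](_ : _ = 0) ?scale0r ?addr0; last first.
  by field; rewrite f0 e0 -?natrD !nat1r ?natr1 ?pnatr_eq0 ?n0.
by congr (_ *: _); field; rewrite f0 e0 -?natrD !nat1r ?natr1 ?pnatr_eq0 ?n0.
Qed.

(** * Integration against the surface measure *)

Section DensityPushforward.
Local Open Scope ereal_scope.
Context d1 d2 (X : measurableType d1) (Y : measurableType d2) (R : realType).
Variables (mu : {measure set X -> \bar R}) (nu : {measure set Y -> \bar R}).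
Variables (D : set X) (phi : X -> Y) (w : X -> R).
Hypothesis mD : measurable D.
Hypothesis mphi : measurable_fun setT phi.
Hypothesis mw : measurable_fun D w.
Hypothesis w0 : forall x, D x -> (0 <= w x)%R.
Hypothesis nuE : forall A, measurable A ->
  nu A = \int[mu]_(x in D `&` phi @^-1` A) (w x)%:E.

Import HBNNSimple.

(** [nu] is the image under [phi] of the measure of density [w] on [D]. The formula holds for
    indicators by [nuE], for simple functions by linearity, and in general by monotone
    convergence. *)
Lemma ge0_integral_density_pushforward (f : Y -> \bar R) :
  measurable_fun setT f -> (forall y, 0 <= f y) ->
  \int[nu]_y f y = \int[mu]_(x in D) (f (phi x) * (w x)%:E).
Proof.
move=> mf f0.
pose h := nnsfun_approx measurableT mf.
have hf y : (EFin \o h n) y @[n --> \oo] --> f y.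
  by apply: cvg_nnsfun_approx.
have mhphi n : measurable_fun D (fun x => (h n (phi x))%:E).
  apply/measurable_EFinP/measurable_funTS/(measurableT_comp _ mphi).
  exact: measurable_funP.
have mwE : measurable_fun D (fun x => (w x)%:E) by exact/measurable_EFinP.
have -> : \int[nu]_y f y = lim (\int[nu]_y (EFin \o h n) y @[n --> \oo]).
  rewrite -monotone_convergence//.
  - by apply: eq_integral => y _; apply/esym/cvg_lim => //; exact: hf.
  - by move=> n; apply/measurable_EFinP; exact/measurable_funP.
  - by move=> n y _; rewrite lee_fin.
  - by move=> y _ a b ab; rewrite lee_fin; exact/lefP/nd_nnsfun_approx.
have -> : \int[mu]_(x in D) (f (phi x) * (w x)%:E) =
    lim (\int[mu]_(x in D) ((EFin \o h n) (phi x) * (w x)%:E) @[n --> \oo]).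
  rewrite -monotone_convergence//.
  - apply: eq_integral => x _; apply/esym/cvg_lim => //.
    by apply: cvgeZr => //; exact: hf.
  - by move=> n; exact: (emeasurable_funM (mhphi n) mwE).
  - by move=> n x Dx; rewrite mule_ge0 ?lee_fin// w0.
  - move=> x Dx a b ab; rewrite lee_wpmul2r ?lee_fin ?w0//.
    exact/lefP/nd_nnsfun_approx.
congr (lim (_ @ \oo)); apply/funext => n.
have sumE y : (EFin \o h n) y =
    \sum_(r \in range (h n)) (r * \1_(h n @^-1` [set r]) y)%:E.
  by rewrite /= fimfunE -fsumEFin.
transitivity (\sum_(r \in range (h n))
    \int[nu]_y (r * \1_(h n @^-1` [set r]) y)%:E).
  under eq_integral do rewrite sumE.
  rewrite ge0_integral_fsum//; last by move=> r y _; exact: nnfun_muleindic_ge0.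
  by move=> r; apply/measurable_EFinP; exact: measurable_funM.
transitivity (\sum_(r \in range (h n))
    \int[mu]_(x in D) ((r * \1_(h n @^-1` [set r]) (phi x))%:E * (w x)%:E)); last first.
  rewrite -ge0_integral_fsum//; last 2 first.
  - move=> r; apply: emeasurable_funM => //; apply/measurable_EFinP.
    apply: measurable_funM => //; apply: measurable_funTS.
    exact: (measurableT_comp _ mphi).
  - move=> r x Dx; rewrite mule_ge0 ?lee_fin ?w0//.
    by have := nnfun_muleindic_ge0 (h n) r (phi x); rewrite lee_fin.
  apply: eq_integral => x _; rewrite sumE ge0_mule_fsuml// => r.
  exact: nnfun_muleindic_ge0.
apply: eq_fsbigr => r /[!inE] -[y _ hr].
have r0 : (0 <= r)%R by rewrite -hr.
under eq_integral do rewrite EFinM.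
rewrite ge0_integralZl//; last exact/measurable_EFinP.
rewrite integral_indic// setIT nuE//.
under [RHS]eq_integral do rewrite EFinM -muleA.
rewrite ge0_integralZl//; last 2 first.
- apply: emeasurable_funM => //; apply/measurable_EFinP/measurable_funTS.
  exact: (measurableT_comp _ mphi).
- by move=> x Dx; rewrite mule_ge0 ?lee_fin ?w0.
congr (_ * _); rewrite integral_mkcondr; apply: eq_integral => x _.
by rewrite epatch_indic muleC.
Qed.

End DensityPushforward.

(** * The surface measure in spherical coordinates *)

Section SurfaceMeasure.
Variable R : realType.
Local Notation V := 'cV[R]_3.
Local Notation mu := (@surface_measure R).
Local Notation leb := (@lebesgue_measure R).
Local Notation S2 := (sphere R : set (borel3 R)).
Local Notation leb2 := (leb \x leb)%E.

Lemma dotE (x y : V) : dot x y = \sum_i x i 0 * y i 0.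
Proof. by rewrite /dot !mxE; apply: eq_bigr => i _; rewrite !mxE. Qed.

Lemma sphere_sqr (x : V) : sphere R x <-> \sum_i x i 0 ^+ 2 = 1.
Proof.
have d0 : 0 <= dot x x by rewrite dotE sumr_ge0// => i _; rewrite -expr2 sqr_ge0.
have -> : \sum_i x i 0 ^+ 2 = dot x x.
  by rewrite dotE; apply: eq_bigr => i _; rewrite expr2.
rewrite /sphere /enorm /=; split => [h|->]; last by rewrite sqrtr1.
by rewrite -[LHS]sqr_sqrtr// h expr1n.
Qed.

Lemma sphere_coord_le1 (x : V) i : sphere R x -> `|x i 0| <= 1.
Proof.
move=> /sphere_sqr h; rewrite -(@ler_pXn2r _ 2)// ?nnegrE// expr1n.
rewrite real_normK ?num_real// -h (bigD1 i)//= lerDl.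
by apply: sumr_ge0 => j _; exact: sqr_ge0.
Qed.

Lemma measurable_coord3 (i : 'I_3) :
  measurable_fun setT (fun x : borel3 R => x i 0 : R).
Proof.
move=> _ A mA; rewrite setTI; apply: sub_sigma_algebra => /=.
apply: sub_sigma_algebra => /=; rewrite -bigcup_seq/=.
by exists i => /=; [exact: mem_index_enum|exists A => //; rewrite setTI].
Qed.

Definition polyfun (p : poly3 R) (x : V) : R := mpoly.meval (fun i => x i 0) p.

Lemma measurable_polyfun p : measurable_fun setT (polyfun p : borel3 R -> R).
Proof.
have -> : polyfun p = (fun x : borel3 R =>
    \sum_(m <- mpoly.msupp p) mpoly.mcoeff m p * \prod_i x i 0 ^+ m i).
  by apply/funext => x; rewrite /polyfun mpoly.mevalE.
apply: measurable_sum => m; apply: measurable_funM => //.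
apply: measurable_prod => i _; apply: measurable_funX; exact: measurable_coord3.
Qed.

Lemma polyfun_sqnorm3 x : polyfun (sqnorm3 R) x = \sum_i x i 0 ^+ 2.
Proof.
rewrite /polyfun /sqnorm3 raddf_sum; apply: eq_bigr => i _.
by rewrite /= rmorphXn /= meval_var.
Qed.

Lemma measurable_sphere : measurable S2.
Proof.
have := @measurable_polyfun (sqnorm3 R) measurableT [set 1] (measurable_set1 _).
rewrite setTI; congr measurable.
by apply/seteqP; split=> x /=; rewrite polyfun_sqnorm3 => /sphere_sqr.
Qed.

Lemma spherical_coord_sphere p : sphere R (@spherical_coord R p).
Proof.
apply/sphere_sqr; rewrite big_ord3 !mxE /= !exprMn.
have := cos2Dsin2 p.1; have := cos2Dsin2 p.2.
by move: (sin p.2) (cos p.2) (sin p.1) (cos p.1) => a b c d h1 h2; nra.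
Qed.

Lemma spherical_domain_lty : (leb2 (spherical_domain R) < +oo)%E.
Proof.
rewrite /spherical_domain product_measure1E; [|exact: measurable_itv..].
have h (a b : R) : (leb `[a, b]%classic < +oo)%E.
  by rewrite lebesgue_measure_itv/=; case: ifPn => _ //; rewrite -EFinB ltry.
apply: lte_mul_pinfty; [exact: measure_ge0| |exact: h].
by rewrite ge0_fin_numE; [exact: h|exact: measure_ge0].
Qed.

Lemma measurable_sin_fst : measurable_fun (spherical_domain R)
  (fun p => sin p.1 : R).
Proof.
apply: measurable_funTS; apply: measurableT_comp => //.
by apply: continuous_measurable_fun => x; exact: continuous_sin.
Qed.

Lemma surface_measure_lty : (mu setT < +oo)%E.
Proof.
rewrite /surface_measure preimage_setT setIT.
have mD := @measurable_spherical_domain R.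
apply: le_lt_trans spherical_domain_lty.
rewrite -[leRHS]mul1e -integral_cst//.
apply: ge0_le_integral => //.
- exact: sin_ge0_spherical_domain.
- apply/measurable_EFinP; exact: measurable_sin_fst.
- by move=> p _; rewrite lee_fin sin_le1.
Qed.

Lemma surface_measure_sphere_lty : (mu S2 < +oo)%E.
Proof.
apply: le_lt_trans surface_measure_lty.
by apply: le_measure; rewrite ?inE//; exact: measurable_sphere.
Qed.

Lemma ge0_sint_spherical (h : borel3 R -> \bar R) : measurable_fun setT h ->
  (forall x, 0 <= h x)%E ->
  (\int[mu]_(x in S2) h x =
   \int[leb2]_(p in spherical_domain R)
     (h (spherical_coord p) * (sin p.1)%:E))%E.
Proof.
move=> mh h0; rewrite integral_mkcond.
rewrite (@ge0_integral_density_pushforward _ _ _ _ _ leb2 mu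
  (spherical_domain R) (@spherical_coord R) (fun p => sin p.1)) //=.
- apply: eq_integral => p _; rewrite patchE mem_set//.
  exact: spherical_coord_sphere.
- exact: measurable_spherical_domain.
- exact: measurable_spherical_coord.
- exact: measurable_sin_fst.
- by move=> p /sin_ge0_spherical_domain; rewrite lee_fin.
- by apply/(measurable_restrictT _ measurable_sphere); exact: measurable_funTS.
- by move=> y; rewrite patchE; case: ifP.
Qed.

(** Positive and negative parts are treated separately; the density [sin] is nonnegative on the
    domain, so multiplication by it commutes with taking parts. *)
Lemma sint_spherical (h : V -> R) : measurable_fun setT (h : borel3 R -> R) ->
  sint h = \int[leb2]_(p in spherical_domain R)
     (h (spherical_coord p) * sin p.1).
Proof.
move=> mh; have mhE : measurable_fun setT (EFin \o h : borel3 R -> \bar R).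
  exact/measurable_EFinP.
rewrite /sint /Rintegral integralE [in RHS]integralE; congr (fine (_ - _)).
- rewrite ge0_sint_spherical//; last exact: measurable_funepos.
  apply: eq_integral => p /[!inE] /sin_ge0_spherical_domain s0.
  by rewrite !funeposE /= EFinM maxe_pMl// mul0e.
- rewrite ge0_sint_spherical//; last exact: measurable_funeneg.
  apply: eq_integral => p /[!inE] /sin_ge0_spherical_domain s0.
  by rewrite !funenegE /= -mulNr EFinM maxe_pMl// mul0e.
Qed.

End SurfaceMeasure.

(** * Primitives, and product functions on rectangles *)

Section SphericalMoments.
Variable R : realType.
Local Notation V := 'cV[R]_3.
Local Notation mu := (@surface_measure R).
Local Notation leb := (@lebesgue_measure R).
Local Notation S2 := (sphere R : set (borel3 R)).
Local Notation leb2 := (leb \x leb)%E.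

Lemma continuous_is_derive (F f : R -> R) :
  (forall x, is_derive x (1 : R) F (f x)) -> continuous F.
Proof.
move=> dF x; apply: differentiable_continuous; apply/derivable1_diffP.
by have := dF x => -[].
Qed.

Lemma Rintegral_is_derive (F f : R -> R) (a b : R) : a < b ->
  (forall x, is_derive x (1 : R) F (f x)) -> continuous f ->
  \int[leb]_(x in `[a, b]) f x = F b - F a.
Proof.
move=> ab dF cf; have cF := continuous_is_derive dF.
rewrite /Rintegral (@continuous_FTC2 _ f F)//.
- exact: continuous_subspaceT.
- split; [by move=> x _; have := dF x => -[]|..].
  + by apply: cvg_at_right_filter; exact: cF.
  + by apply: cvg_at_left_filter; exact: cF.
- by move=> x _; rewrite derive1E; exact: derive_val.
Qed.

Lemma continuous_itv_integrable (f : R -> R) (a b : R) : continuous f ->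
  leb.-integrable `[a, b] (EFin \o f).
Proof.
move=> cf; apply: continuous_compact_integrable; first exact: segment_compact.
exact: continuous_subspaceT.
Qed.

Lemma Rintegral_rectangle (A B : R -> R) (a b c d : R) :
  continuous A -> continuous B ->
  \int[leb2]_(p in `[a, b]%classic `*` `[c, d]%classic) (A p.1 * B p.2) =
  (\int[leb]_(x in `[a, b]) A x) * (\int[leb]_(x in `[c, d]) B x).
Proof.
move=> cA cB.
have mI (u v : R) : measurable (`[u, v]%classic : set (measurableTypeR R)).
  exact: measurable_itv.
(* Extension by zero replaces the rectangle by the whole plane, where Fubini is applied. *)
pose A' : measurableTypeR R -> R := A \_ `[a, b].
pose B' : measurableTypeR R -> R := B \_ `[c, d].
have iA : leb.-integrable setT (EFin \o A').
  rewrite /A' -restrict_EFin; apply/(integrable_mkcond _ (mI _ _)).1.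
  exact: continuous_itv_integrable.
have iB : leb.-integrable setT (EFin \o B').
  rewrite /B' -restrict_EFin; apply/(integrable_mkcond _ (mI _ _)).1.
  exact: continuous_itv_integrable.
have mA' : measurable_fun setT A' by apply/measurable_EFinP; exact: (measurable_int leb).
have mB' : measurable_fun setT B' by apply/measurable_EFinP; exact: (measurable_int leb).
pose f p : \bar R := (A' p.1 * B' p.2)%:E.
have mf : measurable_fun setT f.
  apply/measurable_EFinP; apply: measurable_funM.
    exact: (measurableT_comp mA').
  exact: (measurableT_comp mB').
have ifx : leb2.-integrable setT f.
  apply/integrable12ltyP => //.
  rewrite (eq_integral (fun x => `|(A' x)%:E| * \int[leb]_y `|(B' y)%:E|))%E; last first.
    move=> x _; rewrite -ge0_integralZl//.
    - by apply: eq_integral => y _; rewrite /f EFinM abseM.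
    - by apply: measurableT_comp => //; exact/measurable_EFinP.
  have /integrableP[_ lA] := iA; have /integrableP[mB lB] := iB.
  rewrite ge0_integralZr//.
  - apply: lte_mul_pinfty => //; first exact: integral_ge0.
    by rewrite ge0_fin_numE//; exact: integral_ge0.
  - by apply: measurableT_comp => //; exact/measurable_EFinP.
  - exact: integral_ge0.
transitivity (fine (\int[leb2]_p f p)).
  rewrite Rintegral_mkcond /Rintegral; congr fine; apply: eq_integral => -[x y] _.
  rewrite /f /A' /B' !patchE /= in_setX.
  by case: (x \in _); case: (y \in _); rewrite ?mulr0 ?mul0r.
have -> : \int[leb]_(x in `[a, b]) A x = \int[leb]_x A' x by rewrite Rintegral_mkcond.
have -> : \int[leb]_(x in `[c, d]) B x = \int[leb]_x B' x by rewrite Rintegral_mkcond.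
rewrite -integral12_prod_meas1//.
rewrite -RintegralZr//; congr fine; apply: eq_integral => x _.
transitivity (\int[leb]_y ((A' x)%:E * (EFin \o B') y))%E.
  by apply: eq_integral => y _; rewrite /f /= EFinM.
rewrite integralZl// EFinM; congr (_ * _)%E.
by rewrite -[LHS]fineK//; exact: integrable_fin_num.
Qed.

End SphericalMoments.

(** * The surface integral as a functional on polynomials *)

Section PolynomialFunctional.
Variable R : realType.
Local Notation V := 'cV[R]_3.
Local Notation mu := (@surface_measure R).
Local Notation leb := (@lebesgue_measure R).
Local Notation S2 := (sphere R : set (borel3 R)).
Local Notation leb2 := (leb \x leb)%E.

Lemma sphere_bounded_integrable (h : V -> R) (M : R) :
  measurable_fun S2 (h : borel3 R -> R) ->
  (forall x, sphere R x -> `|h x| <= M) -> mu.-integrable S2 (EFin \o h).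
Proof.
move=> mh hM; apply: measurable_bounded_integrable => //.
- exact: measurable_sphere.
- exact: surface_measure_sphere_lty.
- exists M; split; first exact: num_real.
  by move=> r Mr x Sx /=; apply: le_trans (hM _ Sx) _; exact: ltW.
Qed.

(** Bounds [p] on the sphere, as monomials are at most 1 there. *)
Definition mpoly_norm1 (p : poly3 R) : R :=
  \sum_(m <- mpoly.msupp p) `|mpoly.mcoeff m p|.

Lemma polyfun_le (p : poly3 R) (x : V) : sphere R x -> `|polyfun p x| <= mpoly_norm1 p.
Proof.
move=> Sx; rewrite /polyfun mpoly.mevalE.
apply: le_trans (ler_norm_sum _ _ _) _; apply: ler_sum => m _.
rewrite normrM ler_piMr// normr_prod; apply: prodr_ile1 => i _.
by rewrite normr_ge0 normrX exprn_ile1// sphere_coord_le1.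
Qed.

Lemma polyfun_integrable (p : poly3 R) : mu.-integrable S2 (EFin \o polyfun p).
Proof.
apply: (@sphere_bounded_integrable _ (mpoly_norm1 p)) => [|x]; last exact: polyfun_le.
by apply: measurable_funTS; exact: measurable_polyfun.
Qed.

Definition sintp (p : poly3 R) : R := sint (polyfun p).

Lemma sintp_is_linear : linear_for *%R sintp.
Proof.
move=> c p q; rewrite /sintp /sint.
rewrite (_ : polyfun (c *: p + q) = fun x => c * polyfun p x + polyfun q x); last first.
  by apply/funext => x; rewrite /polyfun mpoly.mevalD mpoly.mevalZ.
have mS := @measurable_sphere R.
rewrite RintegralD//; last 2 first.
- exact: integrableZl (polyfun_integrable p).
- exact: polyfun_integrable.
by rewrite RintegralZl//; exact: polyfun_integrable.
Qed.

HB.instance Definition _ := GRing.isLinear.Build R (poly3 R) R _ sintp sintp_is_linear.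

Definition theta_moment n c : R := \int[leb]_(t in `[0, pi]) (sin t ^+ n * cos t ^+ c).
Definition phi_moment a b : R := \int[leb]_(t in `[0, 2 * pi]) (cos t ^+ a * sin t ^+ b).

Lemma is_derive_sinX_cosX n c (t : R) :
  is_derive t (1 : R) (fun t : R => sin t ^+ n * cos t ^+ c)
   (n%:R * (sin t ^+ n.-1 * cos t ^+ c.+1) - c%:R * (sin t ^+ n.+1 * cos t ^+ c.-1)).
Proof.
have -> : (fun t : R => sin t ^+ n * cos t ^+ c) = sin ^+ n * cos ^+ c.
  by apply/funext => s; rewrite mulrfctE !exprfctE.
apply: is_derive_eq.
rewrite !exprfctE /GRing.scale /=.
by case: n c => [|n] [|c]; rewrite ?exprS /=; ring.
Qed.

Lemma continuous_sinX_cosX n c : continuous (fun t : R => sin t ^+ n * cos t ^+ c).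
Proof. exact: (continuous_is_derive (is_derive_sinX_cosX n c)). Qed.

Lemma continuous_cosX_sinX a b : continuous (fun t : R => cos t ^+ a * sin t ^+ b).
Proof. by under eq_fun do rewrite mulrC; exact: continuous_sinX_cosX. Qed.

(** The integral of the derivative of [sin^(n+1) cos^c], which vanishes at 0 and [pi]. *)
Lemma theta_moment_rec n c :
  n.+1%:R * theta_moment n c.+1 = c%:R * theta_moment n.+2 c.-1.
Proof.
have i1 n' c' (k : R) := @RintegralZl _ _ _ leb _ _ k (measurable_itv _)
  (@continuous_itv_integrable R _ 0 pi (@continuous_sinX_cosX n' c')).
rewrite -!i1; apply/eqP; rewrite -subr_eq0 -RintegralB//; last 2 first.
- exact: integrableZl (continuous_itv_integrable _ _ (@continuous_sinX_cosX _ _)).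
- exact: integrableZl (continuous_itv_integrable _ _ (@continuous_sinX_cosX _ _)).
rewrite (Rintegral_is_derive _ (is_derive_sinX_cosX n.+1 c)) ?pi_gt0//.
  by rewrite sinpi sin0 expr0n /= !mul0r subrr.
move=> t; apply: cvgB; apply: cvgM; try exact: cvg_cst; exact: continuous_sinX_cosX.
Qed.

(** The integral of the derivative of [cos^a sin^b] over one period. *)
Lemma phi_moment_rec a b :
  a%:R * phi_moment a.-1 b.+1 = b%:R * phi_moment a.+1 b.-1.
Proof.
have i1 n' c' (k : R) := @RintegralZl _ _ _ leb _ _ k (measurable_itv _)
  (@continuous_itv_integrable R _ 0 (2 * pi) (@continuous_cosX_sinX n' c')).
rewrite -!i1; apply/eqP; rewrite eq_sym -subr_eq0 -RintegralB//; last 2 first.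
- exact: integrableZl (continuous_itv_integrable _ _ (@continuous_cosX_sinX _ _)).
- exact: integrableZl (continuous_itv_integrable _ _ (@continuous_cosX_sinX _ _)).
under eq_Rintegral do rewrite ![cos _ ^+ _ * _]mulrC.
rewrite (Rintegral_is_derive _ (is_derive_sinX_cosX b a)) ?mulr_gt0 ?pi_gt0//.
  by rewrite mulr_natl sin2pi cos2pi sin0 cos0 subrr.
move=> t; apply: cvgB; apply: cvgM; try exact: cvg_cst; exact: continuous_sinX_cosX.
Qed.

Lemma phi_moment_split a b :
  phi_moment a.+2 b = phi_moment a b - phi_moment a b.+2.
Proof.
rewrite /phi_moment -RintegralB//; last 2 first.
- exact: (continuous_itv_integrable _ _ (@continuous_cosX_sinX _ _)).
- exact: (continuous_itv_integrable _ _ (@continuous_cosX_sinX _ _)).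
apply: eq_Rintegral => t _; have := cos2Dsin2 t => h.
by rewrite !exprS -[X in X - _]mul1r -h; ring.
Qed.

Definition monomial3 a b c : poly3 R := var R 0 ^+ a * var R 1 ^+ b * var R 2 ^+ c.

(** The successor in [(a + b).+1] is the Jacobian [sin theta]. *)
Lemma sintp_monomial3 a b c :
  sintp (monomial3 a b c) = theta_moment (a + b).+1 c * phi_moment a b.
Proof.
rewrite /sintp sint_spherical; last exact: measurable_polyfun.
rewrite -Rintegral_rectangle; [|exact: continuous_sinX_cosX|exact: continuous_cosX_sinX].
apply: eq_Rintegral => p _.
rewrite /polyfun /monomial3 !rmorphM !rmorphXn /= !meval_var !mxE /= !exprMn exprS exprD.
by ring.
Qed.

Lemma monomial3E (m : mpoly.multinom 3) :
  mpoly.mpolyX R m = monomial3 (m 0) (m 1) (m 2).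
Proof.
rewrite mpoly.mpolyXE_id !big_ord_recl big_ord0 mulr1 mulrA /monomial3 /var.
by congr (_ * _ * _); congr (mpoly.mpolyX _ (mpoly.mnm1 _) ^+ m _); apply: val_inj.
Qed.

End PolynomialFunctional.

(** * Invariance of the surface integral under rotations *)

Section PolynomialFunctionalRotation.
Variable R : realType.
Local Notation V := 'cV[R]_3.
Local Notation leb := (@lebesgue_measure R).

Lemma rotd_monomial3 a b c :
  [/\ rotd 0 (monomial3 R a b c) =
        c%:R *: monomial3 R a b.+1 c.-1 - b%:R *: monomial3 R a b.-1 c.+1,
      rotd 1 (monomial3 R a b c) =
        a%:R *: monomial3 R a.-1 b c.+1 - c%:R *: monomial3 R a.+1 b c.-1 &
      rotd 2 (monomial3 R a b c) =
        b%:R *: monomial3 R a.+1 b.-1 c - a%:R *: monomial3 R a.-1 b.+1 c].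
Proof.
by split; rewrite /rotd /monomial3 !ord3_add !mpoly.mderivM !mderivXn !mderiv_var /=
  !scaler_nat !exprS; ring.
Qed.

(** On a monomial, the rotation about the vertical axis involves only the azimuthal recursion; the
    other two also exchange powers of [sin theta] and [cos theta], by the polar recursion. *)
Lemma sintp_rotd i (p : poly3 R) : sintp (rotd i p) = 0.
Proof.
elim/mpoly.mpolyind: p => [|c m p _ _ IH].
  by rewrite /rotd !mpoly.mderiv0 !mulr0 subrr linear0.
rewrite rotdD rotdZ linearD linearZ /= IH addr0 monomial3E.
move: (m 0) (m 1) (m 2) => {p IH} a b {}m.
suff -> : sintp (rotd i (monomial3 R a b m)) = 0 by rewrite mulr0.
have sZ (k : R) q : sintp (k *: q) = k * sintp q by rewrite linearZ.
have [r0 r1 r2] := rotd_monomial3 a b m.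
(* [phi1] and [phi2] combine periodicity with [cos^2 = 1 - sin^2], so that only one of the two
   exponents changes. *)
have phi1 a' b' : (a' + b').+1%:R * phi_moment R a' b'.+1 = b'%:R * phi_moment R a' b'.-1.
  have := phi_moment_rec R a'.+1 b'; rewrite /= phi_moment_split.
  by case: b' => [|b'] /= h; [rewrite addn0 h|rewrite -addSn natrD mulrDl h]; ring.
have phi2 a' b' : (a' + b').+1%:R * phi_moment R a'.+1 b' = a'%:R * phi_moment R a'.-1 b'.
  have := phi_moment_rec R a' b'.+1; case: a' => [|a'] /= h.
    by rewrite add0n -h !mul0r.
  by rewrite -addnS natrD mulrDl -h phi_moment_split; ring.
have th := theta_moment_rec R.
elim/ord3_ind: i.
- rewrite r0 raddfB /= !sZ !sintp_monomial3 addnS mulrA -th.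
  apply/eqP; rewrite subr_eq0; apply/eqP.
  rewrite [RHS]mulrCA mulrAC phi1; case: b {r0 r1 r2} => [|b]; first by rewrite !(mul0r, mulr0).
  by rewrite /= addnS; ring.
- rewrite r1 raddfB /= !sZ !sintp_monomial3 addSn [X in _ - X]mulrA -th.
  apply/eqP; rewrite subr_eq0; apply/eqP.
  rewrite mulrCA [RHS]mulrAC phi2; case: a {r0 r1 r2} => [|a]; first by rewrite !(mul0r, mulr0).
  by rewrite /= addSn; ring.
- rewrite r2 raddfB /= !sZ !sintp_monomial3.
  have := phi_moment_rec R a b.
  case: a {r0 r1 r2} => [|a]; case: b => [|b] /=; rewrite ?addSn ?addnS => h.
  + by rewrite !mul0r subrr.
  + by rewrite mulrCA -h !mul0r mulr0 subrr.
  + by rewrite [X in _ - X]mulrCA h !mul0r mulr0 subrr.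
  + by rewrite mulrCA -h [X in _ - X]mulrCA subrr.
Qed.

Lemma eq_sint (h h' : V -> R) : (forall x, sphere R x -> h x = h' x) -> sint h = sint h'.
Proof. by move=> hh'; apply: eq_Rintegral => x /[!inE]; exact: hh'. Qed.

Lemma sintp_sqnorm (p : poly3 R) : sintp (sqnorm3 R * p) = sintp p.
Proof.
apply: eq_sint => x /sphere_sqr x1; rewrite /polyfun mpoly.mevalM -/(polyfun (sqnorm3 R) x).
by rewrite polyfun_sqnorm3 x1 mul1r.
Qed.

Lemma sintp1 : sintp (1 : poly3 R) = 4 * pi.
Proof.
have -> : 1 = monomial3 R 0 0 0 by rewrite /monomial3 !expr0 !mulr1.
rewrite sintp_monomial3.
have -> : theta_moment R 1 0 = 2.
  rewrite /theta_moment; under eq_Rintegral do rewrite expr1 expr0 mulr1.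
  have dF (t : R) : is_derive t (1 : R) (fun t => - cos t) (sin t).
    by rewrite -[sin t]opprK; exact: is_deriveN.
  rewrite (Rintegral_is_derive (pi_gt0 R) dF (@continuous_sin R)).
  by rewrite cospi cos0 opprK.
have -> : phi_moment R 0 0 = 2 * pi; last by ring.
rewrite /phi_moment; under eq_Rintegral do rewrite !expr0 mulr1.
have dF (t : R) : is_derive t (1 : R) id (1 : R) by exact: is_derive_id.
rewrite (Rintegral_is_derive _ dF) ?mulr_gt0 ?pi_gt0// ?subr0//.
by move=> t; exact: cvg_cst.
Qed.

End PolynomialFunctionalRotation.

(** * Legendre coefficients *)

Section LegendreFunctional.
Variable R : realType.
Local Notation leb := (@lebesgue_measure R).

Lemma continuous_hornerp (p : {poly R}) : continuous (horner p).
Proof. exact: (continuous_is_derive (fun x => is_derive_poly p x)). Qed.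

Lemma Rintegral_deriv_poly (p : {poly R}) (a b : R) : a < b ->
  \int[leb]_(x in `[a, b]) p^`().[x] = p.[b] - p.[a].
Proof.
move=> ab; exact: (Rintegral_is_derive ab (fun x => is_derive_poly p x) (@continuous_hornerp _)).
Qed.

(** Each derivative lowers the order of the zeros at 1 and -1 by at most one. With [j = 1], the
    primitive of a Legendre polynomial given by Rodrigues' formula vanishes at both ends. *)
Lemma derivn_sqrX_sub1 k j : exists r : {poly R},
  (('X^2 - 1) ^+ (k + j))^`(k) = ('X^2 - 1) ^+ j * r.
Proof.
elim: k j => [|k IH] j; first by exists 1; rewrite derivn0 mulr1.
have [r hr] := IH j.+1; rewrite addSnnS derivnS hr derivM deriv_sqrX_sub1 (exprS _ j).
exists ('X *+ j.+1 *+ 2 * r + ('X^2 - 1) * r^`()).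
by set u := _ ^+ j; ring.
Qed.

Definition legendre_coefp l (q : {poly R}) : R := legendre_coef (horner q) l.

Lemma legendre_coefp_is_linear l : linear_for *%R (legendre_coefp l).
Proof.
move=> c p q; rewrite /legendre_coefp /legendre_coef.
under eq_Rintegral do rewrite hornerD hornerZ mulrDl -mulrA -!hornerM.
have ip (p' : {poly R}) : leb.-integrable `[-1, 1] (EFin \o horner p').
  by apply: continuous_itv_integrable; exact: continuous_hornerp.
rewrite RintegralD//; last exact: integrableZl (ip _).
rewrite RintegralZl//.
under [in RHS]eq_Rintegral do rewrite -hornerM.
under [X in _ = _ + _ * X]eq_Rintegral do rewrite -hornerM.
by ring.
Qed.

HB.instance Definition _ l := GRing.isLinear.Build R {poly R} R _
  (legendre_coefp l) (legendre_coefp_is_linear l).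

Lemma legendre_coefp01 : legendre_coefp 0 1 = 4 * pi.
Proof.
rewrite /legendre_coefp /legendre_coef /legendre.
have E (t : R) : (1 : {poly R}).[t] * (((2 ^ 0 * 0`!)%:R)^-1 *: (('X^2 - 1) ^+ 0)^`(0)).[t] =
    ('X : {poly R})^`().[t].
  by rewrite expn0 fact0 muln1 invr1 scale1r expr0 derivn0 derivX hornerC mulr1.
under eq_Rintegral do rewrite E.
rewrite Rintegral_deriv_poly; last lra.
by rewrite !hornerX; ring.
Qed.

Lemma legendre_coefpS1 l : legendre_coefp l.+1 1 = 0.
Proof.
rewrite /legendre_coefp /legendre_coef.
under eq_Rintegral => t _.
  rewrite hornerC mul1r /legendre derivnS -derivZ; over.
rewrite Rintegral_deriv_poly; last lra.
have [r] := derivn_sqrX_sub1 l 1; rewrite addn1 => ->.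
by rewrite !hornerE /=; ring.
Qed.

Lemma legendre_coefp_mulX l q :
  (l.*2.+1)%:R * legendre_coefp l (q * 'X) =
  l.+1%:R * legendre_coefp l.+1 q + l%:R * legendre_coefp l.-1 q.
Proof.
rewrite /legendre_coefp /legendre_coef.
have ip (p' : {poly R}) : leb.-integrable `[-1, 1] (EFin \o horner p').
  by apply: continuous_itv_integrable; exact: continuous_hornerp.
under eq_Rintegral do rewrite -hornerM.
under [X in _ = _ * (_ * X) + _]eq_Rintegral do rewrite -hornerM.
under [X in _ = _ + _ * (_ * X)]eq_Rintegral do rewrite -hornerM.
rewrite !(mulrCA _ (2 * pi)) -mulrDr; congr (_ * _).
rewrite -!RintegralZl// -RintegralD//; try exact: integrableZl (ip _).
apply: eq_Rintegral => t _; rewrite -!hornerZ -hornerD; congr (_.[t]).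
have h := legendre_bonnet R l.
by rewrite -mulrA ['X * _]mulrC [LHS]scalerAr h mulrDr !scalerAr.
Qed.
End LegendreFunctional.

(** * Polynomial approximation *)

Section Weierstrass.
Variable R : realType.

(* Expectation of [g] under the binomial law of parameters [n] and ['X]. *)
Fixpoint bernstein n (g : nat -> R) : {poly R} :=
  if n is n'.+1 then
    'X * bernstein n' (fun k => g k.+1) + (1 - 'X) * bernstein n' g
  else (g 0)%:P.

Lemma bernstein_opp n g : bernstein n (fun k => - g k) = - bernstein n g.
Proof.
elim: n g => [|n IH] g /=; first by rewrite polyCN.
by rewrite !IH; ring.
Qed.

(** Expectation is monotone, and the binomial law has mean [n t] and second moment
    [n t (1 - t) + (n t)^2]. The induction conditions on one trial: a success shifts [k] by one,
    which changes the quadratic bound to [(a + b + c) + (b + 2 c) k + c k^2]. *)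
Lemma bernstein_le n g (a b c t : R) : 0 <= t <= 1 ->
  (forall k, (k <= n)%N -> g k <= a + b * k%:R + c * k%:R ^+ 2) ->
  (bernstein n g).[t] <= a + b * (n%:R * t) + c * (n%:R * t * (1 - t) + (n%:R * t) ^+ 2).
Proof.
move=> /andP[t0 t1]; elim: n g a b c => [|n IH] g a b c h /=.
  rewrite hornerC; apply: le_trans (h 0%N isT) _.
  by rewrite le_eqVlt; apply/orP; left; apply/eqP; ring.
rewrite !hornerE /=.
have h1 := IH (fun k => g k.+1) (a + b + c) (b + 2 * c) c _.
have h2 := IH g a b c _.
apply: le_trans (lerD (ler_wpM2l t0 (h1 _)) (ler_wpM2l _ (h2 _))) _.
- move=> k kn; apply: le_trans (h _ _) _ => //.
  by rewrite -natr1 le_eqVlt; apply/orP; left; apply/eqP; ring.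
- by rewrite subr_ge0.
- by move=> k kn; apply: h; exact: leqW.
- by rewrite -natr1 le_eqVlt; apply/orP; left; apply/eqP; ring.
Qed.

(** Uniform continuity in the quadratic form that [bernstein_le] accepts: close points are handled
    by [e], distant ones by the bound [2 M] of the oscillation, absorbed in [K (s - t)^2]. *)
Lemma uniform_quadratic_modulus (f : R -> R) (e : R) : continuous f -> 0 < e ->
  exists2 K : R, 0 <= K &
    forall s t, 0 <= s <= 1 -> 0 <= t <= 1 -> `|f s - f t| <= e + K * (s - t) ^+ 2.
Proof.
move=> cf e0.
have [M hM] : exists M, forall t, 0 <= t <= 1 -> `|f t| <= M.
  have [] := @EVT_max R (fun t => `|f t|) 0 1 ler01.
    apply: continuous_subspaceT => t; apply: continuous_comp; first exact: cf.
    exact: norm_continuous.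
  move=> c _ hc; exists `|f c| => t t01; apply: hc; by rewrite in_itv.
have M0 : 0 <= M by apply: le_trans (hM 0 _); rewrite ?normr_ge0 ?lexx ?ler01.
have := @segment_compact R 0 1; rewrite compact_near_coveringP.
pose P K s := 0 <= s <= 1 -> forall t, 0 <= t <= 1 ->
  `|f s - f t| <= e + K * (s - t) ^+ 2.
move=> /(_ R (pinfty_nbhs R) P _).
case=> [s s01|K0 [_ hK]].
  have /cvgrPdist_lt /(_ (e / 2)) := cf s.
  rewrite divr_gt0// => /(_ isT) [d /= d0 hd].
  (* At distance at least [d / 2] one has [K (s' - t)^2 >= 2 M] as soon as [K >= 4 (2 M) / d^2]. *)
  exists (ball s (d / 2), [set K | 4 * (2 * M) / d ^+ 2 < K]) => /=.
    split; first by apply: nbhsx_ballx; rewrite divr_gt0.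
    by exists (4 * (2 * M) / d ^+ 2); split; rewrite ?num_real.
  move=> [s' K] /= [ss' hK] s'01 t t01.
  have K0 : 0 <= K.
    by apply: le_trans (ltW hK); rewrite divr_ge0 ?sqr_ge0 ?mulr_ge0.
  have [st|st] := ltP `|s' - t| (d / 2).
    have h1 : `|f s - f s'| < e / 2.
      by apply: hd; apply: lt_trans ss' _; rewrite ltr_pdivrMr// ltr_pMr// ltr1n.
    have h2 : `|f s - f t| < e / 2.
      apply: hd => /=; rewrite -(subrKA s') (le_lt_trans (ler_normD _ _))//.
      by rewrite [d]splitr ltrD.
    have := ler_normB (f s - f t) (f s - f s').
    rewrite (_ : f s - f t - (f s - f s') = f s' - f t); last by ring.
    by have := mulr_ge0 K0 (sqr_ge0 (s' - t)); lra.
  have h : `|f s' - f t| <= 2 * M.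
    by rewrite (le_trans (ler_normB _ _))// mulr2n mulrDl !mul1r lerD ?hM.
  apply: le_trans h _; apply: ler_wpDl; first exact: ltW.
  apply: le_trans _ (ler_wpM2r (sqr_ge0 _) (ltW hK)).
  have : (d / 2) ^+ 2 <= (s' - t) ^+ 2.
    rewrite -[leRHS]real_normK ?num_real// lerXn2r ?nnegrE ?normr_ge0//.
    by rewrite divr_ge0// ltW.
  move=> hst; have dd : 0 < d ^+ 2 by rewrite exprn_gt0.
  rewrite [leRHS](_ : _ = (4 * (s' - t) ^+ 2) * (2 * M) / d ^+ 2).
    rewrite ler_pdivlMr// mulrC ler_wpM2r ?mulr_ge0//.
    by move: hst; rewrite expr_div_n ler_pdivrMr ?exprn_gt0//; lra.
  by rewrite mulrAC; congr (_ / _); rewrite mulrAC.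
exists (`|K0| + 1); first by rewrite addr_ge0.
move=> s t s01 t01; apply: hK => //.
by rewrite (le_lt_trans (ler_norm _))// ltrDl.
Qed.

Lemma weierstrass01 (f : R -> R) (e : R) : continuous f -> 0 < e ->
  exists q : {poly R}, forall t, 0 <= t <= 1 -> `|f t - q.[t]| <= e.
Proof.
move=> cf e0; have e20 : 0 < e / 2 by rewrite divr_gt0.
have [K K0 hK] := uniform_quadratic_modulus cf e20.
(* The variance contributes at most [K t (1 - t) / n], which this [n] keeps below [e / 2]. *)
pose n := (Num.truncn (2 * K / e)).+1.
have n0 : 0 < n%:R :> R by rewrite ltr0n.
have hn : K / n%:R <= e / 2.
  have : 2 * K / e < n%:R by exact: truncnS_gt.
  by rewrite ltr_pdivrMr// => h; rewrite ler_pdivrMr//; lra.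
exists (bernstein n (fun k => f (k%:R / n%:R))) => t t01.
have hk k : (k <= n)%N -> `|f (k%:R / n%:R) - f t| <=
    e / 2 + K / n%:R ^+ 2 * (k%:R - n%:R * t) ^+ 2.
  move=> kn; apply: le_trans (hK _ _ _ t01) _.
    by rewrite divr_ge0 ?ler0n//= ler_pdivrMr// mul1r ler_nat.
  rewrite lerD2l -mulrA ler_wpM2l// le_eqVlt; apply/orP; left; apply/eqP; field.
  by rewrite gt_eqF.
set c := K / n%:R ^+ 2 in hk; set y := n%:R * t in hk *.
have hc : y * (1 - t) * c <= e / 2.
  have /andP[t0 t1] := t01.
  apply: le_trans hn; rewrite /y /c -[leRHS]mul1r.
  rewrite [leLHS](_ : _ = (t * (1 - t)) * (K / n%:R)); last by field; rewrite gt_eqF.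
  by rewrite ler_wpM2r ?divr_ge0// ?ler0n//; nra.
have sqrE k : c * (k%:R - y) ^+ 2 = c * y ^+ 2 + - 2 * c * y * k%:R + c * k%:R ^+ 2.
  by ring.
have valE : c * y ^+ 2 + - 2 * c * y * y + c * (y * (1 - t) + y ^+ 2) = y * (1 - t) * c.
  by ring.
(* The majorant is [f t + e / 2 + c (k - y)^2] with the square expanded; the expectation of the
   square is the variance [y (1 - t)]. Applying the same bound to [- f] gives the other side. *)
have := @bernstein_le n (fun k => f (k%:R / n%:R)) (f t + e / 2 + c * y ^+ 2)
  (- 2 * c * y) c t t01.
have := @bernstein_le n (fun k => - f (k%:R / n%:R)) (- f t + e / 2 + c * y ^+ 2)
  (- 2 * c * y) c t t01.
rewrite bernstein_opp hornerN -/y => lower upper.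
rewrite ler_norml; apply/andP; split.
- have := upper _; move=> /(_ _)/wrap[k kn|{}upper].
    have := hk k kn; rewrite sqrE ler_norml => /andP[_] {}hk; move: hk; clear.
    by lra.
  by move: upper hc valE; clear; lra.
- have := lower _; move=> /(_ _)/wrap[k kn|{}lower].
    have := hk k kn; rewrite sqrE ler_norml => /andP[+ _]; clear.
    by lra.
  by move: lower hc valE; clear; lra.
Qed.

Lemma weierstrass (f : R -> R) (e : R) : continuous f -> 0 < e ->
  exists q : {poly R}, forall t, -1 <= t <= 1 -> `|f t - q.[t]| <= e.
Proof.
move=> cf e0; have cg : continuous (fun s : R => f (2 * s - 1)).
  move=> s; apply: (@continuous_comp _ _ _ (fun s : R => 2 * s - 1)); last exact: cf.
  by apply: cvgB; [apply: cvgM; [exact: cvg_cst|exact: cvg_id]|exact: cvg_cst].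
have [q hq] := weierstrass01 cg e0.
exists (q \Po (2^-1 *: ('X + 1))) => t /andP[t1 t2].
have := hq ((t + 1) / 2); rewrite horner_comp hornerZ hornerD hornerX hornerC.
rewrite (mulrC 2^-1) (_ : 2 * ((t + 1) / 2) - 1 = t); last by field.
by apply; lra.
Qed.
End Weierstrass.

(** * The kernel kappa *)

Section ZonalApproximation.
Variable R : realType.
Local Notation leb := (@lebesgue_measure R).

Lemma poly_antiderivative (p : {poly R}) : exists P : {poly R}, P^`() = p.
Proof.
exists (\sum_(i < size p) (p`_i / i.+1%:R) *: 'X^(i.+1)).
rewrite raddf_sum -[RHS]coefK poly_def; apply: eq_bigr => i _.
by rewrite /= derivZ derivXn /= -scalerMnr scalerMnl -mulr_natr mulfVK ?pnatr_eq0.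
Qed.

(* [(4 pi)^-1 - ((1 - X^2) g')'] is the zonal polynomial with Green function [g]. *)
Definition green_zonal (g : {poly R}) : {poly R} :=
  (4 * pi)^-1%:P - ((1 - 'X ^+ 2) * g^`())^`().

Lemma hornerp_integrable (p : {poly R}) (a b : R) :
  leb.-integrable `[a, b] (EFin \o horner p).
Proof. by apply: continuous_itv_integrable; exact: continuous_hornerp. Qed.

Lemma Rintegral_itv_cst (a b c : R) : a <= b ->
  \int[leb]_(x in `[a, b]) c = c * (b - a).
Proof.
move=> ab; rewrite Rintegral_cst; last exact: measurable_itv.
congr (_ * _); suff h : leb `[a, b]%classic = (b - a)%:E by exact: (congr1 fine h).
rewrite lebesgue_measure_itv /= lte_fin; case: ltP => //= ba.
by rewrite (@le_anti _ _ a b) ?ab ?ba// subrr.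
Qed.

Lemma Rintegral_itv_bound (h : R -> R) (a b e : R) : a <= b ->
  leb.-integrable `[a, b] (EFin \o h) ->
  (forall t, a <= t <= b -> `|h t| <= e) ->
  `|\int[leb]_(x in `[a, b]) h x| <= e * (b - a).
Proof.
move=> ab ih he; rewrite -Rintegral_itv_cst//.
apply: le_trans (le_normr_Rintegral _ _) _ => //.
have mI : measurable (`[a, b]%classic : set (measurableTypeR R)) by exact: measurable_itv.
apply: le_Rintegral => //.
- exact: integrable_norm.
- by apply: continuous_itv_integrable => t; exact: cvg_cst.
Qed.

Lemma root_pm1_factor (P : {poly R}) : P.[1] = 0 -> P.[-1] = 0 ->
  exists k, P = (1 - 'X ^+ 2) * k.
Proof.
move=> /eqP/factor_theorem[A ->]; rewrite hornerM hornerXsubC => /eqP.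
rewrite mulf_eq0 => /orP[|/eqP]; last by move=> ?; exfalso; lra.
move=> /factor_theorem[B ->]; exists (- B).
by rewrite polyCN; ring.
Qed.

Let pi_neq0 : pi != 0 :> R.
Proof. by rewrite gt_eqF ?pi_gt0. Qed.

(** [F] is a globally continuous profile with the values of [psi] on [[-1, 1]]; its integral
    expresses that the zonal kernel has surface integral one. *)
Variable F : R -> R.
Hypothesis cF : continuous F.
Hypothesis intF : \int[leb]_(t in `[-1, 1]) F t = (2 * pi)^-1.

(** A Weierstrass polynomial is shifted by a constant to have exactly the integral of [F]. Then
    [(4 pi)^-1 - q] has mean zero, so its primitive can vanish at both ends and is divisible by
    [1 - X^2]; the quotient is [g']. *)
Lemma green_zonal_approximation (e : R) : 0 < e -> exists g : {poly R},
  forall t, -1 <= t <= 1 -> `|F t - (green_zonal g).[t]| <= e.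
Proof.
move=> e0; have e20 : 0 < e / 2 by rewrite divr_gt0.
have [q0 hq0] := weierstrass cF e20.
have i1 : -1 <= 1 :> R by lra.
pose m := \int[leb]_(t in `[-1, 1]) q0.[t].
(* The defect of the integral is spread over an interval of length 2, so the shift costs at most
   [e / 2]. *)
pose q := q0 + (((2 * pi)^-1 - m) / 2)%:P.
have hm : `|(2 * pi)^-1 - m| <= e / 2 * (1 - -1).
  rewrite -intF -RintegralB//; [|exact: continuous_itv_integrable|exact: hornerp_integrable].
  apply: (@Rintegral_itv_bound (fun t => F t - q0.[t])) => //.
  apply: continuous_itv_integrable => t.
  by apply: cvgB; [exact: cF|exact: continuous_hornerp].
have [P hP] := poly_antiderivative ((4 * pi)^-1%:P - q).
have P1 : P.[1] - P.[-1] = 0.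
  rewrite -Rintegral_deriv_poly; last lra.
  rewrite hP; under eq_Rintegral do rewrite hornerD hornerC hornerN hornerD hornerC.
  rewrite RintegralB//; last 2 first.
  - by apply: continuous_itv_integrable => t; exact: cvg_cst.
  - by apply: continuous_itv_integrable => t; apply: cvgD; [exact: continuous_hornerp|exact: cvg_cst].
  rewrite RintegralD//; last 2 first.
  - exact: hornerp_integrable.
  - by apply: continuous_itv_integrable => t; exact: cvg_cst.
  rewrite !Rintegral_itv_cst// -/m.
  by move: pi_neq0; generalize (@pi R) => p p0; field.
have [k hk] : exists k, P - P.[-1]%:P = (1 - 'X ^+ 2) * k.
  by apply: root_pm1_factor; rewrite hornerD hornerN hornerC ?subrr.
have [g hg] := poly_antiderivative k.
exists g => t t1.
have -> : green_zonal g = q.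
  by rewrite /green_zonal hg -hk derivB derivC subr0 hP subKr.
rewrite /q hornerD hornerC opprD addrA; apply: le_trans (ler_normB _ _) _.
rewrite [e]splitr; apply: lerD; first exact: hq0.
by rewrite normrM [`|2^-1|]ger0_norm ?invr_ge0// ler_pdivrMr//; move: hm; lra.
Qed.

Variable psi : R -> R.
Hypothesis psiF : forall t, -1 <= t <= 1 -> psi t = F t.

(** [H] is [(1 - t^2) kappa], which is differentiable up to the point 1 and beyond. *)
Let H (t : R) := \int[leb]_(s in `[-1, t]) ((4 * pi)^-1 - F s).

Let cH : continuous (fun s => (4 * pi)^-1 - F s).
Proof. by move=> s; apply: cvgB; [exact: cvg_cst|exact: cF]. Qed.

Let kappaE (t : R) : -1 < t < 1 -> kappa psi t = (1 - t ^+ 2)^-1 * H t.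
Proof.
move=> /andP[t1 t2]; rewrite /kappa; case: eqP => [|_]; first by lra.
case: eqP => [|_]; first by lra.
rewrite /kappa_open invfM -mulrA mulrCA; congr (_ * _).
rewrite /H -RintegralZl//; last first.
  have : leb.-integrable `[-1, t] (EFin \o (fun s => 1 - 4 * pi * F s)).
    apply: continuous_itv_integrable => s; apply: cvgB; first exact: cvg_cst.
    by apply: cvgM; [exact: cvg_cst|exact: cF].
  apply: eq_integrable => //.
  move=> s /[!inE]; rewrite /= in_itv /= => /andP[s1 s2].
  by rewrite psiF// s1/=; lra.
apply: eq_Rintegral => s /[!inE]; rewrite /= in_itv /= => /andP[s1 s2].
rewrite psiF ?s1/=; last lra.
by move: pi_neq0; generalize (@pi R) => p p0; field.
Qed.

Let is_deriveH (t : R) : -1 < t -> is_derive t (1 : R) H ((4 * pi)^-1 - F t).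
Proof.
move=> t1; have tt : t < t + 1 by rewrite ltrDl.
have [dH <-] := continuous_FTC1_closed tt
  (continuous_itv_integrable _ _ cH) t1 (@cH t).
by rewrite derive1E; split.
Qed.

Lemma is_derive_kappa (t : R) : -1 < t < 1 -> is_derive t (1 : R) (kappa psi)
  (((4 * pi)^-1 - F t + 2 * t * kappa psi t) / (1 - t ^+ 2)).
Proof.
move=> t1; have /andP[t0 t2] := t1.
have w0 : 1 - t ^+ 2 != 0 by rewrite gt_eqF//; nra.
apply: (near_eq_is_derive (f := fun s : R => (1 - s ^+ 2)^-1 * H s)).
  have : \forall s \near t, s \in `]-1, 1[ by apply: near_in_itvoo; rewrite in_itv/= t0.
  by apply: filterS => s; rewrite in_itv /= => s1; rewrite kappaE.
have dw : is_derive t (1 : R) (fun s : R => 1 - s ^+ 2) (- (2 * t)).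
  have := is_derive_poly (1 - 'X ^+ 2) t.
  rewrite -polyC1 derivB derivC derivXn sub0r hornerN hornerMn /= expr1 hornerX.
  rewrite mulr_natl; congr is_derive.
  by apply/funext => s; rewrite hornerD hornerN hornerXn hornerC.
have dwv : is_derive t (1 : R) (fun s : R => (1 - s ^+ 2)^-1) (2 * t / (1 - t ^+ 2) ^+ 2).
  have [d1 d2] := dw; split; first exact: derivableV.
  by rewrite deriveV// d2 /GRing.scale /=; field.
apply: (is_derive_eq (is_deriveM dwv (is_deriveH t0))); rewrite /GRing.scale /= kappaE//.
by move: (4 * pi)^-1 => c; field.
Qed.

(** [(1 - t^2) (kappa - g')] is the integral of the error [D] from -1 to [t], and up to sign from
    [t] to 1. It is therefore at most [e (1 - |t|)], hence at most [e (1 - t^2)]. In the second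
    bound, [3 = 1 + 2]: one [e] for [D], two for the term [2 t (kappa - g')]. *)
Lemma kappa_approximation (g : {poly R}) (e : R) :
  (forall t, -1 <= t <= 1 -> `|F t - (green_zonal g).[t]| <= e) ->
  forall t, -1 < t < 1 -> `|kappa psi t - g^`().[t]| <= e /\
    (1 - t ^+ 2) * `|derive1 (kappa psi) t - g^`()^`().[t]| <= 3 * e.
Proof.
move=> hg t t1; have /andP[t0 t2] := t1.
have w0 : 0 < 1 - t ^+ 2 by nra.
have e0 : 0 <= e by apply: le_trans (hg 0 _); rewrite ?normr_ge0//; lra.
pose D s := (green_zonal g).[s] - F s.
have cD : continuous D.
  by move=> s; apply: cvgB; [exact: continuous_hornerp|exact: cF].
have hD s : -1 <= s <= 1 -> `|D s| <= e by move=> s1; rewrite distrC; exact: hg.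
have intg s : -1 < s ->
    \int[leb]_(u in `[-1, s]) ((4 * pi)^-1 - (green_zonal g).[u]) = (1 - s ^+ 2) * g^`().[s].
  move=> s1.
  transitivity (\int[leb]_(u in `[-1, s]) (((1 - 'X ^+ 2) * g^`())^`()).[u]).
    apply: eq_Rintegral => u _.
    by rewrite /green_zonal hornerD hornerN hornerC; ring.
  by rewrite Rintegral_deriv_poly// !hornerE /=; ring.
have HD s : -1 < s -> H s - (1 - s ^+ 2) * g^`().[s] = \int[leb]_(u in `[-1, s]) D u.
  move=> s1; rewrite -intg// /H -RintegralB//; last 2 first.
  - exact: (continuous_itv_integrable _ _ cH).
  - apply: continuous_itv_integrable => u.
    by apply: cvgB; [exact: cvg_cst|exact: continuous_hornerp].
  by apply: eq_Rintegral => u _; rewrite /D; ring.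
have iD a b : leb.-integrable `[a, b] (EFin \o D) by exact: continuous_itv_integrable.
have H1 : H 1 = 0.
  rewrite /H RintegralB//; last 2 first.
  - by apply: continuous_itv_integrable => u; exact: cvg_cst.
  - exact: continuous_itv_integrable.
  rewrite intF Rintegral_itv_cst; last lra.
  by move: pi_neq0; generalize (@pi R) => p p0; field.
have hD1 : `|\int[leb]_(u in `[-1, t]) D u| <= e * (t + 1).
  rewrite -[X in t + X]opprK; apply: Rintegral_itv_bound => //; first lra.
  by move=> u u1; apply: hD; lra.
(* The same integral measured from the other end, where [H] vanishes by the normalisation of [F]. *)
have hD2 : `|\int[leb]_(u in `[-1, t]) D u| <= e * (1 - t).
  have := @Rintegral_itvB R D (BLeft (-1)) (BRight 1) t (iD _ _).
  rewrite !bnd_simp => /(_ (ltW t0) (ltW t2)).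
  rewrite -(HD 1) ?H1; last lra.
  rewrite expr1n subrr mul0r subr0 sub0r => /(congr1 (fun x => `|x|)).
  rewrite normrN => ->.
  rewrite Rintegral_itv_obnd_cbnd; last first.
    apply: integrableS (iD t 1) => //; exact: subset_itv_oc_cc.
  apply: Rintegral_itv_bound => //; first lra.
  by move=> u u1; apply: hD; lra.
have hk : `|kappa psi t - g^`().[t]| <= e.
  rewrite kappaE// -[g^`().[t]](mulKf (lt0r_neq0 w0)) -mulrBr HD//.
  rewrite normrM normfV (gtr0_norm w0) mulrC ler_pdivrMr//.
  have [tp|tn] := leP 0 t; first by apply: le_trans hD2 _; rewrite ler_wpM2l//; nra.
  by apply: le_trans hD1 _; rewrite ler_wpM2l//; nra.
split => //; rewrite -[X in X * _]gtr0_norm// -normrM derive1E.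
have dk := is_derive_kappa t1.
rewrite derive_val.
have -> : (1 - t ^+ 2) * (((4 * pi)^-1 - F t + 2 * t * kappa psi t) / (1 - t ^+ 2) -
    g^`()^`().[t]) = D t + 2 * t * (kappa psi t - g^`().[t]).
  rewrite mulrBr mulrCA mulfV ?gt_eqF// mulr1 /D /green_zonal.
  rewrite -polyC1 derivM derivB derivXn derivC !hornerE /=.
  by ring.
apply: le_trans (ler_normD _ _) _; rewrite normrM [3 * e](_ : _ = e + 2 * e); last by ring.
apply: lerD; first by apply: hD; lra.
apply: ler_pM => //; rewrite normrM [`|2|]ger0_norm// -[leRHS]mulr1 ler_wpM2l//.
by rewrite ler_norml; lra.
Qed.

End ZonalApproximation.

(** * Separable kernels *)

Section SurfaceIntegrals.
Variable R : realType.
Local Notation V := 'cV[R]_3.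
Local Notation mu := (@surface_measure R).
Local Notation S2 := (sphere R : set (borel3 R)).
Implicit Types (h : V -> R) (p : poly3 R).

Definition sintegrable h := mu.-integrable S2 (EFin \o h).

Let mS := @measurable_sphere R.

Lemma sintegrableD h h' : sintegrable h -> sintegrable h' ->
  sintegrable (fun x => h x + h' x).
Proof. by move=> ih ih'; exact: (integrableD mS ih ih'). Qed.

Lemma sintegrableB h h' : sintegrable h -> sintegrable h' ->
  sintegrable (fun x => h x - h' x).
Proof. by move=> ih ih'; exact: (integrableB mS ih ih'). Qed.

Lemma sintegrableZ c h : sintegrable h -> sintegrable (fun x => c * h x).
Proof. by move=> ih; exact: (integrableZl mS c ih). Qed.

Lemma sintegrable_norm h : sintegrable h -> sintegrable (fun x => `|h x|).
Proof. by move=> ih; exact: (integrable_norm ih). Qed.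

Lemma sintegrable0 : sintegrable (fun=> 0).
Proof. by rewrite /sintegrable; exact: integrable0. Qed.

Lemma sintegrable_sum (I : Type) (s : seq I) (F : I -> V -> R) :
  (forall i, sintegrable (F i)) -> sintegrable (fun x => \sum_(i <- s) F i x).
Proof.
move=> iF; elim: s => [|i s IH].
  by under [X in sintegrable X]eq_fun do rewrite big_nil; exact: sintegrable0.
by under [X in sintegrable X]eq_fun do rewrite big_cons; exact: sintegrableD.
Qed.

Lemma sintegrable_polyfunM p h : sintegrable h -> sintegrable (fun x => polyfun p x * h x).
Proof.
move=> ih; apply: (@integrableMr _ _ _ mu _ mS (polyfun p) (EFin \o h)) => //.
  by apply: measurable_funTS; exact: measurable_polyfun.
exists (mpoly_norm1 p); split; first exact: num_real.
by move=> r pr x Sx /=; apply: le_trans (polyfun_le _ Sx) _; exact: ltW.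
Qed.

Lemma sintD h h' : sintegrable h -> sintegrable h' ->
  sint (fun x => h x + h' x) = sint h + sint h'.
Proof. by move=> ih ih'; exact: (RintegralD mS ih ih'). Qed.

Lemma sintB h h' : sintegrable h -> sintegrable h' ->
  sint (fun x => h x - h' x) = sint h - sint h'.
Proof. by move=> ih ih'; exact: (RintegralB mS ih ih'). Qed.

Lemma sintZ c h : sintegrable h -> sint (fun x => c * h x) = c * sint h.
Proof. by move=> ih; exact: (RintegralZl c mS ih). Qed.

Lemma sint0 : sint (fun _ : V => 0 : R) = 0.
Proof. by rewrite /sint Rintegral_cst// mul0r. Qed.

Lemma sint_sum (I : Type) (s : seq I) (F : I -> V -> R) :
  (forall i, sintegrable (F i)) ->
  sint (fun x => \sum_(i <- s) F i x) = \sum_(i <- s) sint (F i).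
Proof.
move=> iF; elim: s => [|i s IH].
  by rewrite big_nil; under [X in sint X]eq_fun do rewrite big_nil; exact: sint0.
rewrite big_cons -IH; under [X in sint X]eq_fun do rewrite big_cons.
by rewrite sintD//; exact: sintegrable_sum.
Qed.

Lemma le_sint h h' : sintegrable h -> sintegrable h' ->
  (forall x, sphere R x -> h x <= h' x) -> sint h <= sint h'.
Proof. by move=> ih ih' hh'; exact: (le_Rintegral mS ih ih' hh'). Qed.

Lemma le_norm_sint h : sintegrable h -> `|sint h| <= sint (fun x => `|h x|).
Proof. by move=> ih; exact: (le_normr_Rintegral mS ih). Qed.

Lemma le_norm_sintM h h' (c : R) : sintegrable h -> sintegrable h' ->
  (forall x, sphere R x -> `|h x| <= c * h' x) -> `|sint h| <= c * sint h'.
Proof.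
move=> ih ih' hh'; apply: le_trans (le_norm_sint ih) _.
rewrite -sintZ//; apply: le_sint => //; [exact: sintegrable_norm|exact: sintegrableZ].
Qed.

Definition separable (K : V -> V -> R) := exists s : seq (poly3 R * poly3 R),
  forall x y, K x y = \sum_(ab <- s) polyfun ab.1 x * polyfun ab.2 y.

Lemma eq_separable K K' : (forall x y, K x y = K' x y) -> separable K' -> separable K.
Proof. by move=> KK' [s hs]; exists s => x y; rewrite KK'. Qed.

Lemma separableC K : separable K -> separable (fun x y => K y x).
Proof.
move=> [s hs]; exists [seq (ab.2, ab.1) | ab <- s] => x y.
by rewrite hs big_map; apply: eq_bigr => ab _; rewrite mulrC.
Qed.

Lemma separable_fst p : separable (fun x _ => polyfun p x).
Proof.
exists [:: (p, 1)] => x y; rewrite big_seq1 /= /polyfun.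
by rewrite mpoly.meval1 mulr1.
Qed.

Lemma separable_snd p : separable (fun _ y => polyfun p y).
Proof.
exists [:: (1, p)] => x y; rewrite big_seq1 /= /polyfun.
by rewrite mpoly.meval1 mul1r.
Qed.

Lemma separable_cst (c : R) : separable (fun _ _ => c).
Proof.
exists [:: (c%:A, 1)] => x y; rewrite big_seq1 /= /polyfun.
by rewrite mpoly.mevalZ !mpoly.meval1 !mulr1.
Qed.

Lemma separableD K K' : separable K -> separable K' ->
  separable (fun x y => K x y + K' x y).
Proof.
by move=> [s hs] [s' hs']; exists (s ++ s') => x y; rewrite big_cat hs hs'.
Qed.

Lemma separableM K K' : separable K -> separable K' ->
  separable (fun x y => K x y * K' x y).
Proof.
move=> [s hs] [s' hs'].
exists [seq (ab.1 * ab'.1, ab.2 * ab'.2) | ab <- s, ab' <- s'] => x y.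
rewrite big_allpairs_dep hs hs' mulr_suml; apply: eq_bigr => ab _.
rewrite mulr_sumr; apply: eq_bigr => ab' _ /=.
by rewrite /polyfun !mpoly.mevalM; ring.
Qed.

Lemma separableN K : separable K -> separable (fun x y => - K x y).
Proof.
move=> sK; under eq_fun do under eq_fun do rewrite -mulN1r.
by apply: separableM => //; exact: separable_cst.
Qed.

Lemma separable_sum (I : Type) (s : seq I) (K : I -> V -> V -> R) :
  (forall i, separable (K i)) -> separable (fun x y => \sum_(i <- s) K i x y).
Proof.
move=> sK; elim: s => [|i s IH].
  by under eq_fun do under eq_fun do rewrite big_nil; exact: separable_cst.
by under eq_fun do under eq_fun do rewrite big_cons; exact: separableD.
Qed.

Lemma separable_horner (q : {poly R}) K : separable K -> separable (fun x y => q.[K x y]).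
Proof.
move=> sK; elim/poly_ind: q => [|q c IH].
  by under eq_fun do under eq_fun do rewrite horner0; exact: separable_cst.
under eq_fun do under eq_fun do rewrite hornerMXaddC.
by apply: separableD; [exact: separableM|exact: separable_cst].
Qed.

Lemma separable_integrable K h x : separable K -> sintegrable h ->
  sintegrable (fun y => K x y * h y).
Proof.
move=> [s hs] ih.
under [X in sintegrable X]eq_fun do rewrite hs mulr_suml.
apply: sintegrable_sum => ab.
under [X in sintegrable X]eq_fun do rewrite -mulrA.
by apply: sintegrableZ; exact: sintegrable_polyfunM.
Qed.

Lemma separable_sint_polyfun K h : separable K -> sintegrable h ->
  exists p, forall x, sint (fun y => K x y * h y) = polyfun p x.
Proof.
move=> [s hs] ih.
exists (\sum_(ab <- s) sint (fun y => polyfun ab.2 y * h y) *: ab.1) => x.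
rewrite /polyfun raddf_sum /=.
under [X in sint X]eq_fun do rewrite hs mulr_suml.
rewrite sint_sum => [|ab].
  apply: eq_bigr => ab _; rewrite mpoly.mevalZ mulrC -sintZ; last exact: sintegrable_polyfunM.
  by congr sint; apply/funext => y; rewrite mulrA.
under [X in sintegrable X]eq_fun do rewrite -mulrA.
by apply: sintegrableZ; exact: sintegrable_polyfunM.
Qed.

(** Both sides equal the same finite sum of products of two single integrals. *)
Lemma separable_fubini K h p : separable K -> sintegrable h ->
  sint (fun x => polyfun p x * sint (fun y => K x y * h y)) =
  sint (fun y => h y * sint (fun x => K x y * polyfun p x)).
Proof.
move=> [s hs] ih.
have i1 (a b : poly3 R) x : sintegrable (fun y => polyfun a x * polyfun b y * h y).
  under [X in sintegrable X]eq_fun do rewrite -mulrA.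
  by apply: sintegrableZ; exact: sintegrable_polyfunM.
have ip a := polyfun_integrable a : sintegrable (polyfun a).
transitivity (\sum_(ab <- s) sint (fun x => polyfun ab.1 x * polyfun p x) *
    sint (fun y => polyfun ab.2 y * h y)).
  transitivity (sint (fun x => \sum_(ab <- s)
      sint (fun y => polyfun ab.2 y * h y) * (polyfun ab.1 x * polyfun p x))).
    congr sint; apply/funext => x.
    under [X in _ * sint X]eq_fun do rewrite hs mulr_suml.
    rewrite sint_sum// mulr_sumr; apply: eq_bigr => ab _.
    under [X in sint X]eq_fun do rewrite -mulrA.
    by rewrite sintZ; [ring|exact: sintegrable_polyfunM].
  rewrite sint_sum => [|ab]; last by apply: sintegrableZ; exact: sintegrable_polyfunM.
  by apply: eq_bigr => ab _; rewrite sintZ; [rewrite mulrC|exact: sintegrable_polyfunM].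
transitivity (sint (fun y => \sum_(ab <- s)
    sint (fun x => polyfun ab.1 x * polyfun p x) * (polyfun ab.2 y * h y))).
  rewrite sint_sum => [|ab]; last by apply: sintegrableZ; exact: sintegrable_polyfunM.
  by apply: eq_bigr => ab _; rewrite sintZ//; exact: sintegrable_polyfunM.
congr sint; apply/funext => y.
under [X in _ = _ * sint X]eq_fun do rewrite hs mulr_suml.
rewrite sint_sum => [|ab].
  rewrite mulr_sumr; apply: eq_bigr => ab _.
  under [X in _ = _ * sint X]eq_fun do rewrite mulrAC mulrC.
  by rewrite sintZ; [ring|exact: sintegrable_polyfunM].
under [X in sintegrable X]eq_fun do rewrite mulrAC mulrC.
by apply: sintegrableZ; exact: sintegrable_polyfunM.
Qed.

Lemma measurable_dot_self (f : V -> V) :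
  (forall i, measurable_fun S2 (fun x : borel3 R => f x i 0)) ->
  measurable_fun S2 (fun x : borel3 R => dot (f x) (f x)).
Proof.
move=> mf; rewrite (_ : (fun x => _) = (fun x : borel3 R => \sum_j f x j 0 * f x j 0)).
  by apply: measurable_sum => j; exact: measurable_funM.
by apply/funext => x; rewrite dotE.
Qed.

Lemma dot_self_ge0 (v : V) : 0 <= dot v v.
Proof. by rewrite dotE sumr_ge0// => j _; rewrite -expr2 sqr_ge0. Qed.

Lemma tangential_L2_dot_integrable (f : V -> V) : tangential_L2 f ->
  sintegrable (fun x => dot (f x) (f x)).
Proof.
move=> [mf _ lf]; apply/integrableP; split.
  by apply/measurable_EFinP; exact: measurable_dot_self.
rewrite (eq_integral (fun x : borel3 R => (dot (f x) (f x))%:E))// => x _.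
by rewrite /= ger0_norm// dot_self_ge0.
Qed.

(** [|f_i| <= 1 + |f|^2], and the sphere has finite measure. *)
Lemma tangential_L2_integrable (f : V -> V) i : tangential_L2 f ->
  sintegrable (fun x => f x i 0).
Proof.
move=> hf; have [mf _ _] := hf; have iff := tangential_L2_dot_integrable hf.
have i1 : sintegrable (fun=> 1 : R).
  by apply: (@sphere_bounded_integrable _ _ 1) => // x _; rewrite normr1.
apply: le_integrable (sintegrableD i1 iff) => //; first exact/measurable_EFinP.
move=> x Sx /=; rewrite lee_fin [leRHS]ger0_norm ?addr_ge0 ?dot_self_ge0//.
have : f x i 0 ^+ 2 <= dot (f x) (f x).
  rewrite dotE (bigD1 i)//= expr2 lerDl sumr_ge0// => j _.
  by rewrite -expr2 sqr_ge0.
have := sqr_ge0 (`|f x i 0| - 1); rewrite sqrrB1 real_normK ?num_real//.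
by have := normr_ge0 (f x i 0); lra.
Qed.

Lemma tangential_L2B (h h' : V -> V) : tangential_L2 h -> tangential_L2 h' ->
  tangential_L2 (fun x => h x - h' x).
Proof.
move=> hL hL'; have [m1 t1 _] := hL; have [m2 t2 _] := hL'.
have mB i : measurable_fun S2 (fun x : borel3 R => (h x - h' x) i 0).
  rewrite (_ : (fun x => _) = fun x : borel3 R => h x i 0 - h' x i 0); last first.
    by apply/funext => x; rewrite !mxE.
  exact: measurable_funB.
split => //.
- move=> x Sx; have -> : dot x (h x - h' x) = dot x (h x) - dot x (h' x).
    by rewrite !dotE -sumrB; apply: eq_bigr => i _; rewrite !mxE mulrBr.
  by rewrite t1// t2// subr0.
- have i2 : sintegrable (fun x => 2 * dot (h x) (h x) + 2 * dot (h' x) (h' x)).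
    by apply: sintegrableD; apply: sintegrableZ; exact: tangential_L2_dot_integrable.
  suff : sintegrable (fun x => dot (h x - h' x) (h x - h' x)).
    by move=> /integrable_lty; apply.
  apply: le_integrable i2 => //.
    by apply/measurable_EFinP; exact: measurable_dot_self.
  move=> x Sx /=; rewrite lee_fin !ger0_norm ?addr_ge0 ?mulr_ge0 ?dot_self_ge0//.
  rewrite !dotE !mulr_sumr -big_split; apply: ler_sum => i _ /=; rewrite !mxE.
  by have := sqr_ge0 (h x i 0 + h' x i 0); nra.
Qed.
End SurfaceIntegrals.

(** * The matrix kernels *)

Section MatrixKernels.
Variable R : realType.
Local Notation V := 'cV[R]_3.
Implicit Types (x y : V) (k : R) (i j : 'I_3) (Z : poly3 R).

(** [k] and [k'] are free scalars in place of [kappa (x . y)] and its derivative; as the kernel is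
    linear in them, differences of kernels are again of this form. *)
Definition div_ker k (k' : R) x y : 'M[R]_3 :=
  - k' *: (cross x y *m (cross x y)^T) + k *: ((dot x y)%:M - y *m x^T).

Definition curl_ker k (k' : R) x y : 'M[R]_3 :=
  k' *: ((y - dot x y *: x) *m (x - dot x y *: y)^T) +
  k *: ((1%:M - x *m x^T) *m (1%:M - y *m y^T)).

Lemma crossE x y i : cross x y i 0 =
  x (i + 1) 0 * y (i + 2) 0 - x (i + 2) 0 * y (i + 1) 0.
Proof. by rewrite mxE. Qed.

Lemma div_kerE k k' x y i j : div_ker k k' x y i j =
  - k' * (cross x y i 0 * cross x y j 0) +
  k * ((i == j)%:R * dot x y - y i 0 * x j 0).
Proof.
rewrite /div_ker; move: (cross x y) => c.
by rewrite !mxE !big_ord1 !mxE !ord1 mulr_natl.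
Qed.

Lemma curl_kerE k k' x y i j : curl_ker k k' x y i j =
  k' * ((y i 0 - dot x y * x i 0) * (x j 0 - dot x y * y j 0)) +
  k * \sum_l ((i == l)%:R - x i 0 * x l 0) * ((l == j)%:R - y l 0 * y j 0).
Proof.
rewrite /curl_ker; move: (dot x y) => t.
rewrite !mxE !big_ord1 !mxE !ord1; congr (_ + _ * _); apply: eq_bigr => l _.
by rewrite !mxE !big_ord1 !mxE !ord1.
Qed.

Lemma cross_sqr x y : sphere R x -> sphere R y ->
  \sum_i cross x y i 0 ^+ 2 = 1 - dot x y ^+ 2.
Proof.
move=> /sphere_sqr hx /sphere_sqr hy.
rewrite -[1]mulr1 -{1}hx -hy dotE !big_ord3 !crossE !ord3_add; ring.
Qed.

Lemma dotC x y : dot x y = dot y x.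
Proof. by rewrite !dotE; apply: eq_bigr => i _; rewrite mulrC. Qed.

Lemma reject_sqr x y : sphere R x -> sphere R y ->
  \sum_i (y i 0 - dot x y * x i 0) ^+ 2 = 1 - dot x y ^+ 2.
Proof.
move=> /sphere_sqr hx /sphere_sqr hy.
transitivity (\sum_i y i 0 ^+ 2 - 2 * dot x y * (\sum_i x i 0 * y i 0) +
    dot x y ^+ 2 * (\sum_i x i 0 ^+ 2)).
  by rewrite !big_ord3; ring.
by rewrite -dotE hx hy; ring.
Qed.

Lemma norm_mul_le_sqr (a b s : R) : a ^+ 2 <= s -> b ^+ 2 <= s -> `|a * b| <= s.
Proof.
move=> ha hb; rewrite ler_norml; have := sqr_ge0 (a - b); have := sqr_ge0 (a + b).
by rewrite sqrrD sqrrB; lra.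
Qed.

Lemma sqr_le_sum (a : 'I_3 -> R) i : a i ^+ 2 <= \sum_j a j ^+ 2.
Proof. by rewrite (bigD1 i)//= lerDl sumr_ge0// => j _; exact: sqr_ge0. Qed.

(** The weight of [k'] is the squared length of [x * y], precisely the weight with which [kappa'] is
    controlled. *)
Lemma div_ker_le k k' x y i j : sphere R x -> sphere R y ->
  `|div_ker k k' x y i j| <= (1 - dot x y ^+ 2) * `|k'| + 2 * `|k|.
Proof.
move=> Sx Sy; rewrite div_kerE; apply: le_trans (ler_normD _ _) _.
rewrite !normrM normrN -normrM [X in X + _ <= _]mulrC [X in _ + X <= _]mulrC.
apply: lerD; rewrite ler_wpM2r//.
  by rewrite -cross_sqr//; apply: norm_mul_le_sqr; exact: (sqr_le_sum (fun i => cross x y i 0)).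
have dot1 : dot x y ^+ 2 <= 1.
  by rewrite -subr_ge0 -cross_sqr// sumr_ge0// => l _; exact: sqr_ge0.
apply: le_trans (ler_normB _ _) _; rewrite (_ : 2 = 1 + 1)//; apply: lerD; rewrite normrM.
  rewrite mulr_ile1 ?normr_ge0//; first by case: (i == j); rewrite ?normr1 ?normr0.
  by rewrite -(@ler_pXn2r _ 2) ?nnegrE// expr1n real_normK ?num_real.
by rewrite mulr_ile1 ?normr_ge0 ?sphere_coord_le1.
Qed.

(** Here the vectors multiplying [k'] are the components of [y] orthogonal to [x] and of [x]
    orthogonal to [y], both of squared length [1 - t^2]. The factor 12 counts three products of
    projection entries, each entry being at most 2. *)
Lemma curl_ker_le k k' x y i j : sphere R x -> sphere R y ->
  `|curl_ker k k' x y i j| <= (1 - dot x y ^+ 2) * `|k'| + 12 * `|k|.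
Proof.
move=> Sx Sy; rewrite curl_kerE; apply: le_trans (ler_normD _ _) _.
rewrite !normrM -normrM [X in X + _ <= _]mulrC [X in _ + X <= _]mulrC.
apply: lerD; rewrite ler_wpM2r//.
  apply: norm_mul_le_sqr.
    by rewrite -reject_sqr//; exact: (sqr_le_sum (fun i => y i 0 - dot x y * x i 0)).
  by rewrite dotC -reject_sqr//; exact: (sqr_le_sum (fun j => x j 0 - dot y x * y j 0)).
have h (a b : 'I_3) (v : V) : sphere R v -> `|(a == b)%:R - v a 0 * v b 0| <= 2.
  move=> Sv; apply: le_trans (ler_normB _ _) _; rewrite (_ : 2 = 1 + 1)//; apply: lerD.
    by case: (a == b); rewrite ?normr1 ?normr0.
  by rewrite normrM mulr_ile1 ?normr_ge0 ?sphere_coord_le1.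
apply: le_trans (ler_norm_sum _ _ _) _.
have -> : 12 = \sum_(l < 3) 2 * 2 :> R by rewrite big_ord3; ring.
by apply: ler_sum => l _; rewrite normrM ler_pM// h.
Qed.

Lemma div_kerB k1 k1' k2 k2' x y i j :
  div_ker k1 k1' x y i j - div_ker k2 k2' x y i j =
  div_ker (k1 - k2) (k1' - k2') x y i j.
Proof. by rewrite !div_kerE; ring. Qed.

Lemma curl_kerB k1 k1' k2 k2' x y i j :
  curl_ker k1 k1' x y i j - curl_ker k2 k2' x y i j =
  curl_ker (k1 - k2) (k1' - k2') x y i j.
Proof. by rewrite !curl_kerE; ring. Qed.

Lemma dot_div_ker k k' x y (v : V) : dot x (div_ker k k' x y *m v) = 0.
Proof.
rewrite dotE; under eq_bigr do rewrite mxE mulr_sumr.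
rewrite exchange_big big1//= => j _; under eq_bigr do rewrite div_kerE.
by rewrite !big_ord3 dotE big_ord3 !crossE; elim/ord3_ind: j; rewrite !ord3_add /=; ring.
Qed.

Lemma dot_curl_ker k k' x y (v : V) : sphere R x -> dot x (curl_ker k k' x y *m v) = 0.
Proof.
move=> /sphere_sqr hx.
rewrite dotE; under eq_bigr do rewrite mxE mulr_sumr.
rewrite exchange_big big1//= => j _; under eq_bigr do rewrite curl_kerE.
transitivity ((1 - \sum_i x i 0 ^+ 2) * (k' * (x j 0 - dot x y * y j 0) * dot x y +
    k * (x j 0 - dot x y * y j 0)) * v j 0).
  by rewrite dotE !big_ord3; elim/ord3_ind: j => /=; ring.
by rewrite hx subrr !mul0r.
Qed.

(* On the sphere, [curl_ker] is the conjugate of [div_ker] by the rotations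
   [v |-> x * v] and [v |-> y * v] of the two tangent planes. *)
Lemma curl_ker_cross k k' x y (u : V) j : sphere R x -> sphere R y ->
  \sum_i curl_ker k k' x y i j * u i 0 =
  - cross y (\col_l \sum_i div_ker k k' x y i l * cross x u i 0) j 0.
Proof.
move=> /sphere_sqr hx /sphere_sqr hy.
pose X := \sum_i x i 0 ^+ 2; pose Y := \sum_i y i 0 ^+ 2.
pose xu := dot x u; pose yu := dot y u; pose t := dot x y.
(* With [X = |x|^2] and [Y = |y|^2] left symbolic, the right-hand side equals this form identically;
   for the left-hand side they are set to 1. *)
transitivity (k' * ((X * yu - t * xu) * (Y * x j 0 - t * y j 0)) +
    k * (X * Y * u j 0 - Y * x j 0 * xu - X * y j 0 * yu + t * y j 0 * xu)).
  rewrite /X /Y hx hy.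
  under eq_bigr do rewrite curl_kerE.
  rewrite /xu /yu /t !dotE.
  by rewrite !big_ord3; elim/ord3_ind: j => /=; ring.
rewrite [in RHS]crossE !mxE.
under [X in - (_ * X - _)]eq_bigr do rewrite div_kerE.
under [X in - (_ - _ * X)]eq_bigr do rewrite div_kerE.
rewrite /xu /yu /X /Y /t !dotE.
by rewrite !big_ord3; elim/ord3_ind: j; rewrite !ord3_add /= !crossE !ord3_add; ring.
Qed.

Definition green_ker (g : {poly R}) x y : 'M[R]_3 :=
  div_ker g^`().[dot x y] g^`()^`().[dot x y] x y +
  curl_ker g^`().[dot x y] g^`()^`().[dot x y] x y.

(** Both rotation fields act in [x]: on functions of [x . y] the field in [y] is minus the field in
    [x], whence the sign. *)
Lemma div_ker_rotd (g : {poly R}) x y i j :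
  div_ker g^`().[dot x y] g^`()^`().[dot x y] x y i j =
  polyfun (- rotd i (rotd j (zonal (fun l => y l 0) g))) x.
Proof.
have lf : mpoly.meval (fun l => x l 0) (linform (fun l => y l 0)) = dot x y.
  rewrite /linform raddf_sum dotE; apply: eq_bigr => l _.
  by rewrite /= mpoly.mevalZ meval_var mulrC.
have cp l : mpoly.meval (fun l => x l 0) (crossp (fun l => y l 0) l) = cross x y l 0.
  by rewrite /crossp mpoly.mevalB !mpoly.mevalZ !meval_var crossE; ring.
rewrite rotd_zonal rotdM rotd_zonal rotd_crossp div_kerE.
rewrite /polyfun mpoly.mevalN mpoly.mevalD !mpoly.mevalM !meval_zonal.
rewrite mpoly.mevalB !mpoly.mevalZ !cp lf meval_var.
have -> : \sum_l y l 0 * x l 0 = dot x y by rewrite dotC dotE.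
by ring.
Qed.

End MatrixKernels.

(** * Polynomial kernels acting on vector spherical harmonics *)

Section GreenKernel.
Variable R : realType.
Local Notation V := 'cV[R]_3.
Implicit Types (x y : V) (i j : 'I_3) (Z : poly3 R) (g : {poly R}).

Lemma polyfun_sum (I : Type) (s : seq I) (F : I -> poly3 R) x :
  polyfun (\sum_(i <- s) F i) x = \sum_(i <- s) polyfun (F i) x.
Proof. by rewrite /polyfun raddf_sum. Qed.

Lemma polyfunM (p q : poly3 R) x : polyfun (p * q) x = polyfun p x * polyfun q x.
Proof. exact: mpoly.mevalM. Qed.

Lemma polyfunB (p q : poly3 R) x : polyfun (p - q) x = polyfun p x - polyfun q x.
Proof. exact: mpoly.mevalB. Qed.

Lemma polyfun_var i x : polyfun (var R i) x = x i 0.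
Proof. exact: meval_var. Qed.

Lemma separable_coord1 i : separable (fun x _ : V => x i 0).
Proof.
apply: eq_separable (separable_fst (var R i)) => x y.
by rewrite polyfun_var.
Qed.

Lemma separable_coord2 i : separable (fun _ y : V => y i 0).
Proof.
apply: eq_separable (separable_snd (var R i)) => x y.
by rewrite polyfun_var.
Qed.

Lemma separable_dot : separable (fun x y : V => dot x y).
Proof.
apply: (eq_separable (@dotE R)); apply: separable_sum => i.
by apply: separableM; [exact: separable_coord1|exact: separable_coord2].
Qed.

Lemma separable_green_ker g i j : separable (fun x y => green_ker g x y i j).
Proof.
apply: (@eq_separable _ _ (fun x y =>
    (- g^`()^`().[dot x y] * ((x (i + 1) 0 * y (i + 2) 0 - x (i + 2) 0 * y (i + 1) 0) *
     (x (j + 1) 0 * y (j + 2) 0 - x (j + 2) 0 * y (j + 1) 0)) +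
     g^`().[dot x y] * ((i == j)%:R * dot x y - y i 0 * x j 0)) +
    (g^`()^`().[dot x y] * ((y i 0 - dot x y * x i 0) * (x j 0 - dot x y * y j 0)) +
     g^`().[dot x y] * \sum_l ((i == l)%:R - x i 0 * x l 0) * ((l == j)%:R - y l 0 * y j 0)))).
  by move=> x y; rewrite mxE div_kerE curl_kerE !crossE.
have h1 := separable_coord1; have h2 := separable_coord2.
have h0 := @separable_cst R; have hd := separable_dot.
have hq (q : {poly R}) := separable_horner q hd.
by repeat first [exact: h0|exact: h1|exact: h2|exact: hq|exact: hd|apply: separableD|
  apply: separableM|apply: separableN|apply: separable_sum => ? /=].
Qed.

Lemma dot_green_ker g x y (v : V) : sphere R x -> dot x (green_ker g x y *m v) = 0.
Proof.
move=> Sx; rewrite /green_ker mulmxDl.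
rewrite (_ : forall a b, dot x (a + b) = dot x a + dot x b); last first.
  by move=> a b; rewrite !dotE -big_split; apply: eq_bigr => i _ /=; rewrite mxE mulrDr.
by rewrite dot_div_ker dot_curl_ker// addr0.
Qed.

Definition surface_gradient Z i : poly3 R := mpoly.mderiv i Z - var R i * euler Z.

Lemma sint_div_ker g (U : 'I_3 -> poly3 R) y j :
  sint (fun x => \sum_i div_ker g^`().[dot x y] g^`()^`().[dot x y] x y i j * polyfun (U i) x) =
  sintp (\sum_i - rotd i (rotd j (zonal (fun l => y l 0) g)) * U i).
Proof.
congr sint; apply/funext => x; rewrite polyfun_sum; apply: eq_bigr => i _.
by rewrite div_ker_rotd polyfunM.
Qed.

Lemma sint_div_ker_rotd g l Z y j : sphere R y -> solid_harmonic l.+1 Z ->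
  sint (fun x => \sum_i div_ker g^`().[dot x y] g^`()^`().[dot x y] x y i j *
    polyfun (rotd i Z) x) =
  legendre_coefp l.+1 (green_zonal g) * polyfun (rotd j Z) y.
Proof.
move=> /sphere_sqr Sy hZ; rewrite sint_div_ker.
apply: (@kernel_rotd _ (@sintp R) (@sintp_rotd R) (@sintp_sqnorm R)
  (fun l => @legendre_coefp R l) _ _ _ (fun l => y l 0) _ g (4 * pi)^-1 l Z j hZ) => //.
- exact: (etrans (legendre_coefp01 R) (esym (sintp1 R))).
- exact: legendre_coefpS1.
- exact: legendre_coefp_mulX.
Qed.

Lemma sint_div_ker_surface_gradient g Z y j :
  sint (fun x => \sum_i div_ker g^`().[dot x y] g^`()^`().[dot x y] x y i j *
    polyfun (surface_gradient Z i) x) = 0.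
Proof.
by rewrite sint_div_ker; apply: kernel_surface_gradient; exact: sintp_rotd.
Qed.

(** [W] is [x * U] on the sphere. By the conjugation [curl_ker_cross], if the divergence-free part
    sends [U] to [u] and [W] to [w], the curl-free part sends [U] to [- y * w]. *)
Lemma sint_green_ker g (U W : 'I_3 -> poly3 R) (u w : 'I_3 -> R) y j : sphere R y ->
  (forall x i, sphere R x -> polyfun (W i) x =
    x (i + 1) 0 * polyfun (U (i + 2)) x - x (i + 2) 0 * polyfun (U (i + 1)) x) ->
  (forall j, sint (fun x => \sum_i div_ker g^`().[dot x y] g^`()^`().[dot x y] x y i j *
    polyfun (U i) x) = u j) ->
  (forall j, sint (fun x => \sum_i div_ker g^`().[dot x y] g^`()^`().[dot x y] x y i j *
    polyfun (W i) x) = w j) ->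
  sint (fun x => \sum_i green_ker g x y i j * polyfun (U i) x) =
  u j - (y (j + 1) 0 * w (j + 2) - y (j + 2) 0 * w (j + 1)).
Proof.
move=> Sy hW hu hw.
have ip (U' : 'I_3 -> poly3 R) l : sintegrable (fun x =>
    \sum_i div_ker g^`().[dot x y] g^`()^`().[dot x y] x y i l * polyfun (U' i) x).
  apply: sintegrable_sum => i; under [X in sintegrable X]eq_fun do rewrite div_ker_rotd.
  exact/sintegrable_polyfunM/polyfun_integrable.
rewrite -hu -!hw -!sintZ// -!sintB//; try exact: sintegrableZ; last first.
  by apply: sintegrableB; exact: sintegrableZ.
apply: eq_sint => x Sx.
pose ux := \col_i polyfun (U i) x.
have := @curl_ker_cross _ g^`().[dot x y] g^`()^`().[dot x y] x y ux j Sx Sy.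
rewrite crossE !mxE.
have hl l : \sum_i div_ker g^`().[dot x y] g^`()^`().[dot x y] x y i l * cross x ux i 0 =
    \sum_i div_ker g^`().[dot x y] g^`()^`().[dot x y] x y i l * polyfun (W i) x.
  by apply: eq_bigr => i _; rewrite hW// crossE !mxE.
rewrite !hl => <-; rewrite -big_split; apply: eq_bigr => i _ /=.
by rewrite /ux !mxE mulrDl.
Qed.

(** The quarter turn of [L Z] is minus the surface gradient of [Z], which the divergence-free part
    annihilates; so only that part contributes. *)
Lemma sint_green_ker_rotd g l Z y j : sphere R y -> solid_harmonic l.+1 Z ->
  sint (fun x => \sum_i green_ker g x y i j * polyfun (rotd i Z) x) =
  legendre_coefp l.+1 (green_zonal g) * polyfun (rotd j Z) y.
Proof.
move=> Sy hZ.
rewrite (@sint_green_ker g (fun i => rotd i Z) (fun i => - surface_gradient Z i)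
  (fun j => legendre_coefp l.+1 (green_zonal g) * polyfun (rotd j Z) y) (fun=> 0)) //.
- by rewrite !mulr0 !subr0.
- move=> x i /sphere_sqr Sx.
  transitivity (polyfun (var R i * euler Z - mpoly.mderiv i Z) x); first by congr polyfun; rewrite opprB.
  transitivity (polyfun (var R i * euler Z - sqnorm3 R * mpoly.mderiv i Z) x).
    by rewrite !polyfunB (polyfunM (sqnorm3 R)) polyfun_sqnorm3 Sx mul1r.
  rewrite -!polyfun_var -!polyfunM -polyfunB; congr polyfun.
  by rewrite /rotd /euler /sqnorm3 !big_ord3; elim/ord3_ind: i; rewrite !ord3_add; ring.
- by move=> j'; exact: sint_div_ker_rotd.
- move=> j'; transitivity (-1 * sint (fun x =>
      \sum_i div_ker g^`().[dot x y] g^`()^`().[dot x y] x y i j' *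
        polyfun (surface_gradient Z i) x)); last first.
    by rewrite sint_div_ker_surface_gradient mulr0.
  rewrite -sintZ; last first.
    apply: sintegrable_sum => i; under [X in sintegrable X]eq_fun do rewrite div_ker_rotd.
    exact/sintegrable_polyfunM/polyfun_integrable.
  congr sint; apply/funext => x; rewrite mulr_sumr; apply: eq_bigr => i _.
  by rewrite /polyfun mpoly.mevalN; ring.
Qed.

(** Dually, the divergence-free part annihilates [U], while its quarter turn is [L Z]; turning the
    image back at [y] gives the surface gradient. *)
Lemma sint_green_ker_surface_gradient g l Z y j : sphere R y -> solid_harmonic l.+1 Z ->
  sint (fun x => \sum_i green_ker g x y i j * polyfun (surface_gradient Z i) x) =
  legendre_coefp l.+1 (green_zonal g) * polyfun (surface_gradient Z j) y.
Proof.
move=> Sy hZ.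
rewrite (@sint_green_ker g (surface_gradient Z) (fun i => rotd i Z)
  (fun=> 0) (fun j => legendre_coefp l.+1 (green_zonal g) * polyfun (rotd j Z) y)) //.
- move/sphere_sqr : Sy => Sy.
  transitivity (legendre_coefp l.+1 (green_zonal g) *
     polyfun (sqnorm3 R * mpoly.mderiv j Z - var R j * euler Z) y).
    rewrite sub0r mulrCA [X in - (_ - X)]mulrCA -mulrBr -mulrN; congr (_ * _).
    rewrite -!polyfun_var -!polyfunM -polyfunB.
    transitivity (polyfun (- (var R (j + 1) * rotd (j + 2) Z - var R (j + 2) * rotd (j + 1) Z)) y).
      by rewrite /polyfun mpoly.mevalN.
    congr polyfun.
    by rewrite /rotd /euler /sqnorm3 !big_ord3; elim/ord3_ind: j; rewrite !ord3_add; ring.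
  by rewrite /surface_gradient !polyfunB (polyfunM (sqnorm3 R)) polyfun_sqnorm3 Sy mul1r.
- move=> x i _; rewrite -!polyfun_var -!polyfunM -polyfunB; congr polyfun.
  by rewrite /surface_gradient /rotd; ring.
- by move=> j'; exact: sint_div_ker_surface_gradient.
- by move=> j'; exact: sint_div_ker_rotd.
Qed.

Lemma is_derive_coord i x (v : V) : is_derive x v (fun y : V => y i 0) (v i 0).
Proof.
have h : (fun t : R => t^-1 *: ((t *: v + x) i 0 - x i 0)) @ 0^' --> v i 0.
  apply: cvg_near_cst; near=> t.
  rewrite !mxE addrK; apply: mulKf.
  by near: t; exact: nbhs_dnbhs_neq.
apply: DeriveDef; first by apply/cvg_ex; exists (v i 0).
exact: cvg_lim h.
Unshelve. all: by end_near. Qed.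

Lemma is_derive_polyfun i (p : poly3 R) x :
  is_derive x (delta_mx i 0 : V) (polyfun p) (polyfun (mpoly.mderiv i p) x).
Proof.
pose P q := forall x, is_derive x (delta_mx i 0 : V) (polyfun q) (polyfun (mpoly.mderiv i q) x).
have PM a b : P a -> P b -> P (a * b).
  move=> ha hb x'; have := is_deriveM (ha x') (hb x').
  rewrite (_ : polyfun a * polyfun b = polyfun (a * b)); last first.
    by apply/funext => z; rewrite polyfunM.
  move=> h; apply: (is_derive_eq h).
  by rewrite mpoly.mderivM /polyfun mpoly.mevalD !mpoly.mevalM /GRing.scale /=; ring.
have P1 : P 1.
  move=> x'; rewrite mderiv1 (_ : polyfun 1 = cst 1); last first.
    by apply/funext => z; rewrite /polyfun mpoly.meval1.
  by rewrite /polyfun mpoly.meval0; exact: is_derive_cst.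
have Pvar l : P (var R l).
  move=> x'; rewrite (_ : polyfun (var R l) = fun z : V => z l 0); last first.
    by apply/funext => z; rewrite polyfun_var.
  apply: (is_derive_eq (is_derive_coord l x' _)).
  rewrite mxE mderiv_var eqxx andbT eq_sym; case: eqP => _.
    by rewrite /polyfun mpoly.meval1.
  by rewrite /polyfun mpoly.meval0.
move: x; rewrite -/(P p); elim/mpoly.mpolyind: p => [|c m q _ _ IH] x.
  rewrite mpoly.mderiv0 (_ : polyfun 0 = cst 0); last first.
    by apply/funext => z; rewrite /polyfun mpoly.meval0.
  exact: is_derive_cst.
have Pm : P (mpoly.mpolyX R m).
  rewrite mpoly.mpolyXE_id; apply: (big_ind P) => // l _.
  by elim: (m l) => [|n IHn]; rewrite ?expr0// exprS; apply: PM => //; exact: Pvar.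
have := is_deriveD (is_deriveZ c (Pm x)) (IH x).
rewrite (_ : c \*: polyfun (mpoly.mpolyX R m) + polyfun q =
    polyfun (c *: mpoly.mpolyX R m + q)); last first.
  by apply/funext => z; rewrite /polyfun mpoly.mevalD mpoly.mevalZ.
move=> h; apply: (is_derive_eq h).
by rewrite mpoly.mderivD mpoly.mderivZ /polyfun mpoly.mevalD mpoly.mevalZ.
Qed.

Lemma grad_polyfun (p : poly3 R) x i :
  grad (polyfun p) x i 0 = polyfun (mpoly.mderiv i p) x.
Proof.
by rewrite mxE; have h := is_derive_polyfun i p x; rewrite derive_val.
Qed.

Lemma L_star_polyfun (p : poly3 R) x i : L_star (polyfun p) x i 0 = polyfun (rotd i p) x.
Proof.
by rewrite /L_star crossE !grad_polyfun /rotd polyfunB !polyfunM !polyfun_var.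
Qed.

Lemma nabla_star_polyfun (p : poly3 R) x i :
  nabla_star (polyfun p) x i 0 = polyfun (surface_gradient p i) x.
Proof.
rewrite /surface_gradient polyfunB polyfunM polyfun_var -grad_polyfun /euler polyfun_sum.
rewrite /nabla_star mulmxBl mul1mx -mulmxA.
move: (grad_polyfun p x); move: (grad _ _) => v hv.
rewrite !mxE big_ord1 !mxE; congr (_ - _ * _); apply: eq_bigr => l _.
by rewrite polyfunM polyfun_var mxE hv.
Qed.

End GreenKernel.

(** * Convolution operators *)

Section ConvolutionLimit.
Variable R : realType.
Local Notation V := 'cV[R]_3.
Local Notation mu := (@surface_measure R).
Local Notation leb := (@lebesgue_measure R).
Local Notation leb2 := (leb \x leb)%E.
Local Notation S2 := (sphere R : set (borel3 R)).

Lemma measurable_set1_borel3 (a : V) : measurable ([set a] : set (borel3 R)).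
Proof.
pose q : poly3 R := \sum_i (var R i - (a i 0)%:A) ^+ 2.
have qE x : polyfun q x = \sum_i (x i 0 - a i 0) ^+ 2.
  rewrite /q polyfun_sum; apply: eq_bigr => i _.
  by rewrite expr2 polyfunM polyfunB polyfun_var -expr2 /polyfun mpoly.mevalZ mpoly.meval1 mulr1.
have := @measurable_polyfun R q measurableT [set 0] (measurable_set1 _).
rewrite setTI; congr measurable; apply/seteqP; split=> x /=; rewrite qE.
  move=> /eqP; rewrite psumr_eq0; last by move=> i _; exact: sqr_ge0.
  move=> /allP h; apply/matrixP => i j; rewrite !ord1.
  by have /(_ (mem_index_enum i)) := h i; rewrite sqrf_eq0 subr_eq0 => /eqP.
by move=> ->; rewrite big1// => i _; rewrite subrr expr0n.
Qed.

(** The last coordinate [cos theta] determines [theta] on [[0, pi]], so the preimage lies in a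
    vertical segment of the parameter plane. *)
Lemma surface_measure_set1 (a : V) : mu [set a] = 0%E.
Proof.
have mD := @measurable_spherical_domain R.
set N := spherical_domain R `&` @spherical_coord R @^-1` [set a].
have mN : measurable N.
  apply: measurableI => //; rewrite -[X in measurable X]setTI.
  by apply: measurable_spherical_coord => //; exact: measurable_set1_borel3.
have [[p Np]|N0] := pselect (exists p, N p); last first.
  rewrite /surface_measure (_ : _ `&` _ = set0) ?integral_set0//.
  by apply/seteqP; split => // p Np; apply: N0; exists p.
case: p Np => th ph [[/= th1 _] hp].
have N0 : leb2 N = 0%E.
  apply/eqP; rewrite -measure_le0.
  have m1 : measurable ([set th] : set (measurableTypeR R)) by exact: measurable_set1.
  have m2 : measurable (`[0, 2 * pi]%classic : set (measurableTypeR R)) by exact: measurable_itv.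
  apply: (@le_trans _ _ (leb2 ([set th] `*` `[0, 2 * pi]%classic))).
    apply: le_measure; rewrite ?inE//; first exact: measurableX.
    move=> [u v] [[/= u1 v1] huv]; split => //=.
    have := congr1 (fun z : V => z 2 0) (etrans huv (esym hp)); rewrite !mxE /=.
    by apply: cos_inj.
  rewrite product_measure1E//.
  have h0 : leb [set th] = 0%E by exact: lebesgue_measure_set1.
  by rewrite [X in (X * _)%E]h0 mul0e.
apply: null_set_integral => //.
by apply/measurable_EFinP; apply: measurable_funS (@measurable_sin_fst R) => // p [].
Qed.

Lemma harmonic_cvg (u : R^nat) (a M : R) :
  (forall n, `|a - u n| <= n.+1%:R^-1 * M) -> u @ \oo --> a.
Proof.
move=> h; apply/cvgrPdist_le => e e0.
have M0 : 0 <= M by have := le_trans (normr_ge0 _) (h 0%N); rewrite invr1 mul1r.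
have d0 : 0 < e / (M + 1) by rewrite divr_gt0// ltr_wpDl.
near=> n; apply: le_trans (h n) _.
have : n.+1%:R^-1 < e / (M + 1).
  by near: n; exact: (near_infty_natSinv_lt (PosNum d0)).
rewrite ltr_pdivlMr ?ltr_wpDl// => hn; apply: le_trans (ltW hn).
by rewrite ler_wpM2l ?invr_ge0// lerDl.
Unshelve. all: by end_near. Qed.

Variable K : V -> V -> 'M[R]_3.
Variable gs : nat -> {poly R}.
Hypothesis K_gs : forall n x y i j, sphere R x -> sphere R y -> y <> x -> y <> - x ->
  `|K x y i j - green_ker (gs n) x y i j| <= n.+1%:R^-1.
Variable f : V -> V.
Hypothesis f_L2 : tangential_L2 f.

Let intf j : sintegrable (fun y => f y j 0) := @tangential_L2_integrable R f j f_L2.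

Let F (y : V) := \sum_j `|f y j 0|.

Let intF : sintegrable F.
Proof. by apply: sintegrable_sum => j; exact: sintegrable_norm. Qed.

Let integrand_green g x i : sintegrable (fun y => (green_ker g x y *m f y) i 0).
Proof.
under [X in sintegrable X]eq_fun do rewrite mxE.
apply: sintegrable_sum => j; exact: (separable_integrable _ (separable_green_ker g i j)).
Qed.

Let N (x : V) : set (borel3 R) := [set x] `|` [set - x].

Let mN x : measurable (N x).
Proof. by apply: measurableU; exact: measurable_set1_borel3. Qed.

Let N0 x : mu (N x) = 0%E.
Proof.
by rewrite null_set_setU//; try exact: measurable_set1_borel3; exact: surface_measure_set1.
Qed.

Let mS := @measurable_sphere R.

Let mD x : measurable (S2 `\` N x).
Proof. exact: measurableD. Qed.

Let integrand_le n x y i : sphere R x -> (S2 `\` N x) y ->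
  `|(K x y *m f y) i 0 - (green_ker (gs n) x y *m f y) i 0| <= n.+1%:R^-1 * F y.
Proof.
move=> Sx [Sy /not_orP[yx yNx]]; rewrite !mxE -sumrB mulr_sumr.
apply: le_trans (ler_norm_sum _ _ _) _; apply: ler_sum => j _.
by rewrite -mulrBl normrM ler_wpM2r// K_gs.
Qed.

(** Off two points the integrand is a pointwise limit of measurable ones; on single points
    measurability is automatic. *)
Let measurable_integrand x i : sphere R x ->
  measurable_fun S2 (fun y : borel3 R => (K x y *m f y) i 0).
Proof.
move=> Sx; suff h : measurable_fun (S2 `\` N x) (fun y : borel3 R => (K x y *m f y) i 0).
  apply: (@measurable_funS _ _ _ _ ((S2 `\` N x) `|` N x)).
  - exact: measurableU.
  - by move=> y Sy; have [Ny|Ny] := pselect (N x y); [right|left].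
  apply/measurable_funU => //; split => //; apply/measurable_funU.
  - exact: measurable_set1_borel3.
  - exact: measurable_set1_borel3.
  - by split; exact: measurable_fun_set1.
apply: (@measurable_fun_cvg _ _ _ _ (fun n (y : borel3 R) => (green_ker (gs n) x y *m f y) i 0)).
  move=> n; apply: (@measurable_funS _ _ _ _ S2) => //.
  by apply/measurable_EFinP; exact: (measurable_int mu (integrand_green (gs n) x i)).
by move=> y Dy; apply: harmonic_cvg => n; exact: integrand_le.
Qed.

Let integrable_integrand x i : sphere R x -> sintegrable (fun y => (K x y *m f y) i 0).
Proof.
move=> Sx; apply/(negligible_integrable (mN x) mS _ (N0 x)).
  by apply/measurable_EFinP; exact: measurable_integrand.
have h : sintegrable (fun y => `|(green_ker (gs 0) x y *m f y) i 0| + F y).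
  by apply: sintegrableD => //; exact: sintegrable_norm.
apply: le_integrable (integrableS mS (mD x) _ h) => //.
  apply/measurable_EFinP; apply: (@measurable_funS _ _ _ _ S2) => //.
  exact: measurable_integrand.
move=> y Dy /=; rewrite lee_fin.
have F0 : 0 <= F y by exact: sumr_ge0.
rewrite [leRHS]ger0_norm ?addr_ge0//.
have := integrand_le 0 i Sx Dy; rewrite invr1 mul1r => h'.
rewrite -[X in `|X|](subrK ((green_ker (gs 0) x y *m f y) i 0)).
by apply: le_trans (ler_normD _ _) _; rewrite addrC lerD.
Qed.

Definition field_mass : R := sint F.

(** The bound is uniform in [x]. Measurability, boundedness and tangency of the convolution, and its
    pairings with polynomial fields, are all inherited from the finite-rank kernels through it. *)
Lemma convolution_approx n x i : sphere R x ->
  `|convolution K f x i 0 - convolution (green_ker (gs n)) f x i 0| <=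
  n.+1%:R^-1 * field_mass.
Proof.
move=> Sx; rewrite !mxE -sintB//; last exact: integrable_integrand.
have iD : sintegrable (fun y => (K x y *m f y) i 0 - (green_ker (gs n) x y *m f y) i 0).
  by apply: sintegrableB => //; exact: integrable_integrand.
have iF : sintegrable (fun y => n.+1%:R^-1 * F y) by exact: sintegrableZ.
rewrite -sintZ//; apply: le_trans (le_norm_sint iD) _.
rewrite /sint /Rintegral.
have iD' := sintegrable_norm iD.
rewrite (negligible_integral (mN x) mS iD' (N0 x)).
rewrite (negligible_integral (mN x) mS iF (N0 x)).
apply: le_Rintegral => //.
- exact: (integrableS mS).
- exact: (integrableS mS).
- by move=> y Dy; exact: integrand_le.
Qed.

Lemma convolution_green_polyfun g i : exists p : poly3 R,
  forall x, convolution (green_ker g) f x i 0 = polyfun p x.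
Proof.
have /choice[P hP] : forall j, exists p : poly3 R, forall x,
    sint (fun y => green_ker g x y i j * f y j 0) = polyfun p x.
  by move=> j; exact: (separable_sint_polyfun (separable_green_ker g i j)).
exists (\sum_j P j) => x; rewrite mxE polyfun_sum.
under [X in sint X]eq_fun do rewrite mxE.
rewrite sint_sum => [|j]; first by apply: eq_bigr.
by exact: (separable_integrable _ (separable_green_ker g i j)).
Qed.

Lemma measurable_convolution i :
  measurable_fun S2 (fun x : borel3 R => convolution K f x i 0).
Proof.
apply: (@measurable_fun_cvg _ _ _ _ (fun n (x : borel3 R) => convolution (green_ker (gs n)) f x i 0)).
  move=> n; have [p hp] := convolution_green_polyfun (gs n) i.
  rewrite (_ : (fun x => _) = (polyfun p : borel3 R -> R)); last by apply/funext => x; rewrite hp.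
  by apply: measurable_funTS; exact: measurable_polyfun.
by move=> x Sx; apply: harmonic_cvg => n; exact: convolution_approx.
Qed.

Lemma convolution_bounded : exists B : R, forall x i, sphere R x ->
  `|convolution K f x i 0| <= B.
Proof.
have /choice[P hP] := convolution_green_polyfun (gs 0).
exists (field_mass + \sum_i mpoly_norm1 (P i)) => x i Sx.
rewrite -[X in `|X|](subrK (convolution (green_ker (gs 0)) f x i 0)).
apply: le_trans (ler_normD _ _) _; apply: lerD.
  by apply: le_trans (convolution_approx 0 i Sx) _; rewrite invr1 mul1r.
rewrite hP; apply: le_trans (polyfun_le _ Sx) _.
by rewrite (bigD1 i)//= lerDl; apply: sumr_ge0 => j _; exact: sumr_ge0.
Qed.

Lemma convolution_integrable i : sintegrable (fun x => convolution K f x i 0).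
Proof.
have [B hB] := convolution_bounded.
by apply: (@sphere_bounded_integrable _ _ B) => [|x Sx]; [exact: measurable_convolution|exact: hB].
Qed.

Lemma convolution_tangent x : sphere R x -> dot x (convolution K f x) = 0.
Proof.
move=> Sx; have h n : dot x (convolution (green_ker (gs n)) f x) = 0.
  rewrite dotE; transitivity (sint (fun y => dot x (green_ker (gs n) x y *m f y))).
    under [X in _ = sint X]eq_fun do rewrite dotE.
    rewrite sint_sum => [|i]; last exact: sintegrableZ.
    by apply: eq_bigr => i _; rewrite mxE sintZ.
  by under [X in sint X]eq_fun do rewrite dot_green_ker//; exact: sint0.
have : (fun n => dot x (convolution (green_ker (gs n)) f x)) @ \oo --> dot x (convolution K f x).
  apply: (@harmonic_cvg _ _ (3 * field_mass)) => n; rewrite !dotE -sumrB.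
  apply: le_trans (ler_norm_sum _ _ _) _.
  have -> : n.+1%:R^-1 * (3 * field_mass) = \sum_(i < 3) n.+1%:R^-1 * field_mass.
    by rewrite big_ord3; ring.
  apply: ler_sum => i _; rewrite -mulrBr normrM.
  apply: le_trans (ler_wpM2r (normr_ge0 _) (sphere_coord_le1 i Sx)) _.
  by rewrite mul1r convolution_approx.
under eq_fun do rewrite h.
by move=> /(cvg_unique _); apply => //; exact: cvg_cst.
Qed.

Lemma tangential_L2_convolution : tangential_L2 (convolution K f).
Proof.
have [B hB] := convolution_bounded; split.
- exact: measurable_convolution.
- exact: convolution_tangent.
- have : sintegrable (fun x => dot (convolution K f x) (convolution K f x)).
    under [X in sintegrable X]eq_fun do rewrite dotE.
    apply: sintegrable_sum => i.
    apply: (@sphere_bounded_integrable _ _ (B * B)).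
      by apply: measurable_funM; exact: measurable_convolution.
    by move=> x Sx; rewrite normrM ler_pM ?hB.
  by move=> /integrable_lty; apply.
Qed.

Lemma sint_convolution_cvg (U : 'I_3 -> poly3 R) :
  (fun n => sint (fun x => \sum_i polyfun (U i) x * convolution (green_ker (gs n)) f x i 0))
   @ \oo --> sint (fun x => \sum_i polyfun (U i) x * convolution K f x i 0).
Proof.
have iK i : sintegrable (fun x => polyfun (U i) x * convolution K f x i 0).
  by apply: sintegrable_polyfunM; exact: convolution_integrable.
have ig n i : sintegrable (fun x => polyfun (U i) x * convolution (green_ker (gs n)) f x i 0).
  have [p hp] := convolution_green_polyfun (gs n) i.
  under [X in sintegrable X]eq_fun do rewrite hp.
  by apply: sintegrable_polyfunM; exact: polyfun_integrable.
have iU : sintegrable (fun x => \sum_i `|polyfun (U i) x|).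
  by apply: sintegrable_sum => i; apply: sintegrable_norm; exact: polyfun_integrable.
apply: (@harmonic_cvg _ _ (field_mass * sint (fun x => \sum_i `|polyfun (U i) x|))) => n.
rewrite -sintB; try exact: sintegrable_sum.
rewrite mulrA; apply: le_norm_sintM => //.
  by apply: sintegrableB; exact: sintegrable_sum.
move=> x Sx; rewrite -sumrB mulr_sumr; apply: le_trans (ler_norm_sum _ _ _) _.
apply: ler_sum => i _; rewrite -mulrBr normrM mulrC ler_wpM2r//.
exact: convolution_approx.
Qed.

(** Fubini transfers the kernel to the test field [U], on which its action at fixed [y] is known. *)
Lemma sint_convolution_green g (U : 'I_3 -> poly3 R) :
  sint (fun x => \sum_i polyfun (U i) x * convolution (green_ker g) f x i 0) =
  sint (fun y => \sum_j f y j 0 * sint (fun x => \sum_i green_ker g x y i j * polyfun (U i) x)).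
Proof.
have iKf x i j : sintegrable (fun y => green_ker g x y i j * f y j 0).
  exact: (separable_integrable _ (separable_green_ker g i j)).
have iUK i j : sintegrable (fun x => polyfun (U i) x *
    sint (fun y => green_ker g x y i j * f y j 0)).
  have [p hp] := separable_sint_polyfun (separable_green_ker g i j) (intf j).
  under [X in sintegrable X]eq_fun do rewrite hp.
  by apply: sintegrable_polyfunM; exact: polyfun_integrable.
have ifK i j : sintegrable (fun y => f y j 0 *
    sint (fun x => green_ker g x y i j * polyfun (U i) x)).
  have [p hp] := separable_sint_polyfun (separableC (separable_green_ker g i j))
    (polyfun_integrable (U i)).
  under [X in sintegrable X]eq_fun do rewrite hp mulrC.
  exact: sintegrable_polyfunM.
have iKU y i j : sintegrable (fun x => green_ker g x y i j * polyfun (U i) x).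
  exact: (separable_integrable y (separableC (separable_green_ker g i j)) (polyfun_integrable (U i))).
transitivity (\sum_i \sum_j sint (fun x => polyfun (U i) x *
    sint (fun y => green_ker g x y i j * f y j 0))).
  transitivity (sint (fun x => \sum_i \sum_j polyfun (U i) x *
      sint (fun y => green_ker g x y i j * f y j 0))).
    congr sint; apply/funext => x; apply: eq_bigr => i _.
    rewrite mxE -mulr_sumr -sint_sum//; congr (_ * sint _).
    by apply/funext => y; rewrite mxE.
  rewrite sint_sum => [|i]; last exact: sintegrable_sum.
  by apply: eq_bigr => i _; rewrite sint_sum.
rewrite exchange_big/=.
transitivity (sint (fun y => \sum_j \sum_i f y j 0 *
    sint (fun x => green_ker g x y i j * polyfun (U i) x))).
  rewrite sint_sum => [|j]; last exact: sintegrable_sum.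
  apply: eq_bigr => j _; rewrite (sint_sum _ (fun i => ifK i j)); apply: eq_bigr => i _.
  exact: (separable_fubini _ (separable_green_ker g i j)).
congr sint; apply/funext => y; apply: eq_bigr => j _.
by rewrite -mulr_sumr sint_sum.
Qed.

End ConvolutionLimit.

(** * Scaled zonal kernels *)

Section ZonalProfile.
Variable R : realType.
Local Notation V := 'cV[R]_3.
Local Notation leb := (@lebesgue_measure R).

Lemma continuous_comp_nonneg (phi g : R -> R) :
  {within `[0, +oo[, continuous phi} -> continuous g -> (forall t, 0 <= g t) ->
  continuous (fun t => phi (g t)).
Proof.
move=> cphi cg g0 t.
have cphi' : {within `[0, +oo[, continuous phi} := cphi.
move/subspace_continuousP : cphi' => /(_ (g t)).
rewrite /= in_itv /= andbT => /(_ (g0 t)) h.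
apply: (@cvg_comp _ _ _ g phi (nbhs t) (within [set x | x \in `[0, +oo[] (nbhs (g t)))) => //.
move=> A; rewrite /within /= => hA.
have hg : \forall s \near t, g s \in `[0, +oo[ -> A (g s) := cg t _ hA.
by apply: filterS hg => s; apply; rewrite in_itv /= andbT.
Qed.

Definition north_pole : V := \col_i (i == 2)%:R.

Lemma sphere_north_pole : sphere R north_pole.
Proof. by apply/sphere_sqr; rewrite big_ord3 !mxE /=; ring. Qed.

Lemma dot_north_pole (x : V) : dot x north_pole = x 2 0.
Proof. by rewrite dotE big_ord3 !mxE /=; ring. Qed.

(** Funk-Hecke in degree 0, with [Z = 1] and [y] the north pole. *)
Lemma sint_zonal_poly (q : {poly R}) :
  sint (fun x : V => q.[x 2 0]) = legendre_coefp 0 q.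
Proof.
have h1 : solid_harmonic 0 (1 : poly3 R).
  split; first by rewrite /laplacian big1// => i _; rewrite mderiv1 mpoly.mderiv0.
  by rewrite /euler big1 ?scale0r// => i _; rewrite mderiv1 mulr0.
have := @funk_hecke _ (@sintp R) (@sintp_rotd R) (@sintp_sqnorm R)
  (fun l => @legendre_coefp R l) (etrans (legendre_coefp01 R) (esym (sintp1 R)))
  (@legendre_coefpS1 R) (@legendre_coefp_mulX R)
  (fun i => north_pole i 0) (iffLR (sphere_sqr north_pole) sphere_north_pole) 0 q 1 h1.
rewrite mulr1 mpoly.meval1 mulr1 => <-; congr sint; apply/funext => x.
rewrite /polyfun meval_zonal; congr (_.[_]).
by rewrite -dot_north_pole dotC dotE.
Qed.

Lemma legendre_coefE0 (F : R -> R) :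
  legendre_coef F 0 = 2 * pi * \int[leb]_(t in `[-1, 1]) F t.
Proof.
rewrite /legendre_coef /legendre expn0 fact0 muln1 invr1 scale1r expr0 derivn0.
by under eq_Rintegral do rewrite hornerC mulr1.
Qed.

(** The constant depends on [l], which suffices for limits taken at fixed degree. *)
Lemma legendre_coefB_le (F G : R -> R) l (e : R) : continuous F -> continuous G ->
  (forall t, -1 <= t <= 1 -> `|F t - G t| <= e) ->
  `|legendre_coef F l - legendre_coef G l| <=
    e * (2 * pi * \int[leb]_(t in `[-1, 1]) `|(legendre R l).[t]|).
Proof.
move=> cF cG FG; rewrite /legendre_coef -mulrBr.
have cP := @continuous_hornerp R (legendre R l).
have iFP (H : R -> R) : continuous H ->
    leb.-integrable `[-1, 1] (EFin \o (fun t => H t * (legendre R l).[t])).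
  by move=> cH; apply: continuous_itv_integrable => t; apply: cvgM; [exact: cH|exact: cP].
rewrite -RintegralB//; [|exact: iFP|exact: iFP].
rewrite normrM ger0_norm ?mulr_ge0 ?pi_ge0// mulrCA; apply: ler_wpM2l.
  by rewrite mulr_ge0 ?pi_ge0.
have iP : leb.-integrable `[-1, 1] (EFin \o (fun t => `|(legendre R l).[t]|)).
  apply: continuous_itv_integrable => t; apply: continuous_comp; first exact: cP.
  exact: norm_continuous.
have iD : leb.-integrable `[-1, 1] (EFin \o (fun t => F t * (legendre R l).[t] -
    G t * (legendre R l).[t])).
  by apply: continuous_itv_integrable => t; apply: cvgB; apply: cvgM;
    [exact: cF|exact: cP|exact: cG|exact: cP].
rewrite -RintegralZl//; apply: le_trans (le_normr_Rintegral _ iD) _ => //.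
apply: le_Rintegral => //.
- exact: integrable_norm.
- exact: integrableZl iP.
- move=> t; rewrite /= in_itv /= => t1.
  by rewrite -mulrBl normrM ler_wpM2r// FG.
Qed.

(** Archimedes' projection formula, extended from polynomials by uniform approximation with
    arbitrary error. *)
Lemma sint_zonal (F : R -> R) : continuous F ->
  sint (fun x : V => F (x 2 0)) = 2 * pi * \int[leb]_(t in `[-1, 1]) F t.
Proof.
move=> cF; rewrite -legendre_coefE0; apply/eqP; rewrite -subr_eq0 -normr_le0.
apply/ler_addgt0Pl => e e0; rewrite addr0.
(* Collects the factors of the errors in [h1] and [h2]; dividing by [M + 1] also covers [M = 0]. *)
pose M := sint (fun _ : V => 1) + 2 * pi * \int[leb]_(t in `[-1, 1]) `|(legendre R 0).[t]|.
have M0 : 0 <= M.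
  apply: addr_ge0; first exact: Rintegral_ge0.
  by rewrite !mulr_ge0 ?pi_ge0//; exact: Rintegral_ge0.
have d0 : 0 < e / (M + 1) by rewrite divr_gt0// ltr_wpDl.
have [q hq] := weierstrass cF d0.
have x1 (x : V) : sphere R x -> -1 <= x 2 0 <= 1.
  by move=> Sx; rewrite -ler_norml sphere_coord_le1.
have i1 : sintegrable (fun _ : V => 1 : R).
  by apply: (@sphere_bounded_integrable _ _ 1) => // x _; rewrite normr1.
have mF : measurable_fun (sphere R : set (borel3 R)) (fun x : borel3 R => F (x 2 0)).
  apply: measurable_funTS; apply: measurableT_comp; first exact: continuous_measurable_fun.
  exact: measurable_coord3.
have [c _ hc] := @EVT_max R (fun t => `|F t|) (-1) 1 (ltac:(lra)) (ltac:(
  apply: continuous_subspaceT => t; apply: continuous_comp; [exact: cF|exact: norm_continuous])).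
have iF : sintegrable (fun x : V => F (x 2 0)).
  apply: (@sphere_bounded_integrable _ _ `|F c|) => // x Sx.
  by apply: hc; rewrite in_itv /= x1.
have iq : sintegrable (fun x : V => q.[x 2 0]).
  have := @separable_integrable R (fun _ x => q.[x 2 0]) (fun=> 1) 0
    (separable_horner q (@separable_coord2 R 2)) i1.
  by under [X in sintegrable X -> _]eq_fun do rewrite mulr1.
have h1 : `|sint (fun x : V => F (x 2 0)) - legendre_coefp 0 q| <= e / (M + 1) * sint (fun _ : V => 1).
  rewrite -sint_zonal_poly -sintB//; apply: le_norm_sintM => //; first exact: sintegrableB.
  by move=> x Sx; rewrite mulr1 hq// x1.
have h2 := @legendre_coefB_le F (horner q) 0 _ cF (@continuous_hornerp R q) hq.
have -> : sint (fun x : V => F (x 2 0)) - legendre_coef F 0 =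
  sint (fun x : V => F (x 2 0)) - legendre_coefp 0 q - (legendre_coef F 0 - legendre_coefp 0 q).
  by ring.
apply: le_trans (ler_normB _ _) _; apply: le_trans (lerD h1 h2) _.
rewrite -mulrDr -/M -mulrA ler_piMr ?ltW//.
by rewrite mulrC ltr_pdivrMr ?ltr_wpDl// mul1r ltrDl.
Qed.

(** On the sphere [|x - y|^2 = 2 - 2 t], which yields a profile in [t]; it is continuous on the
    whole line because [Num.sqrt] is 0 on negative numbers. *)
Lemma scaled_zonal_profile (phi : R -> R) (psi : R -> R -> R) (rho : R) :
  {within `[0, +oo[, continuous phi} -> scaled_zonal_family phi psi -> 0 < rho < 1 ->
  exists F : R -> R, [/\ continuous F, forall t, -1 <= t <= 1 -> psi rho t = F t &
    \int[leb]_(t in `[-1, 1]) F t = (2 * pi)^-1].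
Proof.
move=> cphi hpsi /[dup] rho01 /andP[rho0 _]; have [C [hC int1]] := hpsi rho rho01.
pose F t := C * phi (rho^-1 * Num.sqrt (2 - 2 * t)).
have cF : continuous F.
  move=> t; apply: cvgM; first exact: cvg_cst.
  apply: (@continuous_comp_nonneg phi (fun t => rho^-1 * Num.sqrt (2 - 2 * t))) => //.
    move=> s; apply: cvgM; first exact: cvg_cst.
    apply: (@continuous_comp _ _ _ (fun s : R => 2 - 2 * s)); last exact: sqrt_continuous.
    by apply: cvgB; [exact: cvg_cst|apply: cvgM; [exact: cvg_cst|exact: cvg_id]].
  by move=> s; rewrite mulr_ge0 ?invr_ge0 ?(ltW rho0) ?sqrtr_ge0.
have psiF t : -1 <= t <= 1 -> psi rho t = F t.
  move=> /andP[t1 t2].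
  (* A point of the sphere at height [t], so that every [t] is a scalar product with the north
     pole. *)
  pose x : V := \col_i [:: Num.sqrt (1 - t ^+ 2); 0; t]`_i.
  have w0 : 0 <= 1 - t ^+ 2 by nra.
  have Sx : sphere R x.
    by apply/sphere_sqr; rewrite big_ord3 !mxE /= sqr_sqrtr//; ring.
  have xt : dot x north_pole = t by rewrite dot_north_pole mxE.
  rewrite -{1}xt hC//; last exact: sphere_north_pole.
  congr (_ * phi (_ * Num.sqrt _)).
  rewrite dotE big_ord3 !mxE /= subr0 -expr2 sqr_sqrtr//; ring.
exists F; split => //.
have h : sint (fun x : V => F (x 2 0)) = 1.
  rewrite -(int1 north_pole sphere_north_pole); apply: eq_sint => x Sx.
  by rewrite dot_north_pole psiF// -ler_norml sphere_coord_le1.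
move: h; rewrite sint_zonal// => h.
have pi0 : 2 * pi != 0 :> R by rewrite mulf_neq0 ?gt_eqF ?pi_gt0.
by apply: (mulfI pi0); rewrite h mulfV.
Qed.
End ZonalProfile.

(** * The convolution as a Fourier multiplier *)

Section ConvolutionMultiplier.
Variable R : realType.
Local Notation V := 'cV[R]_3.
Variables (psi F : R -> R).
Hypothesis cF : continuous F.
Hypothesis psiF : forall t, -1 <= t <= 1 -> psi t = F t.
Hypothesis intF : \int[lebesgue_measure]_(t in `[-1, 1]) F t = (2 * pi)^-1.

(** [2 - 2 t] and [2 + 2 t] are the squared lengths of the nonzero vectors [x - y] and [x + y]. *)
Lemma dot_sphere_lt1 (x y : V) : sphere R x -> sphere R y -> y <> x -> y <> - x ->
  -1 < dot x y < 1.
Proof.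
move=> Sx Sy yx yNx.
have sq (z : V) : z <> 0 -> 0 < \sum_i z i 0 ^+ 2.
  move=> z0; rewrite lt0r sumr_ge0 ?andbT => [|i _]; last exact: sqr_ge0.
  apply/negP; rewrite psumr_eq0 => [/allP h|i _]; last exact: sqr_ge0.
  apply: z0; apply/matrixP => i j; rewrite !ord1 mxE.
  by have := h i (mem_index_enum i); rewrite sqrf_eq0 => /eqP.
have h1 : 0 < \sum_i (x - y) i 0 ^+ 2.
  by apply: sq => /eqP; rewrite subr_eq0 => /eqP /esym.
have h2 : 0 < \sum_i (x + y) i 0 ^+ 2.
  by apply: sq => /eqP; rewrite addrC addr_eq0 => /eqP.
move/sphere_sqr : Sx => Sx; move/sphere_sqr : Sy => Sy.
have e1 : \sum_i (x - y) i 0 ^+ 2 = \sum_i x i 0 ^+ 2 + \sum_i y i 0 ^+ 2 - 2 * dot x y.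
  by rewrite dotE !big_ord3 !mxE; ring.
have e2 : \sum_i (x + y) i 0 ^+ 2 = \sum_i x i 0 ^+ 2 + \sum_i y i 0 ^+ 2 + 2 * dot x y.
  by rewrite dotE !big_ord3 !mxE; ring.
by move: h1 h2; rewrite e1 e2 Sx Sy; lra.
Qed.

(** [20 = (3 + 2) + (3 + 12)]: the entry bounds of the two kernels, with [3 e] for the weighted
    error of [kappa'] and [e] for that of [kappa]. *)
Lemma Psi_approximation (g : {poly R}) (e : R) :
  (forall t, -1 <= t <= 1 -> `|F t - (green_zonal g).[t]| <= e) ->
  forall (x y : V) i j, sphere R x -> sphere R y -> y <> x -> y <> - x ->
    `|Psi psi x y i j - green_ker g x y i j| <= 20 * e.
Proof.
move=> hg x y i j Sx Sy yx yNx.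
have t1 := dot_sphere_lt1 Sx Sy yx yNx.
have [hk hk'] := kappa_approximation cF intF psiF hg t1.
rewrite /Psi /Psi_div /Psi_curl /continuous_ext.
rewrite (negbTE (introN eqP yx)) (negbTE (introN eqP yNx)) /=.
have -> : Psi_div_open psi x y + Psi_curl_open psi x y =
  div_ker (kappa psi (dot x y)) (derive1 (kappa psi) (dot x y)) x y +
  curl_ker (kappa psi (dot x y)) (derive1 (kappa psi) (dot x y)) x y by [].
rewrite /green_ker [in X in `|X|]mxE [X in _ - X]mxE opprD addrACA div_kerB curl_kerB.
apply: le_trans (ler_normD _ _) _.
apply: le_trans (lerD (div_ker_le _ _ _ _ Sx Sy) (curl_ker_le _ _ _ _ Sx Sy)) _.
by move: hk hk'; set a := `|_|; set b := `|_|; lra.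
Qed.

Lemma green_sequence : exists gs : nat -> {poly R}, forall n,
  (forall t, -1 <= t <= 1 -> `|F t - (green_zonal (gs n)).[t]| <= n.+1%:R^-1) /\
  forall (x y : V) i j, sphere R x -> sphere R y -> y <> x -> y <> - x ->
    `|Psi psi x y i j - green_ker (gs n) x y i j| <= n.+1%:R^-1.
Proof.
pose P n (g : {poly R}) :=
  (forall t, -1 <= t <= 1 -> `|F t - (green_zonal g).[t]| <= n.+1%:R^-1) /\
  forall (x y : V) i j, sphere R x -> sphere R y -> y <> x -> y <> - x ->
    `|Psi psi x y i j - green_ker g x y i j| <= n.+1%:R^-1.
suff /choice[gs hgs] : forall n, exists g, P n g by exists gs.
move=> n.
have n0 : 0 < n.+1%:R^-1 :> R by rewrite invr_gt0.
have e0 : 0 < n.+1%:R^-1 / 20 :> R by rewrite divr_gt0.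
have [g hg] := green_zonal_approximation cF intF e0.
exists g; split=> [t t1|x y i j Sx Sy yx yNx].
  by apply: le_trans (hg t t1) _; move: n0; move: (n.+1%:R^-1) => z z0; lra.
by apply: le_trans (Psi_approximation hg i j Sx Sy yx yNx) _; rewrite mulrC mulfVK.
Qed.

Variable f : V -> V.
Hypothesis f_L2 : tangential_L2 f.

Lemma tangential_L2_convolution_Psi : tangential_L2 (convolution (Psi psi) f).
Proof.
have [gs hgs] := green_sequence.
by apply: (@tangential_L2_convolution _ _ gs) => // n; have [] := hgs n.
Qed.

(** [U] is an eigenfield of every polynomial kernel. Pairings and eigenvalues both converge along
    the approximating sequence, and limits are unique. *)
Lemma sint_convolution_multiplier (U : 'I_3 -> poly3 R) l :
  (forall g y j, sphere R y ->
    sint (fun x => \sum_i green_ker g x y i j * polyfun (U i) x) =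
    legendre_coefp l (green_zonal g) * polyfun (U j) y) ->
  sint (fun x => \sum_i polyfun (U i) x * convolution (Psi psi) f x i 0) =
  legendre_coef psi l * sint (fun x => \sum_i polyfun (U i) x * f x i 0).
Proof.
move=> hU; have [gs hgs] := green_sequence.
have hK n := (hgs n).2.
have h1 := @sint_convolution_cvg R _ gs hK f f_L2 U.
have fE n : sint (fun x => \sum_i polyfun (U i) x * convolution (green_ker (gs n)) f x i 0) =
    legendre_coefp l (green_zonal (gs n)) * sint (fun x => \sum_i polyfun (U i) x * f x i 0).
  rewrite (sint_convolution_green f_L2) -sintZ; last first.
    by apply: sintegrable_sum => i; apply: sintegrable_polyfunM; exact: tangential_L2_integrable.
  apply: eq_sint => y Sy; rewrite mulr_sumr; apply: eq_bigr => j _.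
  by rewrite hU//; ring.
move: h1; under eq_fun do rewrite fE.
move=> h1; apply: (cvg_unique _ h1) => //; apply: cvgM; last exact: cvg_cst.
have -> : legendre_coef psi l = legendre_coef F l.
  rewrite /legendre_coef; congr (_ * _); apply: eq_Rintegral => t /[!inE].
  by rewrite /= in_itv /= => /psiF ->.
apply: harmonic_cvg => n.
exact: (legendre_coefB_le _ cF (@continuous_hornerp R _) (hgs n).1).
Qed.

Lemma inner_polyfun (h : V -> V) (u : V -> V) (c : R) (U : 'I_3 -> poly3 R) :
  tangential_L2 h -> (forall x i, u x i 0 = c * polyfun (U i) x) ->
  inner h u = c * sint (fun x => \sum_i polyfun (U i) x * h x i 0).
Proof.
move=> h_L2 hu; rewrite /inner -sintZ; last first.
  by apply: sintegrable_sum => i; apply: sintegrable_polyfunM; exact: tangential_L2_integrable.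
congr sint; apply/funext => x; rewrite dotE mulr_sumr; apply: eq_bigr => i _.
by rewrite hu; ring.
Qed.

Variable Y : forall l : nat, 'I_l.*2.+1 -> V -> R.
Hypothesis hY : spherical_harmonic_basis Y.

Lemma coef_sub_convolution l (k : 'I_(l.+1).*2.+1) :
  let g := fun x => f x - convolution (Psi psi) f x in
  div_coef Y g k = (1 - legendre_coef psi l.+1) * div_coef Y f k /\
  curl_coef Y g k = (1 - legendre_coef psi l.+1) * curl_coef Y f k.
Proof.
move=> g; have [hharm _ _] := hY l.+1; have [p [hp1 hp2 hp3]] := hharm k.
have Yp : Y k = polyfun p by apply/funext => x; rewrite hp3.
have hp : solid_harmonic l.+1 p by split => //; exact: homog_euler.
have cL2 := tangential_L2_convolution_Psi.
have gL2 : tangential_L2 g by exact: tangential_L2B.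
have subE (u : V -> V) (c : R) (U : 'I_3 -> poly3 R) :
    (forall x i, u x i 0 = c * polyfun (U i) x) ->
    (forall g y j, sphere R y ->
      sint (fun x => \sum_i green_ker g x y i j * polyfun (U i) x) =
      legendre_coefp l.+1 (green_zonal g) * polyfun (U j) y) ->
    inner g u = (1 - legendre_coef psi l.+1) * inner f u.
  move=> hu hU; rewrite !(inner_polyfun _ hu)// mulrCA; congr (_ * _).
  have iU h : tangential_L2 h -> sintegrable (fun x => \sum_i polyfun (U i) x * h x i 0).
    move=> hL; apply: sintegrable_sum => i; apply: sintegrable_polyfunM.
    exact: tangential_L2_integrable.
  rewrite mulrBl mul1r -(sint_convolution_multiplier hU) -sintB; [|exact: iU..].
  congr sint; apply/funext => x; rewrite -sumrB; apply: eq_bigr => i _.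
  by rewrite /g !mxE mulrBr.
split.
- apply: (subE _ (Num.sqrt (lambda R l.+1))^-1 (fun i => rotd i p)).
    by move=> x i; rewrite mxE Yp L_star_polyfun.
  by move=> q y j Sy; exact: sint_green_ker_rotd.
- apply: (subE _ (Num.sqrt (lambda R l.+1))^-1 (surface_gradient p)).
    by move=> x i; rewrite mxE Yp nabla_star_polyfun.
  by move=> q y j Sy; exact: sint_green_ker_surface_gradient.
Qed.

End ConvolutionMultiplier.

(** * The error estimate *)

Section MultiplierBound.
Variable R : realType.

Lemma lambda_ge0 l : 0 <= lambda R l.
Proof. by rewrite mulr_ge0 ?addr_ge0. Qed.

(** With [q = sqrt (1 + lambda_l)] one has [l <= q] and [l + 1 <= 2 q]. Low degrees contribute [c1]
    and high degrees [(1 + c2) 2^s]; the sum of the two serves both. *)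
Lemma multiplier_bound (s m c1 c2 rho a : R) (l : nat) :
  0 <= s <= m -> 0 < rho < 1 -> 0 < c1 -> 0 < c2 -> (0 < l)%N ->
  (l%:Z <= Num.floor (rho^-1 - 1) -> `|1 - a| <= c1 * (l%:R * rho) `^ m) ->
  (Num.floor (rho^-1 - 1) < l%:Z -> `|a| <= c2) ->
  `|1 - a| ^+ 2 <= ((c1 + (1 + c2) * 2 `^ s) * rho `^ s) ^+ 2 * (1 + lambda R l) `^ s.
Proof.
move=> /andP[s0 sm] /andP[rho0 rho1] c10 c20 l0 low high.
set q := Num.sqrt (1 + lambda R l).
have q2 : 1 + lambda R l = q * q by rewrite -expr2 sqr_sqrtr// addr_ge0 ?lambda_ge0.
have q0 : 0 <= q by exact: sqrtr_ge0.
have lR : 1 <= l%:R :> R by rewrite ler1n.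
have lq : l%:R <= q by rewrite -(@ler_pXn2r _ 2) ?nnegrE// !expr2 -q2 /lambda; nra.
have l1q : l%:R + 1 <= 2 * q.
  rewrite -(@ler_pXn2r _ 2) ?nnegrE ?addr_ge0 ?mulr_ge0// exprMn (expr2 q) -q2 /lambda.
  by nra.
have P0 (x : R) : 0 <= x `^ s by exact: powR_ge0.
have powle (x y : R) : 0 <= x -> x <= y -> x `^ s <= y `^ s.
  by move=> x0 xy; apply: ge0_ler_powR => //; rewrite nnegrE// (le_trans x0).
rewrite q2 powRM// -expr2 -exprMn.
have D0 : 0 <= (1 + c2) * 2 `^ s by rewrite mulr_ge0// addr_ge0 ?(ltW c20).
have B0 : 0 <= c1 + (1 + c2) * 2 `^ s by rewrite addr_ge0 ?(ltW c10).
apply: lerXn2r; rewrite ?nnegrE//.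
  by apply: mulr_ge0 => //; exact: mulr_ge0.
rewrite -mulrA -(powRM _ (ltW rho0) q0) mulrDl -mulrA.
have [lf|lf] := leP l%:Z (Num.floor (rho^-1 - 1)).
  apply: le_trans (low lf) _; apply: ler_wpDr.
    by apply: mulr_ge0; [rewrite addr_ge0 ?(ltW c20)|exact: mulr_ge0].
  rewrite ler_pM2l//.
  (* Since [l rho <= 1], the exponent [m] may be lowered to [s]. *)
  have lrho : l%:R * rho <= 1.
    move: lf; rewrite floor_ge_int -pmulrn lerBrDr -(ler_pM2r rho0) mulVf ?gt_eqF// mulrDl.
    by rewrite mul1r; lra.
  apply: (@le_trans _ _ ((l%:R * rho) `^ s)).
    by apply: ger_powR => //; rewrite lrho andbT mulr_gt0// ltr0n.
  apply: powle; first by rewrite mulr_ge0// ltW.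
  by rewrite mulrC ler_wpM2l// ltW.
apply: ler_wpDl; first by rewrite mulr_ge0// ltW.
apply: (@le_trans _ _ (1 + c2)).
  by apply: le_trans (ler_normB _ _) _; rewrite normr1 lerD2l high.
rewrite -[leLHS]mulr1 ler_wpM2l ?addr_ge0 ?(ltW c20)//.
rewrite -powRM ?mulr_ge0 ?(ltW rho0)//.
(* Above the cut-off [(l + 1) rho > 1], so [2 rho q >= 1] and the constant bound can be paid for by
   [(2 rho q)^s]. *)
have := powle 1 (2 * (rho * q)) ler01; rewrite powR1; apply.
move: lf; rewrite floor_lt_int -pmulrn ltrBlDr -(ltr_pM2r rho0) mulVf ?gt_eqF// => h.
by apply: le_trans (ltW h) _; rewrite [leRHS]mulrCA mulrC ler_wpM2l// ltW.
Qed.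
End MultiplierBound.

Section SobolevDegreeZero.
Variable R : realType.
Variable Y : forall l : nat, 'I_l.*2.+1 -> 'cV[R]_3 -> R.

Lemma inner_scale0 (h u : 'cV[R]_3 -> 'cV[R]_3) : inner h (fun x => 0 *: u x) = 0.
Proof.
rewrite /inner -[RHS](sint0 R); congr sint; apply/funext => x.
by rewrite scale0r dotE big1// => i _; rewrite mxE mulr0.
Qed.

(** Since [0^-1 = 0], the fields of degree 0 are zero. This lets the termwise comparison hold for
    every degree, although the series start at 1. *)
Lemma coef_degree0 (h : 'cV[R]_3 -> 'cV[R]_3) (k : 'I_0.*2.+1) :
  div_coef Y h k = 0 /\ curl_coef Y h k = 0.
Proof.
have l0 : (Num.sqrt (lambda R 0))^-1 = 0 by rewrite /lambda mul0r sqrtr0 invr0.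
by rewrite /div_coef /curl_coef /y_field /z_field l0 !inner_scale0.
Qed.
End SobolevDegreeZero.

Lemma sqrt_fine_le (R : realType) (A : R) (a b : \bar R) : 0 <= A ->
  (0 <= a)%E -> (0 <= b)%E -> (b < +oo)%E -> (a <= (A ^+ 2)%:E * b)%E ->
  (a < +oo)%E /\ Num.sqrt (fine a) <= A * Num.sqrt (fine b).
Proof.
move=> A0 a0 b0 blt ab; have bfin : b \is a fin_num by rewrite ge0_fin_numE.
have alt : (a < +oo)%E by apply: le_lt_trans ab _; rewrite -(fineK bfin) -EFinM ltry.
have afin : a \is a fin_num by rewrite ge0_fin_numE.
split => //; rewrite -[A]ger0_norm// -sqrtr_sqr -sqrtrM ?sqr_ge0// ler_sqrt.
  by rewrite -lee_fin EFinM !fineK.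
by rewrite mulr_ge0 ?sqr_ge0 ?fine_ge0.
Qed.

Theorem theorem5p1 (R : realType)
    (Y : forall l : nat, 'I_l.*2.+1 -> 'cV[R]_3 -> R)
    (hY : spherical_harmonic_basis Y)
    (sigma : R) (hsigma : 0 <= sigma)
    (phi : R -> R) (hphi : {within `[0, +oo[, continuous phi})
    (psi : R -> R -> R) (hpsi : scaled_zonal_family phi psi)
    (rho0 m c1 c2 : R) (hrho0 : 0 < rho0 < 1) (hm : sigma <= m)
    (hc1 : 0 < c1) (hc2 : 0 < c2)
    (hlow : forall (rho : R) (l : nat), 0 < rho < rho0 ->
       (l%:Z <= Num.floor (rho^-1 - 1)) ->
       `|1 - legendre_coef (psi rho) l| <= c1 * (l%:R * rho) `^ m)
    (hhigh : forall (rho : R) (l : nat), 0 < rho < rho0 ->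
       (Num.floor (rho^-1 - 1) < l%:Z) ->
       `|legendre_coef (psi rho) l| <= c2)
    (tau : R) (htau : 0 <= tau <= sigma) :
  exists C : R, 0 < C /\
    forall (rho : R) (f : 'cV[R]_3 -> 'cV[R]_3),
      0 < rho < rho0 -> sobolev Y sigma f ->
      let g := fun x => f x - convolution (Psi (psi rho)) f x in
      sobolev Y tau g /\
      sobolev_norm Y tau g <=
        C * rho `^ (sigma - tau) * sobolev_norm Y sigma f.
Proof.
have /andP[tau0 taus] := htau; have /andP[rho00 rho01] := hrho0.
set s := sigma - tau.
have s0 : 0 <= s <= m by rewrite subr_ge0 taus lerBlDr (le_trans hm)// lerDl.
set C := c1 + (1 + c2) * 2 `^ s.
have C0 : 0 < C by rewrite addr_gt0// mulr_gt0 ?addr_gt0 ?powR_gt0.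
exists C; split; first exact: C0.
move=> rho f hrho [fL2 fsob] g.
have /andP[rhop rhoq] := hrho.
have rhoI : 0 < rho < 1 by rewrite rhop (lt_trans rhoq).
have [F [cF psiF intF]] := scaled_zonal_profile hphi hpsi rhoI.
have gL2 : tangential_L2 g.
  by apply: tangential_L2B => //; exact: (tangential_L2_convolution_Psi cF psiF intF).
set A := C * rho `^ s.
have A0 : 0 <= A by rewrite mulr_ge0 ?powR_ge0 ?ltW.
pose w (t : R) (h : 'cV[R]_3 -> 'cV[R]_3) l : R := \sum_(k < l.*2.+1) (1 + lambda R l) `^ t *
     (`|div_coef Y h k| ^+ 2 + `|curl_coef Y h k| ^+ 2).
have w0 t h l : 0 <= w t h l.
  by apply: sumr_ge0 => k _; rewrite mulr_ge0 ?powR_ge0 ?addr_ge0 ?exprn_ge0.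
have wle l : w tau g l <= A ^+ 2 * w sigma f l.
  rewrite /w mulr_sumr; apply: ler_sum => k _; case: l k => [|l] k.
    have [-> ->] := coef_degree0 Y g k; have [-> ->] := coef_degree0 Y f k.
    by rewrite normr0 expr0n addr0 !mulr0.
  have [-> ->] := coef_sub_convolution cF psiF intF fL2 hY k.
  (* Splits [(1 + lambda)^sigma] into the weight of the target norm and the factor [(1 + lambda)^s]
     that pays for the multiplier. *)
  have -> : sigma = tau + s by rewrite addrC subrK.
  have l0 : 1 + lambda R l.+1 != 0 by rewrite gt_eqF// ltr_wpDr ?lambda_ge0.
  have key := multiplier_bound s0 rhoI hc1 hc2 (ltn0Sn l)
    (@hlow rho l.+1 hrho) (@hhigh rho l.+1 hrho).
  rewrite powRD ?l0 ?implybT//.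
  move: (_ `^ tau) (powR_ge0 (1 + lambda R l.+1) tau) => P P0.
  move: (1 - _) key (div_coef Y f k) (curl_coef Y f k) => a key u v.
  rewrite !normrM !exprMn -mulrDr -mulrA [leRHS]mulrCA ler_wpM2l// [leRHS]mulrA.
  apply: ler_wpM2r; last by move: key; rewrite exprMn.
  by rewrite addr_ge0 ?exprn_ge0.
have sqle : (sobolev_sqnorm Y tau g <= (A ^+ 2)%:E * sobolev_sqnorm Y sigma f)%E.
  rewrite /sobolev_sqnorm -nneseriesZl; last by move=> l _; rewrite lee_fin; exact: w0.
  apply: lee_nneseries => [i _ _|i _].
    by rewrite lee_fin; exact: w0.
  by rewrite -EFinM lee_fin; exact: wle.
have sq0 t h : (0 <= sobolev_sqnorm Y t h)%E.
  by apply: nneseries_ge0 => l _ _; rewrite lee_fin; exact: w0.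
have [gfin gle] := sqrt_fine_le A0 (sq0 tau g) (sq0 sigma f) fsob sqle.
by split.
Qed.
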